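(* Let $n\geqslant 4$ and let $a,b>0$ be integers with $a+b=n$. Let $W_n$ be the Weyl group of type $\mathrm{D}_n$ and $W_aW_b\leqslant W_n$ its reflection subgroup of type $\mathrm{D}_a\mathrm{D}_b$, with irreducible characters labelled as in the context. Let $E=A\boxtimes B\in\mathrm{Irr}(W_aW_b)$ be an irreducible character, and let $\alpha=(\alpha_1;\alpha_2)$ and $\beta=(\beta_1;\beta_2)$ be bipartitions of $a$ and $b$ respectively such that $A=\overline{[\alpha_1;\alpha_2]}_{\pm}$ and $B=\overline{[\beta_1;\beta_2]}_{\pm}$ (the signs for $A$ and $B$ being independent). Let $X\in\mathrm{Irr}(W_n)$ be an irreducible character and let $\gamma=(\gamma_1;\gamma_2)$ be a bipartition of $n$ such that $X=\overline{[\gamma_1;\gamma_2]}_{\pm}$. Then $$\langle\mathrm{Ind}_{W_aW_b}^{W_n}(E),X\rangle_{W_n}=\begin{cases} a_{\alpha\beta}^{\gamma} & \text{if } X \text{ is non-degenerate},\\ \tfrac12\left(a_{\alpha\beta}^{\gamma}+\varepsilon(A)\varepsilon(B)\varepsilon(X)\,c_{\alpha_1\beta_1}^{\gamma_1}\right) & \text{if } X \text{ is degenerate}.\end{cases}$$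
   Context: **General notation.** Fix a field extension $\mathbb{K}\supseteq\mathbb{Q}$. For a finite Weyl group $G$, $\mathrm{Irr}(G)$ is the set of irreducible characters of $G$ over $\mathbb{K}$, and $\langle\chi,\psi\rangle_G=\dim\mathrm{Hom}_{\mathbb{K}G}(M_\chi,M_\psi)$ (with $M_\chi$ affording $\chi$), extended bilinearly. $\boxtimes$ denotes the external tensor product of characters of a direct product. A partition is a finite, possibly empty, weakly decreasing sequence of positive integers; $|\alpha|$ is the sum of its parts. A bipartition of $n$ is an ordered pair $(\alpha;\beta)$ of partitions with $|\alpha|+|\beta|=n$. For partitions $\alpha,\beta$, $\alpha\cup\beta$ is the partition obtained by sorting the concatenation of the two sequences. **Groups.** $\widetilde W_n$ is the Coxeter group of type $\mathrm{B}_n$ with generators $s_1,\dots,s_{n-1},t_n$, whose diagram is the path $s_1 - s_2 - \cdots - s_{n-1} - t_n$ with the edge $s_{n-1} - t_n$ labelled 4. It is the group of signed permutations of $n$ coordinates, with $s_i$ swapping coordinates $i,i+1$ and $t_n$ changing the sign of coordinate $n$. For $n>1$ set $s_n=t_ns_{n-1}t_n$ and $W_n=\langle s_1,\dots,s_n\rangle$, a Coxeter group of type $\mathrm{D}_n$ and a normal subgroup of index 2 in $\widetilde W_n$. For $n\leqslant1$, $W_n$ is the trivial subgroup of $\widetilde W_n$. For $n\geqslant4$ let $t_0=s_1s_2\cdots s_{n-1}t_ns_{n-1}\cdots s_2s_1$ (the sign change in coordinate 1) and $s_0=t_0s_1t_0\in W_n$. For $a,b>0$ with $a+b=n$, $W_aW_b\leqslant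 W_n$ is the subgroup generated by $\{s_0,\dots,s_n\}\setminus\{s_0,s_1\}$ if $a=1$, by $\{s_0,\dots,s_n\}\setminus\{s_{n-1},s_n\}$ if $a=n-1$, and by $\{s_0,\dots,s_n\}\setminus\{s_a\}$ otherwise. It is the internal direct product of $W_a$ (trivial if $a=1$, otherwise $\langle s_0,s_1,\dots,s_{a-1}\rangle$, acting on the first $a$ coordinates) and $W_b$ (trivial if $b=1$, otherwise $\langle s_{a+1},\dots,s_n\rangle$, acting on the last $b$ coordinates). **Characters.** For $\alpha$ a partition of $n$, $[\alpha]$ is the corresponding irreducible character of the symmetric group $\mathfrak{S}_n$ (standard labelling, $[(n)]$ trivial, $[(1^n)]$ the sign character). For a bipartition $(\alpha;\beta)$ of $n\geqslant1$ with $|\alpha|=k$, $|\beta|=l$, $[\alpha;\beta]\in\mathrm{Irr}(\widetilde W_n)$ is the standard labelling: it is the character induced from $\widetilde W_k\times\widetilde W_l$ of $\widetilde{[\alpha]}\boxtimes(\widetilde{[\beta]}\otimes\epsilon')$, where $\widetilde{[\,\cdot\,]}$ is inflation along $\widetilde W_m\to\mathfrak{S}_m$ (forgetting signs) and $\epsilon'$ is the linear character with value $-1$ on single sign changes and $1$ on the $s_i$. Let $\overline{[\alpha;\beta]}$ be the restriction of $[\alpha;\beta]$ to $W_n$; one has $\overline{[\alpha;\beta]}=\overline{[\beta;\alpha]}$. If $\alpha\neq\beta$ it is irreducible and is called non-degenerate. If $\alpha=\beta$ (so $n$ is even and $\alpha$ is a partition of $n/2$) then $\overline{[\alpha;\alpha]}=\overline{[\alpha;\alpha]}_++\overline{[\alpha;\alpha]}_-$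 with $\overline{[\alpha;\alpha]}_\pm$ distinct irreducible characters, called degenerate of type $\pm$. These are all the irreducible characters of $W_n$. One also writes $\overline{[\alpha;\beta]}_\pm$ when $\alpha\neq\beta$, in which case the sign is ignored. Set $\varepsilon(X)=0$ if $X$ is non-degenerate and $\varepsilon(X)=\pm1$ if $X$ is degenerate of type $\pm$ (the same definitions are used for characters of $W_a$ and $W_b$). **Labelling of the degenerate characters.** Let $H_n^+=\langle s_1,\dots,s_{n-2},s_{n-1}\rangle$ and $H_n^-=\langle s_1,\dots,s_{n-2},s_n\rangle$, both identified with $\mathfrak{S}_n$ by $s_i\mapsto(i,i+1)$ for $1\leqslant i\leqslant n-2$ and $s_{n-1},s_n\mapsto(n-1,n)$. For $\alpha$ a partition of $n/2$, $\overline{[\alpha;\alpha]}_\pm=j_{H_n^\pm}^{W_n}([\alpha\cup\alpha])$. Here $j$ is Lusztig–Macdonald–Spaltenstein induction with respect to the reflection representation $V$ of $W_n$: for a reflection subgroup $H$ and $\psi\in\mathrm{Irr}(H)$, let $d$ be the smallest degree such that $\psi$ occurs in $\mathrm{Sym}^d(V)$; if $\psi$ occurs there with multiplicity one (as it does in all cases used here), $j_H^{W_n}(\psi)$ is the unique irreducible constituent of $\mathrm{Ind}_H^{W_n}(\psi)$ that occurs in $\mathrm{Sym}^d(V)$. For the factors of $W_aW_b$ the degenerate characters (which exist only when the corresponding rank is even) are labelled in the same way, using the following copies of symmetric groups: in $W_a$, $H_a^+=\langle s_1,\dots,s_{a-1}\rangle$ and $H_a^-=t_0H_a^+t_0=\langle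 s_0,s_2,\dots,s_{a-1}\rangle$; in $W_b$, $H_b^+=\langle s_{a+1},\dots,s_{n-1}\rangle$ and $H_b^-=t_nH_b^+t_n=\langle s_{a+1},\dots,s_{n-2},s_n\rangle$. Here $H_a^+$ and $H_b^+$ are identified with symmetric groups in the obvious way, and $H_a^-$, $H_b^-$ via conjugation by $t_0$, $t_n$ respectively. So $\overline{[\alpha_1;\alpha_1]}_\pm=j_{H_a^\pm}^{W_a}([\alpha_1\cup\alpha_1])$, and similarly for $W_b$. **Coefficients.** For partitions $\lambda,\mu,\nu$ with $|\lambda|+|\mu|=|\nu|$, $c_{\lambda\mu}^{\nu}=\langle\mathrm{Ind}_{\mathfrak{S}_{|\lambda|}\times\mathfrak{S}_{|\mu|}}^{\mathfrak{S}_{|\nu|}}([\lambda]\boxtimes[\mu]),[\nu]\rangle$ is the Littlewood–Richardson coefficient (with $\mathfrak{S}_0$ the trivial group, so $c_{\lambda\emptyset}^{\nu}=c_{\emptyset\lambda}^{\nu}=\delta_{\lambda\nu}$); when $|\lambda|+|\mu|\neq|\nu|$, set $c_{\lambda\mu}^\nu=0$. For bipartitions $\alpha=(\alpha_1;\alpha_2)$ of $a$, $\beta=(\beta_1;\beta_2)$ of $b$, $\gamma=(\gamma_1;\gamma_2)$ of $n$, let $\mathfrak{S}_\alpha$ be the trivial group if $\alpha_1=\alpha_2$ and the group $\mathfrak{S}_2$ of permutations of $\{1,2\}$ if $\alpha_1\neq\alpha_2$; define $\mathfrak{S}_\beta$ likewise. Then $$a_{\alpha\beta}^{\gamma}=\sum_{\sigma\in\mathfrak{S}_\alpha}\sum_{\tau\in\mathfrak{S}_\beta}c_{\alpha_{\sigma(1)}\beta_{\tau(1)}}^{\gamma_1}\,c_{\alpha_{\sigma(2)}\beta_{\tau(2)}}^{\gamma_2},$$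 the sum being over those $\sigma,\tau$ with $|\gamma_i|=|\alpha_{\sigma(i)}|+|\beta_{\tau(i)}|$ for $i\in\{1,2\}$ (and $a_{\alpha\beta}^\gamma=0$ if there are none). *)

(* Defs.v *)
From HB Require Import structures.
From mathcomp Require Import all_boot all_order all_fingroup all_algebra.
From mathcomp Require Import mxrepresentation.
From mathcomp Require Import mpoly.
From Stdlib Require ClassicalEpsilon.

Set Implicit Arguments.
Unset Strict Implicit.
Unset Printing Implicit Defensive.

Import GroupScope GRing.Theory.
Local Open Scope ring_scope.

(* Characters over K of a subgroup G of gT are finite functions on gT that     *)
(* vanish outside G.                                                          *)
Section Characters.

Variables (K : fieldType) (gT : finGroupType).
Implicit Types (G H L : {group gT}) (chi psi : {ffun gT -> K}).

Definition reprchar G m (r : mx_representation K G m) : {ffun gT -> K} :=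
  [ffun x => if x \in G then \tr (r x) else 0].

Definition irrchar G chi : Prop :=
  exists m, exists2 r : mx_representation K G m,
    mx_irreducible r & chi = reprchar r.

(* Hom_KG(r1, r2): the row space of hom_mx r1 r2, under the mxvec encoding.    *)
Definition hom_mx G m1 m2 (r1 : mx_representation K G m1)
    (r2 : mx_representation K G m2) : 'M[K]_(m1 * m2) :=
  (\bigcap_(x in G) kermx (lin_mulmx (r1 x) - lin_mulmxr (r2 x)))%MS.

Lemma mem_hom_mxP G m1 m2 (r1 : mx_representation K G m1)
    (r2 : mx_representation K G m2) (M : 'M[K]_(m1, m2)) :
  reflect (forall x, x \in G -> r1 x *m M = M *m r2 x)
          (mxvec M <= hom_mx r1 r2)%MS.
Proof.
apply: (iffP sub_bigcapmxP) => homM x Gx; last first.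
  apply/sub_kermxP; rewrite mulmxBr !mul_rV_lin /= !mxvecK.
  by rewrite -linearB /= homM // subrr linear0.
have /sub_kermxP := homM x Gx.
rewrite mulmxBr !mul_rV_lin /= !mxvecK -linearB /=.
move/eqP; rewrite mxvec_eq0 subr_eq0; exact/eqP.
Qed.

Definition dim_hom G m1 m2 (r1 : mx_representation K G m1)
    (r2 : mx_representation K G m2) : nat := \rank (hom_mx r1 r2).

Definition mult_spec G chi psi (d : nat) : Prop :=
  exists m1 m2 (r1 : mx_representation K G m1) (r2 : mx_representation K G m2),
    [/\ chi = reprchar r1, psi = reprchar r2 & d = dim_hom r1 r2].

(* <chi, psi>_G; the value does not depend on the modules chosen to afford    *)
(* chi and psi, see mult_reprchar.                                            *)
Definition mult G chi psi : nat :=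
  ClassicalEpsilon.epsilon (inhabits 0%N) (mult_spec G chi psi).

Let mxtrace_idem m (P : 'M[K]_m) : P *m P = P -> \tr P = (\rank P)%:R.
Proof.
have := mulmx_base P; have := row_base_free P; have := col_base_full P.
move: (col_base P) (row_base P) => C R fullC freeR PE PP.
rewrite -[in LHS]PE mxtrace_mulC; suff -> : R *m C = 1%:M by rewrite mxtrace1.
have eqCR : C *m (R *m C *m R) = C *m (1%:M *m R).
  by rewrite mul1mx !mulmxA PE -mulmxA PE PP.
exact: row_free_inj freeR _ _ (row_full_inj fullC eqCR).
Qed.

Let mxtrace_sandwich m1 m2 (A : 'M[K]_m1) (B : 'M[K]_m2) :
  \tr (lin_mulmx A *m lin_mulmxr B) = \tr A * \tr B.
Proof.
rewrite /mxtrace (reindex _ (curry_mxvec_bij m1 m2)) /=.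
set F := lin_mulmx A *m lin_mulmxr B.
rewrite (eq_bigr (fun p =>
  F (mxvec_index p.1 p.2) (mxvec_index p.1 p.2))) => [|[i j] _ //].
rewrite -(pair_bigA _ (fun i j => F (mxvec_index i j) (mxvec_index i j))) /=.
rewrite big_distrl /=.
apply: eq_bigr => i _; rewrite big_distrr; apply: eq_bigr => j _ /=.
pose M : 'M[K]_(m1, m2) := delta_mx i j.
have -> : F (mxvec_index i j) (mxvec_index i j)
   = (A *m M *m B) i j.
  transitivity ((mxvec M *m F) 0 (mxvec_index i j)).
    by rewrite mxvec_delta -rowE [RHS]mxE.
  by rewrite /F mulmxA !mul_vec_lin mxvecE.
rewrite !mxE (bigD1 j) //= !mxE (bigD1 i) //= !mxE !eqxx mulr1.
rewrite big1 => [|k nki]; last by rewrite !mxE (negPf nki) mulr0.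
rewrite addr0 big1 ?addr0 // => k nkj; rewrite !mxE big1 ?mul0r // => l _.
by rewrite !mxE (negPf nkj) andbF mulr0.
Qed.

Lemma dim_homE G m1 m2 (r1 : mx_representation K G m1)
    (r2 : mx_representation K G m2) : [pchar K] =i pred0 ->
  (dim_hom r1 r2)%:R =
    (#|G|%:R)^-1 * \sum_(x in G) reprchar r1 x^-1%g * reprchar r2 x :> K.
Proof.
move=> charK.
have nzG : (#|G|%:R : K) != 0 by rewrite ((pcharf0P K).1 charK) -lt0n cardG_gt0.
pose P : 'M[K]_(m1 * m2) := (#|G|%:R)^-1 *:
  \sum_(x in G) lin_mulmx (r1 x^-1%g) *m lin_mulmxr (r2 x).
have PE (M : 'M_(m1, m2)) : mxvec M *m P =
    mxvec ((#|G|%:R)^-1 *: \sum_(x in G) r1 x^-1%g *m M *m r2 x).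
  rewrite /P -scalemxAr linearZ /=; congr (_ *: _).
  rewrite mulmx_sumr linear_sum; apply: eq_bigr => x _.
  by rewrite mulmxA !mul_vec_lin.
have PS (u : 'rV_(m1 * m2)) : (u *m P <= hom_mx r1 r2)%MS.
  rewrite -(vec_mxK u); move: (vec_mx u) => M; rewrite PE.
  apply/mem_hom_mxP => y Gy; rewrite -scalemxAr -scalemxAl; congr (_ *: _).
  rewrite mulmx_sumr mulmx_suml (reindex_inj (mulIg y)) /=.
  apply: eq_big => [x|x]; rewrite groupMr // => Gx.
  rewrite invMg !repr_mxM ?groupV // !mulmxA.
  by rewrite -repr_mxM ?groupV // mulgV repr_mx1 mul1mx.
have PI (u : 'rV_(m1 * m2)) : (u <= hom_mx r1 r2)%MS -> u *m P = u.
  rewrite -(vec_mxK u); move: (vec_mx u) => M /mem_hom_mxP homM.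
  rewrite PE (eq_bigr (fun _ => M)) => [|x Gx].
    by rewrite sumr_const -scaler_nat scalerA mulVf // scale1r.
  by rewrite -mulmxA -homM // mulmxA -repr_mxM ?groupV // mulVg repr_mx1 mul1mx.
have eqP : (P == hom_mx r1 r2)%MS.
  apply/andP; split; apply/row_subP => i; first by rewrite rowE PS.
  by rewrite -[row i _]PI ?row_sub // submxMl.
have idP : P *m P = P.
  by apply/row_matrixP => i; rewrite row_mul PI // rowE PS.
rewrite /dim_hom -(eqmxP eqP) -mxtrace_idem // mxtraceZ raddf_sum /=.
congr (_ * _); apply: eq_bigr => x Gx.
by rewrite mxtrace_sandwich !ffunE groupV Gx.
Qed.

Lemma mult_reprchar G m1 m2 (r1 : mx_representation K G m1)
    (r2 : mx_representation K G m2) : [pchar K] =i pred0 ->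
  mult G (reprchar r1) (reprchar r2) = dim_hom r1 r2.
Proof.
move=> charK; have : exists d, mult_spec G (reprchar r1) (reprchar r2) d.
  by exists (dim_hom r1 r2), m1, m2, r1, r2.
move/(ClassicalEpsilon.epsilon_spec (inhabits 0%N)).
case=> n1 [n2 [s1 [s2 [chi1 chi2 multE]]]]; rewrite /mult multE.
have /pcharf0P eqK0 := charK; have natK: injective (fun d => d%:R : K).
  move=> d e /eqP; wlog le_de: d e / (d <= e)%N => [IH|].
    by case/orP: (leq_total d e) => [/IH //|/IH IH']; rewrite eq_sym => /IH' ->.
  rewrite eq_sym -subr_eq0 -natrB // eqK0 subn_eq0 => le_ed.
  by apply/eqP; rewrite eqn_leq le_de.
by apply: natK; rewrite !dim_homE // chi1 chi2.
Qed.
Definition resf H chi : {ffun gT -> K} :=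
  [ffun x => if x \in H then chi x else 0].

Definition indf H G chi : {ffun gT -> K} :=
  [ffun x => if x \in G then
     (#|H|%:R)^-1 * \sum_(y in G | (x ^ y)%g \in H) chi (x ^ y)%g else 0].

(* For commuting H and L with trivial intersection: the external product of   *)
(* chi and psi, as a function on the internal direct product H <*> L.         *)
Definition boxprod H L chi psi : {ffun gT -> K} :=
  [ffun x => \sum_(u in H) \sum_(v in L | (u * v)%g == x) chi u * psi v].

End Characters.

Definition is_partition (l : seq nat) : bool := sorted geq l && (0 \notin l).

Definition is_bipartition (n : nat) (g : seq nat * seq nat) : bool :=
  [&& is_partition g.1, is_partition g.2 & sumn g.1 + sumn g.2 == n]%N.

Definition part_union (l1 l2 : seq nat) : seq nat := sort geq (l1 ++ l2).

(* Ordinals are 0-based: the 1-based coordinates k+1, ..., k+m.               *)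
Definition window (n k m : nat) : {set 'I_n} := [set i : 'I_n | k <= i < k + m]%N.

(* The irreducible character [l] of the symmetric group on the coordinates    *)
(* k+1, ..., k+|l|, afforded by the right ideal c_l K[S] of the group algebra  *)
(* generated by the Young symmetrizer c_l = (row sum) * (signed column sum)   *)
(* of the tableau of shape l filled row by row.                               *)
Section Specht.

Variables (K : fieldType) (n k : nat) (l : seq nat).

Definition symG : {group {perm 'I_n}} := Sym_group (window n k (sumn l)).

Definition same_row (i j : 'I_n) : bool :=
  reshape_index l (i - k) == reshape_index l (j - k).

Definition same_col (i j : 'I_n) : bool :=
  reshape_offset l (i - k) == reshape_offset l (j - k).

Definition row_stab : {set {perm 'I_n}} :=
  [set u in symG | [forall i in window n k (sumn l), same_row (u i) i]].

Definition col_stab : {set {perm 'I_n}} :=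
  [set u in symG | [forall i in window n k (sumn l), same_col (u i) i]].

Definition young_symmetrizer : 'rV[K]_#|symG| :=
  \sum_(u in row_stab) \sum_(v in col_stab)
    (-1) ^+ odd_perm v *: delta_mx 0 (gring_index symG (u * v)%g).

Definition specht_repr :=
  submod_repr (cyclic_mx_module (regular_repr K symG) young_symmetrizer).

Definition specht : {ffun {perm 'I_n} -> K} := reprchar specht_repr.

End Specht.

Definition LRcoef (K : fieldType) (l m nu : seq nat) : nat :=
  let n := sumn nu in
  if (sumn l + sumn m == n)%N then
    mult (symG n 0 nu)
      (indf (symG n 0 l <*> symG n (sumn l) m) (symG n 0 nu)
        (boxprod (symG n 0 l) (symG n (sumn l) m)
          (specht K n 0 l) (specht K n (sumn l) m)))
      (specht K n 0 nu)
  else 0%N.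

Definition orderings (g : seq nat * seq nat) : seq (seq nat * seq nat) :=
  if g.1 == g.2 then [:: g] else [:: g; (g.2, g.1)].

Definition acoef (K : fieldType) (al be ga : seq nat * seq nat) : nat :=
  (\sum_(p <- orderings al)
   \sum_(q <- orderings be | (sumn ga.1 == sumn p.1 + sumn q.1) &&
                             (sumn ga.2 == sumn p.2 + sumn q.2))
     LRcoef K p.1 q.1 ga.1 * LRcoef K p.2 q.2 ga.2)%N.

(* Signed permutations of n coordinates act on the points (i, b), the point   *)
(* (i, b) standing for (-1)^b e_i.                                            *)
Definition sperm (n : nat) := {perm ('I_n * bool)%type}.

Section Groups.

Variable n : nat.

Definition swap (i j : 'I_n) : sperm n :=
  (tperm (i, false) (j, false) * tperm (i, true) (j, true))%g.

Definition flip (i : 'I_n) : sperm n := tperm (i, false) (i, true).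

(* The sign change in the 1-based coordinate j; junk unless 1 <= j <= n.      *)
(* In particular gent n is t_n and gent 1 is t_0.                             *)
Definition gent (j : nat) : sperm n :=
  if (insub j.-1 : option 'I_n) is Some i then flip i else 1%g.

(* The swap of the 1-based coordinates i and i+1; junk unless 1 <= i < n.     *)
Definition adj_swap (i : nat) : sperm n :=
  match (insub i.-1 : option 'I_n), (insub i : option 'I_n) with
  | Some j, Some k => swap j k
  | _, _ => 1%g
  end.

(* s_0, s_1, ..., s_n                                                         *)
Definition gens (i : nat) : sperm n :=
  if i == 0%N then (gent 1 * adj_swap 1 * gent 1)%g
  else if i == n then (gent n * adj_swap n.-1 * gent n)%g
  else adj_swap i.

Definition genby (I : seq nat) : {group sperm n} :=
  <<[set:: [seq gens i | i <- I]]>>%G.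

(* The group of type B_m on the coordinates k+1, ..., k+m.                    *)
Definition Wtilde (k m : nat) : {group sperm n} :=
  <<[set:: [seq adj_swap i | i <- index_iota k.+1 (k + m)]] :|:
    (if m == 0%N then set0 else [set gent (k + m)])>>%G.

Definition Wfull : {group sperm n} :=
  if (1 < n)%N then genby (index_iota 1 n.+1) else 1%G.

Definition Hfull (minus : bool) : {group sperm n} :=
  genby (if minus then rcons (index_iota 1 n.-1) n else index_iota 1 n).

(* In what follows a + b = n.                                                 *)
Variables (a b : nat).

Definition WaWb : {group sperm n} :=
  genby [seq i <- iota 0 n.+1 |
    i \notin (if a == 1%N then [:: 0; 1]
              else if a == n.-1 then [:: n.-1; n] else [:: a])%N].

Definition Wleft : {group sperm n} :=
  if a == 1%N then 1%G else genby (iota 0 a).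

Definition Hleft (minus : bool) : {group sperm n} :=
  genby (if minus then 0%N :: index_iota 2 a else index_iota 1 a).

Definition Wright : {group sperm n} :=
  if b == 1%N then 1%G else genby (index_iota a.+1 n.+1).

Definition Hright (minus : bool) : {group sperm n} :=
  genby (if minus then rcons (index_iota a.+1 n.-1) n else index_iota a.+1 n).

End Groups.

Section SignedCharacters.

Variables (K : fieldType) (n : nat).

(* Forgets the signs; the default value is used only outside the group of     *)
(* signed permutations.                                                       *)
Definition unsign (w : sperm n) : {perm 'I_n} :=
  insubd (1%g : {perm 'I_n}) [ffun i => (w (i, false)).1].

Definition inflate (G : {group sperm n}) (chi : {ffun {perm 'I_n} -> K}) :
    {ffun sperm n -> K} :=
  [ffun w => if w \in G then chi (unsign w) else 0].

Definition epsilon' (w : sperm n) : K :=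
  \prod_(i : 'I_n) (-1) ^+ (w (i, false)).2.

(* [g.1; g.2], for the group of type B on the coordinates k+1, ..., k+m,      *)
(* where m = |g.1| + |g.2|.                                                   *)
Definition Bchar (k : nat) (g : seq nat * seq nat) : {ffun sperm n -> K} :=
  let p := sumn g.1 in
  let q := sumn g.2 in
  let U := Wtilde n k p in
  let V := Wtilde n (k + p) q in
  indf (U <*> V) (Wtilde n k (p + q))
    (boxprod U V (inflate U (specht K n k g.1))
       [ffun w => inflate V (specht K n (k + p) g.2) w * epsilon' w]).

Definition reflection_mx (w : sperm n) : 'M[K]_n :=
  \matrix_(i, j) ((w (i, false) == (j, false))%:R -
                  (w (i, false) == (j, true))%:R).

Definition linear_subst (w : sperm n) (p : {mpoly K[n]}) : {mpoly K[n]} :=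
  p \mPo [tuple \sum_(j : 'I_n) reflection_mx w i j *: 'X_j | i < n].

(* The character of G on Sym^d(V), V being the span of the coordinates        *)
(* k+1, ..., k+m: the trace of the substitution in the basis of monomials.    *)
Definition symchar (G : {group sperm n}) (k m d : nat) : {ffun sperm n -> K} :=
  [ffun w => if w \in G then
     \sum_(e : 'X_{1..n < d.+1} |
           (mdeg e == d) && [forall i, (e i != 0)%N ==> (i \in window n k m)])
       (linear_subst w 'X_[e])@_e
   else 0].

Definition j_constituent (k m d : nat) (H W : {group sperm n})
    (psi X : {ffun sperm n -> K}) : Prop :=
  [/\ irrchar W X, (0 < mult W (indf H W psi) X)%N
    & (0 < mult W X (symchar W k m d))%N].

(* X = j_H^W(psi) with respect to the span of the coordinates k+1, ..., k+m.  *)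
Definition is_j_induced (k m : nat) (H W : {group sperm n})
    (psi X : {ffun sperm n -> K}) : Prop :=
  exists d : nat,
    [/\ forall e, (e < d)%N -> mult H psi (symchar H k m e) = 0%N,
        mult H psi (symchar H k m d) = 1%N,
        j_constituent k m d H W psi X
      & forall Y, j_constituent k m d H W psi Y -> Y = X].

(* X is the irreducible character of W, of type D on the coordinates          *)
(* k+1, ..., k+m, labelled by g and, when g.1 = g.2, by the sign s (true for   *)
(* minus), with respect to the subgroups H false = H^+ and H true = H^-; these *)
(* are identified with the symmetric group by forgetting signs.               *)
Definition has_label (k m : nat) (W : {group sperm n})
    (H : bool -> {group sperm n}) (g : seq nat * seq nat) (s : bool)
    (X : {ffun sperm n -> K}) : Prop :=
  if g.1 == g.2 then
    [/\ irrchar W X, (0 < mult W (resf W (Bchar k g)) X)%N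
      & is_j_induced k m (H s) W
          (inflate (H s) (specht K n k (part_union g.1 g.1))) X]
  else X = resf W (Bchar k g).

End SignedCharacters.

(* The value epsilon(X) for X labelled by g and s.                            *)
Definition eps (g : seq nat * seq nat) (s : bool) : rat :=
  if g.1 == g.2 then (-1) ^+ s else 0.

(* Main.v *)
Require Import Defs.
From mathcomp Require Import all_boot all_order all_fingroup all_algebra.
From mathcomp Require Import mxrepresentation pgroup ring zify.

Set Implicit Arguments.
Unset Strict Implicit.
Unset Printing Implicit Defensive.

Import GRing.Theory.
Local Open Scope ring_scope.

(** Every character in sight is afforded by an explicit idempotent of a group
    algebra.  If z is an idempotent of K[G], the right ideal z K[G] affords
    [ch G z], the function x |-> sum_g z((x^-1)^g), and pairing it with a class
    function f is evaluation of f at z ([ip_ch]).  For symmetric groups z is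
    the normalised Young symmetrizer e_l of a diagram l, and a
    Littlewood-Richardson coefficient is the value of the character of the
    third diagram at the product of the idempotents of the other two
    ([LRcoefE]).

    For a pair of diagrams, let T be the disjoint union T1 + T2 of their sets
    of cells, coloured by the summand.  A signed permutation of T is a
    permutation v together with the set S of coordinates where the sign
    changes.  The idempotent of [l1;l2] is the product of e_l1 and e_l2 times
    the average of the sign changes against the linear character
    lambda(S) = (-1)^|S meet T2|; averaging over the even S gives the
    restriction R to type D ([Bchar_Phi], [ch_zfun]).  If l1 = l2 = l, the
    permutation sw exchanging the two copies of l commutes with this
    idempotent, because lambda is unchanged on even sets when the colours are
    exchanged.  Cutting with (1 + sw)/2 and (1 - sw)/2 splits R as
    (R + D)/2 + (R - D)/2, and <R, R> = 2 shows that both halves are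
    irreducible, so these are the two degenerate characters
    ([irrchar_Xpm]).  To tell them apart, recall that the definition by
    j-induction makes the character of type + or - a constituent of the
    character induced by [l u l] from the corresponding symmetric group.
    Stacking two copies of l gives, up to the order of the rows, a tableau of
    shape l u l, and sw preserves its columns; since sw has sign (-1)^|l|,
    e_(l u l) x (e_l e_l) sw = (-1)^|l| e_(l u l) x (e_l e_l) for every x
    ([double_sign]).  Hence the character of type s is
    (R + (-1)^|l| s D)/2 ([label_deg]).

    By Frobenius reciprocity the multiplicity is <A x B, X>, the value of X at
    the product of the idempotents of A and B.  It is a sum over permutations
    y of the coordinates, coming from the expansion of X.  The average over
    even sign changes on the first a coordinates kills every y, except those
    that carry the colouring of A to the colouring of X or to its opposite, and
    likewise for B ([avg_even]); the choices between the two possibilities are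
    the permutations sigma and tau of the statement.  For each choice the part
    of the sum coming from the three R factors into two Littlewood-Richardson
    coefficients ([aligned_FR]).  The part coming from the three D collapses
    to a single one, because e_l e_l = e_l ([aligned_FD]).  Products mixing
    R and D vanish: a permutation cannot both preserve and exchange colours
    ([aligned_mixed]).  The signs (-1)^|l| of three degenerate characters
    cancel since the sizes of the diagrams add up, and the factors 1/2 account
    for the repetitions when alpha1 = alpha2 or beta1 = beta2
    ([triple_labelled]). *)

(** * Characters and their inner product *)

Section Sandwich.
Variable K : fieldType.

(** The trace of M |-> A M B on a space of matrices: in the basis of matrix
    units the diagonal entries are products of diagonal entries of A and B. *)
Lemma mxtrace_sandwich m1 m2 (A : 'M[K]_m1) (B : 'M[K]_m2) :
  \tr (lin_mulmx A *m lin_mulmxr B) = \tr A * \tr B.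
Proof.
have diagE i j : (lin_mulmx A *m lin_mulmxr B) (mxvec_index i j)
    (mxvec_index i j) = A i i * B j j.
  transitivity (row (mxvec_index i j) (lin_mulmx A *m lin_mulmxr B) 0
                  (mxvec_index i j)); first by rewrite [RHS]mxE.
  rewrite rowE -mxvec_delta mulmxA !mul_vec_lin mxvecE /=.
  rewrite -(mul_delta_mx (0 : 'I_1)) mulmxA -colE -mulmxA -rowE.
  by rewrite mxE big_ord1 !mxE.
rewrite {1}/mxtrace (reindex _ (curry_mxvec_bij m1 m2)) /=.
rewrite (eq_bigr (fun p => A p.1 p.1 * B p.2 p.2)) => [|[i j] _]; last exact: diagE.
rewrite -(pair_bigA _ (fun i j => A i i * B j j)) /= mulr_suml.
by apply: eq_bigr => i _; rewrite mulr_sumr.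
Qed.
End Sandwich.

Section CharTheory.

Variables (K : fieldType) (gT : finGroupType).
Hypothesis charK : [pchar K] =i pred0.
Implicit Types (G H L : {group gT}) (chi psi : {ffun gT -> K}) (z : gT -> K).

Definition is_char G chi := exists m (r : mx_representation K G m), chi = reprchar r.

(** The bilinear form that computes multiplicities over any field of
    characteristic 0, splitting or not; see [mult_ip]. *)
Definition ip G (f g : gT -> K) : K :=
  (#|G|%:R)^-1 * \sum_(x in G) f x^-1%g * g x.

Definition classfun G (f : gT -> K) := {in G &, forall x y, f (x ^ y)%g = f x}.

Lemma natrK_inj : injective (fun d => d%:R : K).
Proof.
have /pcharf0P eqK0 := charK; move=> d e /eqP.
wlog le_de: d e / (d <= e)%N => [IH|].
  by case/orP: (leq_total d e) => [/IH //|/IH IH']; rewrite eq_sym => /IH' ->.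
rewrite eq_sym -subr_eq0 -natrB // eqK0 subn_eq0 => le_ed.
by apply/eqP; rewrite eqn_leq le_de.
Qed.

Lemma natrK_neq0 d : (0 < d)%N -> d%:R != 0 :> K.
Proof. by rewrite ((pcharf0P K).1 charK) -lt0n. Qed.

Lemma cardK_neq0 G : #|G|%:R != 0 :> K.
Proof. exact/natrK_neq0/cardG_gt0. Qed.

Lemma irrchar_char G chi : irrchar G chi -> is_char G chi.
Proof. by case=> m [r _ ->]; exists m, r. Qed.

Lemma ip_dim_hom G m1 m2 (r1 : mx_representation K G m1)
    (r2 : mx_representation K G m2) :
  ip G (reprchar r1) (reprchar r2) = (dim_hom r1 r2)%:R.
Proof. by rewrite dim_homE. Qed.

Lemma mult_ip G chi psi : is_char G chi -> is_char G psi ->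
  (mult G chi psi)%:R = ip G chi psi.
Proof.
by move=> [m1 [r1 ->]] [m2 [r2 ->]]; rewrite mult_reprchar // ip_dim_hom.
Qed.

Lemma classfun_char G chi : is_char G chi -> classfun G chi.
Proof.
case=> m [r ->] x y Gx Gy; rewrite !ffunE groupJ // Gx.
rewrite conjgE !repr_mxM ?groupM ?groupV // mxtrace_mulC -mulmxA.
by rewrite -repr_mxM ?groupV // mulgV repr_mx1 mulmx1.
Qed.

Lemma ipC G f g : ip G f g = ip G g f.
Proof.
rewrite /ip (reindex_inj invg_inj) /=; congr (_ * _).
by apply: eq_big => [x|x _]; rewrite ?groupV // invgK mulrC.
Qed.

Lemma eq_ip G f f' g g' : {in G, f =1 f'} -> {in G, g =1 g'} ->
  ip G f g = ip G f' g'.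
Proof.
move=> eqf eqg; congr (_ * _); apply: eq_bigr => x Gx.
by rewrite eqf ?groupV // eqg.
Qed.

Lemma ip_linl G f f' g a b :
  ip G (fun x => a * f x + b * f' x) g = a * ip G f g + b * ip G f' g.
Proof.
rewrite /ip !(mulrCA _ _^-1) -mulrDr !mulr_sumr -big_split /= mulr_sumr.
by apply: eq_bigr => x _; rewrite mulrDl !mulrA.
Qed.

Lemma ip_linr G f g g' a b :
  ip G f (fun x => a * g x + b * g' x) = a * ip G f g + b * ip G f g'.
Proof. by rewrite ipC ip_linl !(ipC _ f). Qed.

(** Frobenius reciprocity. *)
Lemma indf_ip G H f g : H \subset G -> (forall x, x \notin H -> f x = 0) ->
  classfun G g -> ip G (indf H G (finfun f)) g = ip H f g.
Proof.
move=> sHG f_out cg; rewrite /ip.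
transitivity ((#|G|%:R)^-1 * ((#|H|%:R)^-1 *
   \sum_(x in G) \sum_(y in G) f (x^-1 ^ y)%g * g (x ^ y)%g)).
  congr (_ * _); rewrite mulr_sumr; apply: eq_bigr => x Gx.
  rewrite ffunE groupV Gx -mulrA; congr (_ * _).
  rewrite big_mkcondr mulr_suml; apply: eq_bigr => y Gy.
  rewrite ffunE; case: ifPn => [_|/f_out->]; last by rewrite !mul0r.
  by rewrite cg.
rewrite exchange_big /= mulrCA; congr (_ * _).
rewrite (eq_bigr (fun _ => \sum_(x in H) f x^-1%g * g x)) => [|y Gy].
  by rewrite sumr_const -[X in _ * X]mulr_natl mulKf ?cardK_neq0.
rewrite (reindex_inj (conjg_inj y^-1%g)) /=.
under eq_bigr do rewrite -conjVg conjgKV conjgKV.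
rewrite (eq_bigl (mem G)) => [|x]; last by rewrite memJ_norm ?groupV // (subsetP (normG G)).
rewrite (big_setID H) /= (setIidPr sHG) [X in _ + X]big1 ?addr0 // => x.
by case/setDP=> _ Hx; rewrite f_out ?mul0r // groupV.
Qed.

(** An idempotent is the composite of the projection onto its image with the
    inclusion; B is a basis of the image and C gives the coordinates. *)
Lemma idem_factor m (P : 'M[K]_m) : P *m P = P ->
  exists n (C : 'M[K]_(m, n)) (B : 'M[K]_(n, m)),
    C *m B = P /\ B *m C = 1%:M.
Proof.
move=> PP; exists (\rank P), (col_base P), (row_base P).
have := mulmx_base P; have := row_base_free P; have := col_base_full P.
move: (col_base P) (row_base P) => C R fullC freeR PE; split=> //.
have eqCR : C *m (R *m C *m R) = C *m (1%:M *m R).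
  by rewrite mul1mx !mulmxA PE -mulmxA PE PP.
exact: row_free_inj freeR _ _ (row_full_inj fullC eqCR).
Qed.

(** An idempotent commuting with the action cuts out a subrepresentation, whose
    character is the trace of the action composed with the idempotent. *)
Lemma is_char_idem G m (r : mx_representation K G m) (P : 'M_m) :
    P *m P = P -> {in G, forall x, P *m r x = r x *m P} ->
  is_char G [ffun x => if x \in G then \tr (P *m r x) else 0].
Proof.
move=> PP Pr; have [n [C [B [CB BC]]]] := idem_factor PP.
have PC : P *m C = C by rewrite -CB -mulmxA BC mulmx1.
have rP : mx_repr G (fun x => B *m r x *m C).
  split=> [|x y Gx Gy]; first by rewrite repr_mx1 mulmx1.
  rewrite repr_mxM // !mulmxA -[X in _ = X *m _]mulmxA -[X in _ = X *m _]mulmxA.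
  by rewrite (mulmxA C) CB -!mulmxA !(mulmxA P) Pr // -(mulmxA _ P) PC !mulmxA.
exists n, (MxRepresentation rP); apply/ffunP=> x; rewrite !ffunE.
by case: ifP => // Gx; rewrite -[in LHS]CB /= mxtrace_mulC !mulmxA mxtrace_mulC mulmxA.
Qed.

(** The same trace formula for a submodule given as the row space of an
    idempotent. *)
Lemma mxtrace_submod_idem G m (r : mx_representation K G m) (U P : 'M_m)
    (modU : mxmodule r U) x : x \in G ->
    P *m P = P -> (P :=: U)%MS -> \tr (submod_repr modU x) = \tr (P *m r x).
Proof.
move=> Gx PP PU; pose B := val_submod (1%:M : 'M_(\rank U)).
have PB : B *m P = B.
  have: (B <= P)%MS by rewrite PU val_submodP.
  by case/submxP=> D ->; rewrite -mulmxA PP.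
have [C CB] : exists C, P = C *m B.
  by apply/submxP; rewrite PU /B val_submod1.
have freeB : row_free B by rewrite /row_free val_submod1.
have BC : B *m C = 1%:M.
  by apply: (row_free_inj freeB); rewrite -mulmxA -CB PB mul1mx.
have Br : B *m r x = submod_repr modU x *m B.
  have := val_submodJ modU 1%:M Gx; rewrite mul1mx => <-.
  by rewrite val_submodE.
by rewrite CB -mulmxA Br [RHS]mxtrace_mulC -mulmxA BC mulmx1.
Qed.

End CharTheory.

(** * Characters of idempotents of the group algebra *)

Section Boxprod.

Variables (K : fieldType) (gT : finGroupType) (H L : {group gT}).
Hypothesis cHL : (L \subset 'C(H))%g.
Hypothesis tiHL : (H :&: L = 1)%g.

Lemma mul_inj u v u' v' : u \in H -> v \in L -> u' \in H -> v' \in L ->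
  (u * v == u' * v')%g = (u == u') && (v == v').
Proof.
move=> Hu Lv Hu' Lv'; apply/eqP/andP=> [uv|[/eqP-> /eqP->]//].
have : (u'^-1 * u \in H :&: L)%g.
  rewrite inE groupM ?groupV //=.
  suff -> : (u'^-1 * u = v' * v^-1)%g by rewrite groupM ?groupV.
  by rewrite -{1}[u](mulgK v) uv -!mulgA mulKg.
rewrite tiHL => /set1P u1; have/eqP uu: (u == u').
  by rewrite eq_sym eq_mulVg1 u1.
by move: uv; rewrite uu => /mulgI->; rewrite !eqxx.
Qed.

Lemma boxprodE (chi psi : {ffun gT -> K}) u v : u \in H -> v \in L ->
  boxprod H L chi psi (u * v)%g = chi u * psi v.
Proof.
move=> Hu Lv; rewrite ffunE (bigD1 u) //= [X in _ + X]big1 ?addr0; last first.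
  move=> u' /andP[Hu' nuu']; rewrite big1 // => v' /andP[Lv'].
  by rewrite mul_inj // (negPf nuu').
rewrite (bigD1 v) ?eqxx ?Lv //= big1 ?addr0 // => v' /andP[/andP[Lv']].
by rewrite mul_inj // eqxx /= => ->.
Qed.

Lemma boxprod_out (chi psi : {ffun gT -> K}) x : x \notin (H <*> L)%g ->
  boxprod H L chi psi x = 0.
Proof.
move=> xHL; rewrite ffunE big1 // => u Hu; rewrite big1 // => v /andP[Lv /eqP uv].
by case/negP: xHL; rewrite -uv cent_joinEr // mem_mulg.
Qed.

Lemma big_join (V : nmodType) (F : gT -> V) :
  \sum_(x in (H <*> L)%g) F x = \sum_(u in H) \sum_(v in L) F (u * v)%g.
Proof.
have -> : (H <*> L)%g = [set (p.1 * p.2)%g | p in setX H L].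
  apply/setP=> y; rewrite cent_joinEr //; apply/mulsgP/imsetP=> [[g h Hg Lh ->]|[[g h]]].
    by exists (g, h); rewrite ?inE ?Hg.
  by rewrite inE => /andP[Hg Lh] ->; exists g h.
rewrite big_imset /=; last first.
  move=> [g h] [g' h'] /setXP[Hg Lh] /setXP[Hg' Lh'] /= /eqP.
  by rewrite mul_inj // => /andP[/eqP-> /eqP->].
rewrite (eq_bigl (fun p => (p.1 \in H) && (p.2 \in L))) => [|p]; last by rewrite inE.
by rewrite -(pair_big (mem H) (mem L) (fun u v => F (u * v)%g)).
Qed.

Lemma card_join : #|(H <*> L)%g| = (#|H| * #|L|)%N.
Proof.
rewrite -[LHS]sum1_card big_join; under eq_bigr do rewrite sum1_card.
by rewrite sum_nat_const.
Qed.

End Boxprod.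

Section GroupAlgebra.

Variables (K : fieldType) (gT : finGroupType).
Hypothesis charK : [pchar K] =i pred0.
Implicit Types (G H L : {group gT}) (chi psi : {ffun gT -> K}) (z : gT -> K).

(** The action of the group algebra element with coefficients z. *)
Definition aeval G m (r : mx_representation K G m) z : 'M[K]_m :=
  \sum_(x in G) z x *: r x.

(** Idempotence is stated through all representations, which makes it easy to
    derive for products and for images under group morphisms. *)
Definition idem G z := forall m (r : mx_representation K G m),
  aeval r z *m aeval r z = aeval r z.

(** The character of the right ideal z K[G] when z is idempotent, see
    [is_char_ch]: the trace of right multiplication by x composed with left
    multiplication by z. *)
Definition ch G z : {ffun gT -> K} :=
  [ffun x => if x \in G then \sum_(g in G) z (x^-1 ^ g)%g else 0].

(** The matrix of the left regular action.  Its transpose acts on row vectors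
    and commutes with the right regular representation. *)
Definition lreg_mx G (h : gT) : 'M[K]_#|G| :=
  \matrix_(i, j) (enum_val i == h * enum_val j)%g%:R.

Lemma regular_mxE G h (i j : 'I_#|G|) : h \in G ->
  regular_mx K G h i j = (enum_val j == enum_val i * h)%g%:R.
Proof.
move=> Gh; rewrite !mxE eqxx /=; congr (_ %:R).
by rewrite -(inj_eq enum_val_inj) gring_indexK // groupM ?enum_valP.
Qed.

Lemma sum_enum_val_eq G (x : gT) (F : gT -> K) : x \in G ->
  \sum_(i < #|G|) (enum_val i == x)%:R * F (enum_val i) = F x.
Proof.
move=> Gx; rewrite (bigD1 (enum_rank_in Gx x)) //= enum_rankK_in // eqxx mul1r.
rewrite big1 ?addr0 // => i; rewrite -(inj_eq enum_val_inj) enum_rankK_in //.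
by move/negPf->; rewrite mul0r.
Qed.

Lemma lreg_mx_repr G : mx_repr G (lreg_mx G).
Proof.
split=> [|x y Gx Gy]; apply/matrixP=> i j; rewrite !mxE.
  by rewrite mul1g (inj_eq enum_val_inj).
under eq_bigr do rewrite !mxE mulrC.
rewrite (sum_enum_val_eq (fun w => (enum_val i == x * w)%g%:R)) ?mulgA //.
by rewrite groupM ?enum_valP.
Qed.
Definition lreg_repr G := MxRepresentation (lreg_mx_repr G).

Lemma lreg_comm G x y : x \in G -> y \in G ->
  (lreg_mx G x)^T *m regular_mx K G y = regular_mx K G y *m (lreg_mx G x)^T.
Proof.
move=> Gx Gy; apply/matrixP=> i j; rewrite !mxE.
under eq_bigr do rewrite regular_mxE // !mxE.
under [RHS]eq_bigr do rewrite regular_mxE // !mxE.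
rewrite (sum_enum_val_eq (fun w => (enum_val j == w * y)%g%:R)) ?groupM ?enum_valP //.
rewrite (sum_enum_val_eq (fun w => (enum_val j == x * w)%g%:R)) ?groupM ?enum_valP //.
by rewrite mulgA.
Qed.

Lemma mxtrace_lreg G x y : x \in G -> y \in G ->
  \tr ((lreg_mx G x)^T *m regular_mx K G y) =
    \sum_(g in G) (g == x * g * y)%g%:R.
Proof.
move=> Gx Gy; rewrite (big_enum_val (fun g => (g == x * g * y)%g%:R)) /=.
apply: eq_bigr => i _; rewrite mxE; under eq_bigr do rewrite regular_mxE // !mxE.
by rewrite (sum_enum_val_eq (fun w => (enum_val i == w * y)%g%:R)) ?groupM ?enum_valP.
Qed.

Lemma mxtrace_lreg_aeval G z x : x \in G ->
  \tr ((aeval (lreg_repr G) z)^T *m regular_mx K G x) = ch G z x.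
Proof.
move=> Gx; rewrite ffunE Gx /aeval linear_sum mulmx_suml linear_sum /=.
transitivity (\sum_(h in G) \sum_(g in G) z h * (g == h * g * x)%g%:R).
  apply: eq_bigr => h Gh; rewrite linearZ -scalemxAl linearZ /= mxtrace_lreg //.
  by rewrite mulr_sumr.
rewrite exchange_big (reindex_inj invg_inj) /=.
apply: eq_big => [g|g]; rewrite groupV // => Gg.
have Gxg : (x^-1 ^ g \in G)%g by rewrite groupJ ?groupV.
rewrite (bigD1 _ Gxg) /= big1 ?addr0 => [|h /andP[_ /negPf nh]].
  by rewrite conjgE -!mulgA mulKVg mulVg mulg1 eqxx mulr1.
suff -> : (g^-1 == h * g^-1 * x)%g = false by rewrite mulr0.
apply: contraFF nh => /eqP gE; apply/eqP; rewrite conjgE mulgA.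
by rewrite {1}gE mulgK mulgKV.
Qed.

Lemma is_char_ch G z : idem G z -> is_char G (ch G z).
Proof.
move=> zz; have -> : ch G z = [ffun x => if x \in G then
   \tr ((aeval (lreg_repr G) z)^T *m regular_repr K G x) else 0].
  apply/ffunP=> x; rewrite [RHS]ffunE; case: ifPn => [Gx|/negPf Gx].
    by rewrite mxtrace_lreg_aeval.
  by rewrite ffunE Gx.
apply: is_char_idem => [|x Gx]; first by rewrite -trmx_mul zz.
rewrite /aeval linear_sum mulmx_suml mulmx_sumr; apply: eq_bigr => h Gh.
by rewrite linearZ -scalemxAl -scalemxAr /= lreg_comm.
Qed.

Lemma aevalZ G m (r : mx_representation K G m) c z :
  aeval r (fun x => c * z x) = c *: aeval r z.
Proof. by rewrite /aeval scaler_sumr; apply: eq_bigr => x _; rewrite scalerA. Qed.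

(** The element z as a vector of the regular representation. *)
Definition gvec G z : 'rV[K]_#|G| := \sum_(x in G) z x *: delta_mx 0 (gring_index G x).

(** If z z = h z with h <> 0 then z/h is an idempotent generating the same right
    ideal as z. *)
Lemma cyclic_char G z h : h != 0 ->
    (forall m (r : mx_representation K G m),
       aeval r z *m aeval r z = h *: aeval r z) ->
  reprchar (submod_repr (cyclic_mx_module (regular_repr K G) (gvec G z))) =
    ch G (fun x => h^-1 * z x).
Proof.
move=> nzh zz; set U := cyclic_mx _ _.
pose P := (aeval (lreg_repr G) (fun x => h^-1 * z x))^T.
have rowP i : row i P = h^-1 *: (gvec G z *m regular_repr K G (enum_val i)).
  rewrite /P aevalZ linearZ linearZ /=; congr (_ *: _).
  rewrite /aeval /gvec linear_sum linear_sum mulmx_suml; apply: eq_bigr => x Gx /=.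
  rewrite linearZ linearZ -scalemxAl /=; congr (_ *: _).
  apply/rowP=> j; rewrite -rowE !mxE gring_indexK //=.
  by rewrite -(inj_eq enum_val_inj) gring_indexK ?groupM ?enum_valP.
have PP : P *m P = P.
  rewrite /P -trmx_mul aevalZ -scalemxAl -scalemxAr zz.
  by rewrite !scalerA -mulrA mulVf // mulr1.
have Pr x : x \in G -> P *m regular_repr K G x = regular_repr K G x *m P.
  move=> Gx; rewrite /P /aeval linear_sum mulmx_suml mulmx_sumr.
  apply: eq_bigr => g Gg.
  by rewrite linearZ -scalemxAl -scalemxAr /= lreg_comm.
have PU : (P :=: U)%MS.
  apply/eqmxP/andP; split.
    apply/row_subP=> i; rewrite rowP scalemx_sub // mxmodule_trans ?enum_valP //.
      exact: cyclic_mx_module.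
    exact: cyclic_mx_id.
  apply: cyclic_mx_sub.
    by apply/mxmoduleP=> x Gx; rewrite Pr // submxMl.
  have -> : gvec G z = h *: row (gring_index G 1) P.
    by rewrite rowP scalerA mulfV // scale1r gring_indexK // repr_mx1 mulmx1.
  by rewrite scalemx_sub // row_sub.
apply/ffunP=> x; rewrite [LHS]ffunE; case: ifPn => [Gx|/negPf Gx].
  by rewrite (mxtrace_submod_idem _ Gx PP PU) mxtrace_lreg_aeval.
by rewrite ffunE Gx.
Qed.

(** Pairing with the character of z K[G] is evaluation at z, since
    Hom(z K[G], M) = M z. *)
Lemma ip_ch G z f : classfun G f -> ip G (ch G z) f = \sum_(x in G) z x * f x.
Proof.
move=> cf; rewrite /ip.
transitivity ((#|G|%:R)^-1 * \sum_(x in G) \sum_(g in G) z (x ^ g)%g * f (x ^ g)%g).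
  congr (_ * _); apply: eq_bigr => x Gx; rewrite ffunE groupV Gx mulr_suml.
  by apply: eq_bigr => g Gg; rewrite invgK cf.
rewrite exchange_big /= (eq_bigr (fun _ => \sum_(x in G) z x * f x)).
  by rewrite sumr_const -[X in _ * X]mulr_natl mulKf ?cardK_neq0.
move=> g Gg; rewrite (reindex_inj (conjg_inj g^-1%g)) /=.
under eq_bigr do rewrite conjgKV.
by apply: eq_bigl => x; rewrite memJ_norm ?groupV // (subsetP (normG G)).
Qed.

(** Inducing the right ideal z K[H] gives the right ideal z K[G]. *)
Lemma indf_ch H G z : H \subset G -> (forall x, x \notin H -> z x = 0) ->
  indf H G (ch H z) = ch G z.
Proof.
move=> sHG z_out; apply/ffunP=> x; rewrite !ffunE; case: ifP => // Gx.
transitivity ((#|H|%:R)^-1 * \sum_(y in G) \sum_(h in H) z (x^-1 ^ (y * h))%g).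
  congr (_ * _); rewrite big_mkcondr; apply: eq_bigr => y Gy.
  rewrite ffunE; case Hxy: (_ \in H).
    by apply: eq_bigr => h _; rewrite -conjVg conjgM.
  rewrite big1 // => h Hh; rewrite z_out // conjgM conjVg.
  by rewrite memJ_norm ?groupV ?Hxy // (subsetP (normG H)).
rewrite exchange_big /= (eq_bigr (fun _ => \sum_(y in G) z (x^-1 ^ y)%g)).
  by rewrite sumr_const -[X in _ * X]mulr_natl mulKf ?cardK_neq0.
move=> h Hh; rewrite [RHS](reindex_inj (mulIg h)) /=.
by apply: eq_bigl => y; rewrite groupMr // (subsetP sHG).
Qed.

Lemma boxprod_ch H L z1 z2 : (L \subset 'C(H))%g -> (H :&: L = 1)%g ->
  boxprod H L (ch H z1) (ch L z2) =
    ch (H <*> L) (fun x => \sum_(u in H) \sum_(v in L | (u * v)%g == x) z1 u * z2 v).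
Proof.
move=> cHL tiHL.
have commHL u v : u \in H -> v \in L -> commute u v.
  by move=> Hu Lv; apply/esym/(centP (subsetP cHL v Lv)).
have conj_fix (a c : gT) : commute a c -> (a ^ c = a)%g.
  by move=> ac; rewrite conjgE ac mulKg.
apply/ffunP=> x; have [HLx|HLx] := boolP (x \in (H <*> L)%g); last first.
  by rewrite boxprod_out // ffunE (negPf HLx).
rewrite [RHS]ffunE HLx; move: HLx; rewrite /= cent_joinEr // => /mulsgP[u v Hu Lv ->].
rewrite boxprodE // -(cent_joinEr cHL) big_join // !ffunE Hu Lv mulr_suml.
apply: eq_bigr => g Hg; rewrite mulr_sumr; apply: eq_bigr => h Lh.
have -> : (((u * v)^-1) ^ (g * h) = (u^-1 ^ g) * (v^-1 ^ h))%g.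
  rewrite (commHL _ _ Hu Lv) invMg conjMg; congr (_ * _)%g; rewrite conjgM.
    by rewrite conj_fix //; apply: commHL; rewrite ?groupJ ?groupV.
  by congr (_ ^ h)%g; apply: conj_fix; apply/commute_sym/commHL; rewrite ?groupV.
transitivity (boxprod H L (finfun z1) (finfun z2) (u^-1 ^ g * v^-1 ^ h)%g).
  by rewrite boxprodE ?groupJ ?groupV // !ffunE.
by rewrite ffunE; apply: eq_bigr => u' _; apply: eq_bigr => v' _; rewrite !ffunE.
Qed.

End GroupAlgebra.

(** * Induced characters and irreducibility *)

Section Induction.

Variables (K : fieldType) (gT : finGroupType).
Hypothesis charK : [pchar K] =i pred0.
Implicit Types (G H L : {group gT}) (chi psi : {ffun gT -> K}) (z : gT -> K).

(** The map M |-> A M B on matrices, that is the tensor product of the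
    transpose of A with B. *)
Definition sandwich m1 m2 (A : 'M[K]_m1) (B : 'M[K]_m2) :=
  lin_mulmx A *m lin_mulmxr B.

Lemma mul_vec_sandwich m1 m2 (A : 'M[K]_m1) (B : 'M[K]_m2) M :
  mxvec M *m sandwich A B = mxvec (A *m M *m B).
Proof. by rewrite mulmxA !mul_vec_lin. Qed.

Lemma sandwichM m1 m2 (A1 A2 : 'M[K]_m1) (B1 B2 : 'M[K]_m2) :
  sandwich A1 B1 *m sandwich A2 B2 = sandwich (A2 *m A1) (B1 *m B2).
Proof.
apply/row_matrixP=> i; rewrite !rowE -[delta_mx 0 i]vec_mxK mulmxA.
by rewrite !mul_vec_sandwich !mulmxA.
Qed.

Lemma sandwich11 m1 m2 : sandwich (1%:M : 'M[K]_m1) (1%:M : 'M_m2) = 1%:M.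
Proof.
apply/row_matrixP=> i; rewrite !rowE -[delta_mx 0 i]vec_mxK.
by rewrite !mul_vec_sandwich mulmx1 mul1mx mulmx1.
Qed.

Lemma lreg_mx_tr G x : x \in G -> (lreg_mx K G x)^T = lreg_mx K G x^-1%g.
Proof.
move=> Gx; apply/matrixP=> i j; rewrite !mxE; congr (nat_of_bool _)%:R.
by apply/eqP/eqP=> ->; rewrite ?mulKg ?mulKVg.
Qed.

(** The induced module is realised as the H-invariants in the tensor product of
    the given module with K[G], where H acts on both factors and G acts on the
    second one by right multiplication.  The average P over H projects onto the
    invariants, and the trace of P composed with the action of G is the formula
    defining [indf]. *)
Lemma is_char_indf H G chi : H \subset G -> is_char H chi ->
  is_char G (indf H G chi).
Proof.
move=> sHG [m [r chiE]].
pose S h := sandwich (r h)^T (lreg_mx K G h).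
pose P := (#|H|%:R)^-1 *: \sum_(h in H) S h.
have SM : {in H &, forall h h', S h *m S h' = S (h * h')%g}.
  move=> h h' Hh Hh'; rewrite /S sandwichM -trmx_mul -repr_mxM //.
  by rewrite -(repr_mxM (lreg_repr K G)) ?(subsetP sHG).
have PP : P *m P = P.
  rewrite /P -scalemxAl -scalemxAr scalerA mulmx_suml.
  rewrite (eq_bigr (fun _ => \sum_(h in H) S h)) => [|h Hh].
    by rewrite sumr_const -[X in _ *: X]scaler_nat scalerA -mulrA mulVf ?mulr1 ?cardK_neq0.
  rewrite mulmx_sumr [RHS](reindex_inj (mulgI h)) /=.
  by apply: eq_big => [h'|h' Hh']; rewrite ?groupMl // SM.
have rR : mx_repr G (fun x => sandwich (1%:M : 'M_m) (regular_mx K G x)).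
  split=> [|x y Gx Gy]; first by rewrite (repr_mx1 (regular_repr K G)) sandwich11.
  by rewrite sandwichM mulmx1 -(repr_mxM (regular_repr K G)).
pose R := MxRepresentation rR.
suff -> : indf H G chi = [ffun x => if x \in G then \tr (P *m R x) else 0].
  apply: is_char_idem => // x Gx; rewrite /P /= -scalemxAl -scalemxAr.
  rewrite mulmx_suml mulmx_sumr; congr (_ *: _); apply: eq_bigr => h Hh.
  have Gh := subsetP sHG h Hh; rewrite !sandwichM mul1mx mulmx1; congr sandwich.
  by rewrite -[h]invgK -lreg_mx_tr ?groupV // lreg_comm ?groupV.
apply/ffunP=> x; rewrite !ffunE; case: ifP => // Gx.
rewrite -scalemxAl linearZ /=; congr (_ * _).
rewrite mulmx_suml linear_sum /= chiE.
transitivity (\sum_(h in H) \sum_(g in G) \tr (r h) * (g == h^-1 * g * x)%g%:R).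
  rewrite exchange_big big_mkcondr [RHS](reindex_inj invg_inj) /=.
  apply: eq_big => [y|y Gy]; rewrite ?groupV //.
  have hE h : (y^-1 == h^-1 * y^-1 * x)%g = (h == x ^ y)%g.
    rewrite -mulgA -(inj_eq (mulgI h)) mulKVg -(inj_eq (mulIg y)) mulgKV.
    by rewrite conjgE -mulgA.
  under [RHS]eq_bigr do rewrite hE.
  case: ifPn => [Hxy|Hxy].
    rewrite (bigD1 _ Hxy) /= ffunE Hxy eqxx mulr1 big1 ?addr0 // => h.
    by case/andP=> _ /negPf->; rewrite mulr0.
  rewrite big1 // => h Hh; suff /negPf-> : h != (x ^ y)%g by rewrite mulr0.
  by apply: contraNneq Hxy => <-.
apply: eq_bigr => h Hh; have Gh := subsetP sHG h Hh.
rewrite sandwichM mul1mx mxtrace_sandwich mxtrace_tr -mulr_sumr; congr (_ * _).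
by rewrite -[h in RHS]invgK -lreg_mx_tr ?groupV // mxtrace_lreg ?groupV.
Qed.

End Induction.

Section Schur.

Variables (K : fieldType) (gT : finGroupType).
Hypothesis charK : [pchar K] =i pred0.
Implicit Types (G H L : {group gT}) (chi psi : {ffun gT -> K}) (z : gT -> K).

(** Schur's lemma: a nonzero homomorphism between irreducible modules is an
    isomorphism. *)
Lemma irrchar_eq G chi psi : irrchar G chi -> irrchar G psi ->
  ip G chi psi != 0 -> chi = psi.
Proof.
case=> m1 [r1 irr1 ->] [m2 [r2 irr2 ->]]; rewrite ip_dim_hom //.
have [h0 | ] := eqVneq (hom_mx r1 r2) 0; first by rewrite /dim_hom h0 mxrank0 eqxx.
case/rowV0Pn=> u; rewrite -[u]vec_mxK; move: (vec_mx u) => M /mem_hom_mxP homM.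
rewrite mxvec_eq0 => nzM _.
have /mx_irrP[m1_gt0 sim1] := irr1; have /mx_irrP[m2_gt0 sim2] := irr2.
have freeM : row_free M.
  rewrite -kermx_eq0; apply: contraNT nzM => nzker; rewrite -[M]mul1mx.
  apply/eqP/sub_kermxP; rewrite sub1mx; apply: sim1 => //.
  apply/mxmoduleP=> x Gx; apply/sub_kermxP.
  by rewrite -mulmxA homM // mulmxA mulmx_ker mul0mx.
have fullM : row_full M.
  rewrite /row_full -(genmxE M); apply: sim2; last first.
    by rewrite -mxrank_eq0 genmxE mxrank_eq0.
  rewrite (eqmx_module _ (genmxE M)); apply/mxmoduleP=> x Gx.
  by rewrite -homM // submxMl.
have m12 : m1 = m2 by rewrite -(eqP fullM) (eqP freeM).
apply/ffunP=> x; rewrite !ffunE; case: ifP => // Gx.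
by apply: mxtrace_rsim Gx; exists M.
Qed.

(** By Maschke's theorem a reducible module has a projection onto a proper
    submodule, an endomorphism that is not a scalar. *)
Lemma irrchar_norm1 G chi : is_char G chi -> ip G chi chi = 1 -> irrchar G chi.
Proof.
case=> m [r ->]; rewrite ip_dim_hom // => /(natrK_inj charK (x2 := 1%N)) dim1.
exists m, r => //; apply/mx_irrP.
have hom1 : (mxvec 1%:M <= hom_mx r r)%MS.
  by apply/mem_hom_mxP=> x Gx; rewrite mulmx1 mul1mx.
have m_gt0 : (0 < m)%N.
  rewrite lt0n; apply: contra_eqN dim1 => /eqP m0.
  have : (dim_hom r r <= m * m)%N by apply: rank_leq_row.
  by move: (dim_hom r r) => d; rewrite m0 leqn0 => /eqP->.
split=> // U modU nzU.
have [|W modW addUW /mxdirect_addsP dxUW] := mx_Maschke_pchar r _ modU (submx1 U).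
  rewrite /pgroup pcharf'_nat; exact: cardK_neq0.
pose P := proj_mx U W.
have homP : (mxvec P <= hom_mx r r)%MS.
  have homP : (1%:M <= dom_hom_mx r P)%MS by rewrite -addUW proj_mx_hom.
  apply/mem_hom_mxP=> x Gx.
  by have := hom_mxP homP x Gx; rewrite !mul1mx.
have nz1 : mxvec (1%:M : 'M[K]_m) != 0.
  by rewrite mxvec_eq0 -mxrank_eq0 mxrank1 -lt0n.
have eq1 : (hom_mx r r <= mxvec (1%:M : 'M[K]_m))%MS.
  rewrite -(geq_leqif (mxrank_leqif_sup hom1)) -/(dim_hom r r) dim1.
  by rewrite lt0n mxrank_eq0.
have /sub_rVP[c] := submx_trans homP eq1; rewrite -linearZ => /(can_inj mxvecK) Pc.
have := proj_mx_id dxUW (submx_refl U); rewrite -/P Pc -scalemxAr mulmx1 => UcU.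
have c1 : c = 1.
  have /eqP : (c - 1) *: U = 0 by rewrite scalerBl scale1r UcU subrr.
  by rewrite scaler_eq0 (negPf nzU) orbF subr_eq0 => /eqP.
rewrite -sub1mx; have := proj_mx_sub U W (1%:M : 'M[K]_m).
by rewrite mul1mx -/P Pc c1 scale1r.
Qed.

(** The four pairings of chi and psi are natural numbers with sum 2, and the
    two diagonal ones are positive, so both are equal to 1. *)
Lemma irrchar_two G chi psi : is_char G chi -> is_char G psi ->
    chi 1%g != 0 -> psi 1%g != 0 ->
    ip G (fun x => chi x + psi x) (fun x => chi x + psi x) = 2%:R ->
  irrchar G chi.
Proof.
case=> m1 [r1 chiE] [m2 [r2 psiE]] nz1 nz2.
have dim_gt0 m (r : mx_representation K G m) : reprchar r 1%g != 0 ->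
    (0 < dim_hom r r)%N.
  rewrite ffunE group1 repr_mx1 mxtrace1 => nzm.
  have hom1 : (mxvec 1%:M <= hom_mx r r)%MS.
    by apply/mem_hom_mxP=> x Gx; rewrite mulmx1 mul1mx.
  apply: leq_trans (mxrankS hom1); rewrite lt0n mxrank_eq0 mxvec_eq0.
  by rewrite -mxrank_eq0 mxrank1; apply: contraNneq nzm => ->.
have ipE : ip G (fun x => chi x + psi x) (fun x => chi x + psi x) =
    (dim_hom r1 r1 + dim_hom r1 r2 + (dim_hom r2 r1 + dim_hom r2 r2))%:R.
  rewrite !natrD -!ip_dim_hom // -chiE -psiE.
  transitivity (ip G (fun x => 1 * chi x + 1 * psi x) (fun x => 1 * chi x + 1 * psi x)).
    by apply: eq_ip => x _; rewrite !mul1r.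
  by rewrite ip_linl !ip_linr !mul1r.
rewrite ipE => /(natrK_inj charK) dimE; apply: irrchar_norm1; first by exists m1, r1.
have := dim_gt0 _ r1; have := dim_gt0 _ r2; rewrite -chiE -psiE => /(_ nz2) d2 /(_ nz1) d1.
rewrite chiE ip_dim_hom //; suff -> : dim_hom r1 r1 = 1%N by []. 
move: d1 d2 dimE.
case: (dim_hom r1 r1) => [|[|d]] // _; case: (dim_hom r2 r2) => [|d'] // _.
by rewrite !addSn !addnS.
Qed.

End Schur.

(** * Young symmetrizers *)

Section Coefficients.

Variables (K : fieldType) (gT : finGroupType) (G : {group gT}).
Implicit Types (z : gT -> K).

(** Coefficients of group algebra elements are read off as matrix entries of the
    regular representation; this turns identities between operators into
    identities between coefficients. *)
Lemma aeval_regularE z v x : v \in G -> x \in G ->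
  aeval (regular_repr K G) z (gring_index G v) (gring_index G x) = z (v^-1 * x)%g.
Proof.
move=> Gv Gx; rewrite summxE (bigD1 (v^-1 * x)%g) ?groupM ?groupV //=.
rewrite mxE regular_mxE ?groupM ?groupV // !gring_indexK // mulKVg eqxx mulr1.
rewrite big1 ?addr0 // => y /andP[Gy ny]; rewrite mxE regular_mxE // !gring_indexK //.
suff /negPf-> : (x != v * y)%g by rewrite mulr0.
by apply: contraNneq ny => ->; rewrite mulKg.
Qed.

Lemma mul_aeval_mul m p q (r : mx_representation K G m) z
    (A : 'M_(p, m)) (B : 'M_(m, q)) :
  A *m aeval r z *m B = \sum_(x in G) z x *: (A *m r x *m B).
Proof.
rewrite /aeval mulmx_sumr mulmx_suml; apply: eq_bigr => x _.
by rewrite -scalemxAr -scalemxAl.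
Qed.

Lemma aeval_regular_mul z (M : 'M[K]_#|G|) j :
  (aeval (regular_repr K G) z *m M) (gring_index G 1) j =
    \sum_(v in G) z v * M (gring_index G v) j.
Proof.
rewrite mulmx_suml summxE; apply: eq_bigr => v Gv; rewrite -scalemxAl mxE.
congr (_ * _); rewrite mxE (bigD1 (gring_index G v)) //= regular_mxE //.
rewrite !gring_indexK // mul1g eqxx mul1r big1 ?addr0 // => i ni.
rewrite regular_mxE // gring_indexK // mul1g.
suff /negPf-> : enum_val i != v by rewrite mul0r.
by apply: contraNneq ni => <-; rewrite gring_valK.
Qed.

End Coefficients.

Section Young.

Variables (K : fieldType) (T : finType).
Hypothesis charK : [pchar K] =i pred0.
Variables (row col : T -> nat).

Let G := [set: {perm T}]%G.

(** The rows of a Young diagram are left justified.  Their lengths are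
    arbitrary, so that stacked diagrams are covered as well. *)
Definition left_justified :=
  injective (fun t => (row t, col t)) /\
  forall t j, (j < col t)%N -> exists2 t', row t' = row t & col t' = j.

Definition preserving (f : T -> nat) : {set {perm T}} :=
  [set u : {perm T} | [forall t, f (u t) == f t]].

Lemma preservingP f (u : {perm T}) :
  reflect (forall t, f (u t) = f t) (u \in preserving f).
Proof. by rewrite inE; apply: (iffP forallP) => fu t; apply/eqP. Qed.

Lemma preserving_group f : group_set (preserving f).
Proof.
apply/group_setP; split=> [|u v /preservingP fu /preservingP fv].
  by apply/preservingP=> t; rewrite perm1.
by apply/preservingP=> t; rewrite permM fv fu.
Qed.
Canonical preserving_groupType f := Group (preserving_group f).

Hypothesis ljT : left_justified.

(** In each row, the images under g of its cells lie in distinct columns, so at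
    most m of them are in the first m columns; and a left justified row has
    min(m, length) cells there. *)
Lemma card_row_le (g : {perm T}) k m :
    (forall i j, row i = row j -> col (g i) = col (g j) -> i = j) ->
  (#|[set i | (row i == k) && (col (g i) < m)]| <=
   #|[set i | (row i == k) && (col i < m)]|)%N.
Proof.
have [inj_rc lj] := ljT => inj_g.
have [/existsP[i /andP[/eqP rik mi]]|/existsPn small] :=
    boolP [exists i, (row i == k) && (m <= col i)]%N; last first.
  apply/subset_leq_card/subsetP=> i; rewrite !inE => /andP[rik _]; rewrite rik.
  by have := small i; rewrite rik /= -ltnNge.
apply: (@leq_trans m).
  rewrite -[leqRHS]card_ord; set A := [set i | _].
  pose f j : option 'I_m := insub (col (g j)).
  rewrite -[leqRHS]cardsT -(card_imset [set: 'I_m] (@Some_inj _)).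
  rewrite -(card_in_imset (f := f) (D := mem A)).
    apply/subset_leq_card/subsetP=> _ /imsetP[j + ->]; rewrite inE => /andP[_ jm].
    by apply/imsetP; exists (Ordinal jm); rewrite // /f insubT.
  move=> j j'; rewrite !inE => /andP[/eqP rj jm] /andP[/eqP rj' jm'].
  rewrite /f !insubT => -[cjj']; apply: inj_g => //.
  by rewrite rj.
have ex j : (j < m)%N -> exists t, (row t == k) && (col t == j).
  move=> jm; have [t rt ct] := lj i j (leq_trans jm mi).
  by exists t; rewrite rt ct rik !eqxx.
pose f (j : 'I_m) := xchoose (ex j (ltn_ord j)).
have fP j : row (f j) = k /\ col (f j) = j.
  by have /andP[/eqP ? /eqP ?] := xchooseP (ex j (ltn_ord j)).
have inj_f : injective f.
  by move=> j j' fjj'; apply: val_inj; rewrite /= -(proj2 (fP j)) fjj'; case: (fP j').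
rewrite -[leqLHS]card_ord -cardsT -(card_imset _ inj_f).
apply/subset_leq_card/subsetP=> _ /imsetP[j _ ->]; rewrite inE.
by have [-> ->] := fP j; rewrite eqxx /=.
Qed.

(** Summed over all rows, both sides count the cells in the first m columns, as
    g is a bijection; so none of the inequalities [card_row_le] is strict. *)
Lemma card_row_eq (g : {perm T}) k m :
    (forall i j, row i = row j -> col (g i) = col (g j) -> i = j) ->
  #|[set i | (row i == k) && (col (g i) < m)%N]| =
  #|[set i | (row i == k) && (col i < m)%N]|.
Proof.
move=> inj_g; pose N := (\max_i row i).+1.
have rowN i : (row i < N)%N by rewrite ltnS leq_bigmax.
have [kN|Nk] := ltnP k N; last first.
  by rewrite !eq_card0 // => i; rewrite !inE; apply/negbTE; rewrite negb_and;
    apply/orP; left; rewrite neq_ltn (leq_trans (rowN i) Nk).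
have sumE (P : pred T) : (\sum_(r < N) #|[set i | (row i == r) && P i]| = #|[set i | P i]|)%N.
  rewrite -sum1_card (partition_big (fun i => Ordinal (rowN i)) xpredT) //=.
  apply: eq_bigr => r _; rewrite -sum1_card; apply: eq_bigl => i.
  by rewrite !inE andbC -val_eqE.
have [_] := leqif_sum (P := xpredT) (fun (r : 'I_N) _ => leqif_eq (card_row_le r m inj_g)).
rewrite !sumE; have -> : #|[set i | (col (g i) < m)%N]| = #|[set i | (col i < m)%N]|.
  rewrite -(card_preimset [set i | (col i < m)%N] (@perm_inj _ g)).
  by apply: eq_card => i; rewrite !inE.
by rewrite eqxx => /esym/forallP/(_ (Ordinal kN))/eqP.
Qed.

(** Row by row, g sends as many cells to each column as there are in it, so the
    cells of each row can be permuted to reach the right columns first.  This is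
    the classical lemma of von Neumann on Young tableaux, proved by counting
    instead of by dominance of shapes. *)
Lemma row_col_factor (g : {perm T}) :
    (forall i j, row i = row j -> col (g i) = col (g j) -> i = j) ->
  exists2 u, u \in preserving row & exists2 v, v \in preserving col & g = (u * v)%g.
Proof.
move=> inj_g.
have ex i : exists t, (row t == row i) && (col t == col (g i)).
  (* compare the cells of the row of i, and their images under g, in the columns before and up to col (g i) *)
  pose N j (f : T -> nat) := #|[set t | (row t == row i) && (f t < j)%N]|.
  have NE : N (col (g i)) (col \o g) = N (col (g i)) col by apply: card_row_eq.
  have NE1 : N (col (g i)).+1 (col \o g) = N (col (g i)).+1 col by apply: card_row_eq.
  apply/existsP; apply: contraT; rewrite negb_exists => /forallP no_t.
  have : N (col (g i)).+1 col = N (col (g i)) col.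
    apply: eq_card => t; rewrite !inE ltnS leq_eqVlt.
    by have := no_t t; case: eqP => //= _ /negPf->.
  move: NE1; rewrite -NE => <- /eqP; rewrite eqn_leq => /andP[+ _]; rewrite leqNgt.
  case/negP; apply: proper_card; apply/properP; split.
    by apply/subsetP=> t; rewrite !inE => /andP[-> /= /leq_trans]; apply.
  by exists i; rewrite !inE eqxx /= ?ltnS ?ltnn.
pose f i := xchoose (ex i).
have fP i : row (f i) = row i /\ col (f i) = col (g i).
  by have /andP[/eqP ? /eqP ?] := xchooseP (ex i).
have inj_f : injective f.
  move=> i j fij; have [r1 c1] := fP i; have [r2 c2] := fP j.
  by apply: inj_g; [rewrite -r1 -r2 fij | rewrite -c1 -c2 fij].
exists (perm inj_f); first by apply/preservingP=> t; rewrite permE; case: (fP t).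
exists ((perm inj_f)^-1 * g)%g; last by rewrite mulKVg.
apply/preservingP=> t; rewrite permM.
by case: (fP ((perm inj_f)^-1 t)%g) => _ <-; rewrite -(permE inj_f) permKV.
Qed.

End Young.

Section YoungAlgebra.

Variables (K : fieldType) (T : finType).
Hypothesis charK : [pchar K] =i pred0.
Variables (row col : T -> nat).
Hypothesis ljT : left_justified row col.

Let G := [set: {perm T}]%G.
Let R := preserving row.
Let C := preserving col.

(** The Young symmetrizer is [rowsum] times [colsum].  They are used as operators
    on a representation, so that the sandwich identities below hold in every
    representation with the same scalar. *)
Definition rowsum m (r : mx_representation K [set: {perm T}]%G m) : 'M[K]_m :=
  \sum_(u in preserving row) r u.
Definition colsum m (r : mx_representation K [set: {perm T}]%G m) : 'M[K]_m :=
  \sum_(v in preserving col) (-1) ^+ odd_perm v *: r v.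
Definition young_elt (g : {perm T}) : K :=
  \sum_(u in preserving row) \sum_(v in preserving col | (u * v)%g == g) (-1) ^+ odd_perm v.

Section Rep.
Variables (m : nat) (r : mx_representation K [set: {perm T}]%G m).

Let rM x y : r (x * y)%g = r x *m r y.
Proof. by rewrite repr_mxM ?inE. Qed.

Lemma rowsum_r u : u \in R -> rowsum r *m r u = rowsum r.
Proof.
move=> Ru; rewrite /rowsum mulmx_suml [RHS](reindex_inj (mulIg u)).
by apply: eq_big => [x|x Rx]; rewrite ?rM // groupMr.
Qed.

Lemma rowsum_l u : u \in R -> r u *m rowsum r = rowsum r.
Proof.
move=> Ru; rewrite /rowsum mulmx_sumr [RHS](reindex_inj (mulgI u)).
by apply: eq_big => [x|x Rx]; rewrite ?rM // groupMl.
Qed.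

Lemma colsum_r v : v \in C -> colsum r *m r v = (-1) ^+ odd_perm v *: colsum r.
Proof.
move=> Cv; rewrite /colsum mulmx_suml [in RHS](reindex_inj (mulIg v)) /= scaler_sumr.
apply: eq_big => [x|x Cx]; rewrite ?groupMr // -scalemxAl rM scalerA odd_permM.
by rewrite signr_addb mulrCA -signr_addb addbb mulr1.
Qed.

Lemma colsum_l v : v \in C -> r v *m colsum r = (-1) ^+ odd_perm v *: colsum r.
Proof.
move=> Cv; rewrite /colsum mulmx_sumr [in RHS](reindex_inj (mulgI v)) /= scaler_sumr.
apply: eq_big => [x|x Cx]; rewrite ?groupMl // -scalemxAr rM scalerA odd_permM.
by rewrite signr_addb mulrA -signr_addb addbb mul1r.
Qed.

Lemma aeval_young : aeval r young_elt = rowsum r *m colsum r.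
Proof.
rewrite /aeval /young_elt mulmx_suml.
under eq_bigl do rewrite inE.
transitivity (\sum_(u in R) \sum_(v in C) \sum_(x | (u * v)%g == x)
                 (-1) ^+ odd_perm v *: r x).
  under eq_bigr do rewrite scaler_suml.
  rewrite exchange_big; apply: eq_bigr => u _.
  under eq_bigr do rewrite scaler_suml big_mkcondr.
  by rewrite exchange_big; apply: eq_bigr => v _; rewrite -big_mkcond.
apply: eq_bigr => u _; rewrite mulmx_sumr; apply: eq_bigr => v _.
rewrite (big_pred1 (u * v)%g) => [|x]; last by rewrite /= eq_sym.
by rewrite rM scalemxAr.
Qed.

End Rep.

Lemma self_opp_eq0 m (M : 'M[K]_m) : M = - M -> M = 0.
Proof.
move/eqP; rewrite -addr_eq0 -mulr2n -scaler_nat scaler_eq0.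
by rewrite (negPf (natrK_neq0 charK _)) //= => /eqP.
Qed.

Lemma tperm_preserving f i j : f i = f j -> tperm i j \in preserving (T := T) f.
Proof. by move=> fij; apply/preservingP=> t; case: tpermP => // ->. Qed.

(** If g is not a row permutation followed by a column permutation, two cells
    i and j of a row are sent to the same column, and their transposition is
    absorbed by the row sum with sign +1 and, after g, by the column sum with
    sign -1. *)
Lemma row_col_dichotomy (g : {perm T}) :
  (exists2 u, u \in R & exists2 v, v \in C & g = (u * v)%g) \/
  (exists i j, [/\ i != j, tperm i j \in R & (tperm i j ^ g)%g \in C]).
Proof.
case: (boolP [exists i, [exists j, [&& i != j, row i == row j & col (g i) == col (g j)]]]).
  case/existsP=> i /existsP[j /and3P[nij /eqP rij /eqP cij]]; right; exists i, j.
  by rewrite tpermJ !tperm_preserving.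
move=> none; left; apply: row_col_factor => // i j rij cij; apply/eqP.
apply: contraNT none => nij; apply/existsP; exists i; apply/existsP; exists j.
by rewrite nij rij cij !eqxx.
Qed.

Lemma row_x_col g : exists k, forall m (r : mx_representation K G m),
  rowsum r *m r g *m colsum r = k *: (rowsum r *m colsum r).
Proof.
have [[u Ru [v Cv ->]]|[i [j [nij Rij Cij]]]] := row_col_dichotomy g.
  exists ((-1) ^+ odd_perm v) => m r.
  by rewrite repr_mxM ?inE // mulmxA rowsum_r // -mulmxA colsum_l // scalemxAr.
exists 0 => m r; rewrite scale0r; apply: self_opp_eq0.
rewrite -{1}(rowsum_r r Rij) -!mulmxA (mulmxA (r (tperm i j))) -repr_mxM ?inE //.
have -> : (tperm i j * g = g * tperm i j ^ g)%g by rewrite conjgE mulKVg.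
rewrite repr_mxM ?inE // -mulmxA colsum_l // odd_permJ odd_tperm nij.
by rewrite scaleN1r !mulmxN.
Qed.

Lemma col_x_row g : exists k, forall m (r : mx_representation K G m),
  colsum r *m r g *m rowsum r = k *: (colsum r *m rowsum r).
Proof.
have [[u Ru [v Cv gE]]|[i [j [nij Rij Cij]]]] := row_col_dichotomy g^-1%g.
  exists ((-1) ^+ odd_perm v^-1%g) => m r.
  rewrite -[g]invgK gE invMg repr_mxM ?inE // mulmxA colsum_r ?groupV //.
  by rewrite -!scalemxAl -mulmxA rowsum_l ?groupV.
exists 0 => m r; rewrite scale0r; apply: self_opp_eq0.
rewrite -{1}(rowsum_l r Rij) mulmxA -(mulmxA _ (r g)) -repr_mxM ?inE //.
have -> : (g * tperm i j = tperm i j ^ g^-1 * g)%g by rewrite conjgE invgK mulgA mulgKV.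
rewrite repr_mxM ?inE // mulmxA colsum_r // odd_permJ odd_tperm nij.
by rewrite scaleN1r !mulNmx.
Qed.

(** The classical c x c = k c for the Young symmetrizer c = a b, from
    b x a = k1 b a and a (b a) b = k2 a b. *)
Lemma young_x_young g : exists k, forall m (r : mx_representation K G m),
  aeval r young_elt *m r g *m aeval r young_elt = k *: aeval r young_elt.
Proof.
have [k1 k1P] := col_x_row g.
have [k2 k2P] : exists k, forall m (r : mx_representation K G m),
   rowsum r *m colsum r *m (rowsum r *m colsum r) = k *: (rowsum r *m colsum r).
  have [k3 k3P] := fin_all_exists row_x_col.
  exists (\sum_(v in C) \sum_(u in R) (-1) ^+ odd_perm v * k3 (v * u)%g) => m r.
  have ba : colsum r *m rowsum r =
      \sum_(v in C) \sum_(u in R) (-1) ^+ odd_perm v *: r (v * u)%g.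
    rewrite /colsum mulmx_suml; apply: eq_bigr => v _.
    rewrite /rowsum mulmx_sumr; apply: eq_bigr => u _.
    by rewrite repr_mxM ?inE // scalemxAl.
  have := fun w => k3P w m r; move: (rowsum r) (colsum r) ba => A B ba k3r.
  rewrite -mulmxA (mulmxA B) ba mulmx_suml mulmx_sumr scaler_suml.
  apply: eq_bigr => v Cv; rewrite mulmx_suml mulmx_sumr scaler_suml.
  by apply: eq_bigr => u Ru; rewrite -scalemxAl -scalemxAr mulmxA k3r scalerA.
exists (k1 * k2) => m r; rewrite aeval_young.
transitivity (rowsum r *m (colsum r *m r g *m rowsum r) *m colsum r).
  by rewrite !mulmxA.
rewrite k1P -scalemxAr -scalemxAl -scalerA; congr (_ *: _); rewrite -k2P.
by rewrite !mulmxA.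
Qed.

(** The scalar in c c = [hook] c, read off as the coefficient of 1 in c c.  For
    the diagram of a partition it is the product of the hook lengths. *)
Definition hook : K := \sum_(x : {perm T}) young_elt x * young_elt x^-1%g.
Definition young_idem (g : {perm T}) : K := hook^-1 * young_elt g.

Lemma young_elt1 : young_elt 1%g = 1.
Proof.
rewrite /young_elt (bigD1 1%g) ?group1 //= (bigD1 1%g) ?group1 ?mulg1 ?eqxx //=.
rewrite odd_perm1 expr0 [X in _ + X + _]big1 ?addr0 => [|v]; last first.
  by case/andP=> /andP[_ /eqP]; rewrite mul1g => ->; rewrite eqxx.
rewrite big1 ?addr0 // => u /andP[Ru nu]; rewrite big1 // => v /andP[Cv /eqP uv].
case/negP: nu; apply/eqP/permP=> t; rewrite perm1; have [inj_rc _] := ljT.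
apply: inj_rc; rewrite (preservingP _ _ Ru); congr (_, _).
have -> : u = (v^-1)%g by rewrite -[u](mulgK v) uv mul1g.
by have := groupVr Cv => /preservingP.
Qed.

Lemma young_sq m (r : mx_representation K G m) :
  aeval r young_elt *m aeval r young_elt = hook *: aeval r young_elt.
Proof.
have [k kP] := young_x_young 1%g.
have zz n (r' : mx_representation K G n) :
    aeval r' young_elt *m aeval r' young_elt = k *: aeval r' young_elt.
  by rewrite -kP repr_mx1 mulmx1.
suff -> : hook = k by apply: zz.
have /matrixP/(_ (gring_index G 1) (gring_index G 1)) := zz _ (regular_repr K G).
rewrite aeval_regular_mul mxE aeval_regularE ?inE // mulg1 invg1 young_elt1 mulr1 => <-.
rewrite /hook; apply: eq_big => [x|x _]; first by rewrite inE.
by rewrite aeval_regularE ?inE // mulg1.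
Qed.

(** On the regular representation c has trace n!, since its coefficient at 1 is
    1, whereas c c = 0 would force trace 0. *)
Lemma hook_neq0 : hook != 0.
Proof.
pose A := aeval (regular_repr K G) young_elt.
apply/eqP=> hook0; have : A *m A = 0 by rewrite young_sq hook0 scale0r.
have : \tr A = #|G|%:R.
  rewrite /mxtrace (eq_bigr (fun _ => 1)) ?sumr_const ?card_ord // => i _.
  rewrite -[i]gring_valK aeval_regularE ?enum_valP //.
  by rewrite mulVg young_elt1.
move=> trA AA; suff trA0 : \tr A = 0.
  by move: (cardK_neq0 charK G); rewrite -trA trA0 eqxx.
have := mulmx_base A; have := row_base_free A; have := col_base_full A.
move: (col_base A) (row_base A) => B D fullB freeD AE.
rewrite -AE mxtrace_mulC; suff -> : D *m B = 0 by rewrite linear0.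
apply: (row_free_inj freeD); apply: (row_full_inj fullB).
rewrite mul0mx mulmx0; transitivity ((B *m D) *m (B *m D)).
  by rewrite !mulmxA.
by rewrite AE.
Qed.

Lemma young_idemP : idem G young_idem.
Proof.
move=> m r; rewrite aevalZ -scalemxAl -scalemxAr young_sq !scalerA -mulrA.
by rewrite mulVf ?hook_neq0 ?mulr1.
Qed.

Lemma young_idem_x g : exists k, forall m (r : mx_representation K G m),
  aeval r young_idem *m r g *m aeval r young_idem = k *: aeval r young_idem.
Proof.
have [k kP] := young_x_young g; exists (hook^-1 * k) => m r.
by rewrite aevalZ -!scalemxAl -scalemxAr kP !scalerA mulrAC.
Qed.

Lemma young_idem1_neq0 : young_idem 1%g != 0.
Proof. by rewrite /young_idem young_elt1 mulr1 invr_eq0 hook_neq0. Qed.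

Lemma young_idem_conv x : \sum_v young_idem v * young_idem (v^-1 * x)%g = young_idem x.
Proof.
have /matrixP/(_ (gring_index G 1) (gring_index G x)) := young_idemP (regular_repr K G).
rewrite aeval_regular_mul aeval_regularE ?inE // invg1 mul1g => <-.
apply: eq_big => [v|v _]; first by rewrite inE.
by rewrite aeval_regularE ?inE.
Qed.

(** The character of e K[S] has norm 1: writing e y e = k(y) e, both sides are
    computed by the coefficient of e in e e e. *)
Lemma young_idem_norm :
  \sum_v \sum_y young_idem v * young_idem (v^-1 ^ y)%g = 1.
Proof.
have [k kP] := fin_all_exists young_idem_x.
pose A := aeval (regular_repr K G) young_idem.
have nzA : A != 0.
  apply/eqP=> /matrixP/(_ (gring_index G 1) (gring_index G 1)).
  rewrite aeval_regularE ?inE // mxE mulVg => /eqP.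
  by rewrite (negPf young_idem1_neq0).
have sum_k : \sum_y young_idem y * k y = 1.
  suff : (\sum_y young_idem y * k y) *: A = 1 *: A.
    move/eqP; rewrite -subr_eq0 -scalerBl scaler_eq0 (negPf nzA) orbF subr_eq0.
    by move/eqP.
  rewrite scale1r; transitivity (A *m A *m A); last by rewrite /A !young_idemP.
  rewrite mul_aeval_mul scaler_suml; apply: eq_big => [v|v _].
    by rewrite inE.
  by rewrite kP scalerA.
rewrite exchange_big /= -sum_k; apply: eq_bigr => y _.
have /matrixP/(_ (gring_index G 1) (gring_index G y)) := kP y _ (regular_repr K G).
rewrite -mulmxA aeval_regular_mul mxE aeval_regularE ?inE // invg1 mul1g mulrC => <-.
apply: eq_big => [v|v _]; first by rewrite inE.
congr (_ * _); rewrite mxE (bigD1 (gring_index G (v * y)%g)) //= regular_mxE ?inE //.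
rewrite !gring_indexK ?inE // eqxx mul1r aeval_regularE ?inE //.
rewrite big1 ?addr0 => [|i ni].
  by rewrite conjgE invMg mulgA.
rewrite regular_mxE ?inE // gring_indexK ?inE //.
suff /negPf-> : (enum_val i != v * y)%g by rewrite mul0r.
by apply: contraNneq ni => <-; rewrite gring_valK.
Qed.

(** If t preserves the columns and normalises the row group, then t can be moved
    from the right of the row sum to its left, where b x a t = sgn(t) b x a
    because b x a is a scalar multiple of b a. *)
Lemma young_sign m (r : mx_representation K G m) g t (B : 'M[K]_m) :
    t \in C -> (R :^ t)%g = R -> B *m r t = r t *m B ->
  aeval r young_elt *m r g *m (rowsum r *m B) *m r t =
    (-1) ^+ odd_perm t *: (aeval r young_elt *m r g *m (rowsum r *m B)).
Proof.
move=> Ct Rt Bt; have [k kP] := col_x_row g.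
have at_comm : rowsum r *m r t = r t *m rowsum r.
  rewrite /rowsum mulmx_suml mulmx_sumr [LHS](reindex_inj (conjg_inj t^-1%g)) /=.
  apply: eq_big => [x|x Rx]; first by rewrite -mem_conjg Rt.
  by rewrite -!repr_mxM ?inE // conjgE invgK -!mulgA mulVg mulg1.
have bat : colsum r *m r g *m rowsum r *m r t =
    (-1) ^+ odd_perm t *: (colsum r *m r g *m rowsum r).
  rewrite kP -scalemxAl -mulmxA at_comm mulmxA colsum_r // -scalemxAl scalerA.
  by rewrite mulrC -scalerA.
rewrite aeval_young.
transitivity (rowsum r *m (colsum r *m r g *m rowsum r *m r t) *m B).
  by rewrite -!mulmxA Bt.
by rewrite bat -scalemxAr -scalemxAl !mulmxA.
Qed.

End YoungAlgebra.

(** * Permutations transported along injections *)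

Section Emb.

Variables (T1 T2 : finType).
Implicit Types (f : T1 -> T2) (u v : {perm T1}) (w y : {perm T2}).

Definition emb_fun f u (x : T2) : T2 :=
  if [pick i | f i == x] is Some i then f (u i) else x.

(** The permutation of T2 acting as u on the image of f and trivially elsewhere.
    It is meaningful when f is injective. *)
Definition emb f u : {perm T2} := insubd (1%g : {perm T2}) (finfun (emb_fun f u)).

Lemma emb_fun_in f u i : injective f -> emb_fun f u (f i) = f (u i).
Proof.
move=> inj_f; rewrite /emb_fun; case: pickP => [j /eqP/inj_f->//|].
by move/(_ i); rewrite eqxx.
Qed.

Lemma emb_fun_out f u x : x \notin codom f -> emb_fun f u x = x.
Proof.
move=> fx; rewrite /emb_fun; case: pickP => // i /eqP fi.
by case/negP: fx; rewrite -fi codom_f.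
Qed.

Lemma embE f u : injective f -> emb f u =1 emb_fun f u.
Proof.
move=> inj_f x; rewrite /emb -pvalE.
suff inj_e : injectiveb (finfun (emb_fun f u)) by rewrite -[pval _]/(val _) (insubdK (1%g : {perm T2}) inj_e) ffunE.
apply/injectiveP=> a b; rewrite !ffunE.
have [/codomP[i ->]|fa] := boolP (a \in codom f);
  have [/codomP[j ->]|fb] := boolP (b \in codom f).
- by rewrite !emb_fun_in // => /inj_f/perm_inj->.
- by rewrite emb_fun_in // emb_fun_out // => bE; case/negP: fb; rewrite -bE codom_f.
- by rewrite emb_fun_out // emb_fun_in // => aE; case/negP: fa; rewrite aE codom_f.
- by rewrite !emb_fun_out.
Qed.

Lemma emb_in f u i : injective f -> emb f u (f i) = f (u i).
Proof. by move=> inj_f; rewrite embE ?emb_fun_in. Qed.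

Lemma emb_out f u x : injective f -> x \notin codom f -> emb f u x = x.
Proof. by move=> inj_f fx; rewrite embE ?emb_fun_out. Qed.

Lemma emb_unique f u w : injective f -> (forall i, w (f i) = f (u i)) ->
  (forall x, x \notin codom f -> w x = x) -> w = emb f u.
Proof.
move=> inj_f w_in w_out; apply/permP=> x.
have [/codomP[i ->]|fx] := boolP (x \in codom f); first by rewrite emb_in.
by rewrite emb_out ?w_out.
Qed.

Lemma emb_onto f w : injective f -> (forall x, x \notin codom f -> w x = x) ->
  exists u, w = emb f u.
Proof.
move=> inj_f w_out.
have ex i : exists j, w (f i) == f j.
  suff /codomP[j ->] : w (f i) \in codom f by exists j.
  apply: contraT => nw; have /perm_inj wfi := w_out _ nw.
  by rewrite wfi codom_f in nw.
pose g i := xchoose (ex i).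
have gP i : w (f i) = f (g i) := eqP (xchooseP (ex i)).
have inj_g : injective g by move=> i j gij; apply/inj_f/(@perm_inj _ w); rewrite !gP gij.
by exists (perm inj_g); apply: emb_unique => // i; rewrite permE gP.
Qed.

Lemma emb1 f : injective f -> emb f 1 = 1%g.
Proof. by move=> inj_f; apply/esym/emb_unique => // [i|x _]; rewrite !perm1. Qed.

Lemma embM f u v : injective f -> emb f (u * v) = (emb f u * emb f v)%g.
Proof.
move=> inj_f; apply/esym/emb_unique => // [i|x fx]; first by rewrite !permM !emb_in.
by rewrite permM !emb_out.
Qed.

Lemma embV f u : injective f -> emb f u^-1 = (emb f u)^-1%g.
Proof.
by move=> inj_f; apply/eqP; rewrite eq_sym eq_invg_mul -embM // mulgV emb1.
Qed.

Lemma emb_inj f : injective f -> injective (emb f).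
Proof.
move=> inj_f u v uv; apply/permP=> i; apply: (inj_f).
by rewrite -(emb_in u i) ?uv ?emb_in.
Qed.

Lemma embJ f u y : injective f -> ((emb f u) ^ y)%g = emb (fun i => y (f i)) u.
Proof.
move=> inj_f; apply: emb_unique => [i j /perm_inj/inj_f//|i|x fx].
  by rewrite permJ emb_in.
rewrite -[x](permKV y) permJ emb_out //; apply: contra fx => /codomP[i yx].
by rewrite -[x](permKV y) yx codom_f.
Qed.

Lemma eq_emb f g u : f =1 g -> emb f u = emb g u.
Proof.
move=> fg; congr insubd; apply/ffunP=> x; rewrite !ffunE /emb_fun.
by rewrite (eq_pick (fun i => congr1 (eq_op^~ x) (fg i))); case: pickP.
Qed.

Lemma emb_tperm f i j : injective f -> emb f (tperm i j) = tperm (f i) (f j).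
Proof.
move=> inj_f; apply/esym/emb_unique => // [k|x fx]; first by rewrite inj_tperm.
by rewrite tpermD //; apply: contraNneq fx => <-; rewrite codom_f.
Qed.

Lemma emb_prod_tperm f u : injective f -> exists ts : seq (T1 * T1),
  emb f u = (\prod_(t <- ts) tperm (f t.1) (f t.2))%g /\ u = (\prod_(t <- ts) tperm t.1 t.2)%g.
Proof.
move=> inj_f; have [ts -> _] := prod_tpermP u; exists ts; split=> //.
by rewrite (big_morph (emb f) (fun u v => embM u v inj_f) (emb1 inj_f));
  apply: eq_bigr => t _; rewrite emb_tperm.
Qed.

Lemma odd_emb f u : injective f -> odd_perm (emb f u) = odd_perm u.
Proof.
move=> inj_f; have [ts [-> ->]] := emb_prod_tperm u inj_f.
elim: ts => [|[i j] ts IH]; first by rewrite !big_nil !odd_perm1.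
by rewrite !big_cons !odd_permM IH !odd_tperm (inj_eq inj_f).
Qed.

End Emb.

Section EmbComp.

Lemma emb_comp (T1 T2 T3 : finType) (f : T1 -> T2) (g : T2 -> T3) u :
  injective f -> injective g -> emb g (emb f u) = emb (fun i => g (f i)) u.
Proof.
move=> inj_f inj_g; apply: emb_unique => [i j /inj_g/inj_f//|i|x gfx].
  by rewrite !emb_in.
have [/codomP[j xE]|gx] := boolP (x \in codom g); last by rewrite emb_out.
rewrite xE emb_in // emb_out //; apply: contra gfx => /codomP[i jE].
by rewrite xE jE (codom_f (fun i => g (f i))).
Qed.

Lemma emb_commute (T1 T2 T : finType) (f : T1 -> T) (g : T2 -> T) u v :
    injective f -> injective g -> (forall i j, f i != g j) ->
  commute (emb f u) (emb g v).
Proof.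
move=> inj_f inj_g dis; apply/permP=> x; rewrite !permM.
have f_out i : f i \notin codom g.
  by apply/codomP=> -[j fg]; move: (dis i j); rewrite fg eqxx.
have g_out j : g j \notin codom f.
  by apply/codomP=> -[i fg]; move: (dis i j); rewrite fg eqxx.
have [/codomP[i ->]|fx] := boolP (x \in codom f).
  by rewrite emb_in // !(@emb_out _ _ g) ?emb_in.
have [/codomP[i ->]|gx] := boolP (x \in codom g).
  by rewrite (@emb_out _ _ f) // !emb_in // emb_out.
by rewrite !emb_out.
Qed.

Lemma emb_id (T : finType) (u : {perm T}) : emb id u = u.
Proof. by apply/esym/emb_unique => // x; rewrite codomE map_id mem_enum. Qed.

End EmbComp.

Section SumPerm.

Variables (T1 T2 : finType).

Lemma inl_inj : injective (@inl T1 T2). Proof. by move=> i j []. Qed.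
Lemma inr_inj : injective (@inr T1 T2). Proof. by move=> i j []. Qed.

Definition sumperm (u1 : {perm T1}) (u2 : {perm T2}) : {perm (T1 + T2)} := (emb inl u1 * emb inr u2)%g.

Lemma inl_out (i : T1) : inl i \notin codom (@inr T1 T2).
Proof. by apply/codomP=> -[]. Qed.
Lemma inr_out (i : T2) : inr i \notin codom (@inl T1 T2).
Proof. by apply/codomP=> -[]. Qed.

Lemma sumperm_inl u1 u2 i : sumperm u1 u2 (inl i) = inl (u1 i).
Proof. by rewrite permM (emb_in _ _ inl_inj) (emb_out _ inr_inj) ?inl_out. Qed.

Lemma sumperm_inr u1 u2 i : sumperm u1 u2 (inr i) = inr (u2 i).
Proof. by rewrite permM (emb_out _ inl_inj) ?inr_out // (emb_in _ _ inr_inj). Qed.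

Lemma sumperm_unique (w : {perm (T1 + T2)}) (u1 : {perm T1}) (u2 : {perm T2}) :
  (forall i, w (inl i) = inl (u1 i)) -> (forall i, w (inr i) = inr (u2 i)) ->
  w = sumperm u1 u2.
Proof.
by move=> wl wr; apply/permP=> -[i|i]; rewrite ?sumperm_inl ?sumperm_inr ?wl ?wr.
Qed.

Lemma sumpermM u1 u2 v1 v2 :
  (sumperm u1 u2 * sumperm v1 v2)%g = sumperm (u1 * v1) (u2 * v2).
Proof.
by apply: sumperm_unique => i; rewrite permM !(sumperm_inl, sumperm_inr) permM.
Qed.

Lemma sumperm1 : sumperm 1 1 = 1%g.
Proof. by apply/esym/sumperm_unique => i; rewrite !perm1. Qed.

Lemma sumpermV u1 u2 : ((sumperm u1 u2)^-1)%g = sumperm u1^-1 u2^-1.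
Proof. by apply/eqP; rewrite eq_invg_mul sumpermM !mulgV sumperm1. Qed.

Lemma sumpermJ u1 u2 v1 v2 :
  (sumperm u1 u2 ^ sumperm v1 v2)%g = sumperm (u1 ^ v1) (u2 ^ v2).
Proof. by rewrite !conjgE sumpermV !sumpermM. Qed.

Lemma sumperm_inj u1 u2 v1 v2 :
  (sumperm u1 u2 == sumperm v1 v2) = (u1 == v1) && (u2 == v2).
Proof.
apply/eqP/andP=> [uv|[/eqP-> /eqP->]//]; split; apply/eqP/permP=> i.
  by apply: inl_inj; rewrite -!(sumperm_inl _ u2) uv !sumperm_inl.
by apply: inr_inj; rewrite -!(sumperm_inr u1) uv !sumperm_inr.
Qed.

Definition colour (t : T1 + T2) : bool := if t is inr _ then true else false.

Lemma sumperm_colour (w : {perm (T1 + T2)}) :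
  (forall t, colour (w t) = colour t) -> exists u1 u2, w = sumperm u1 u2.
Proof.
move=> cw; have [u1 u1E] : exists u1 : {perm T1}, forall i, w (inl i) = inl (u1 i).
  pose f i := if w (inl i) is inl j then j else i.
  have fE i : w (inl i) = inl (f i).
    by rewrite /f; have := cw (inl i); case: (w (inl i)).
  have inj_f : injective f.
    by move=> i j fij; apply/inl_inj/(@perm_inj _ w); rewrite !fE fij.
  by exists (perm inj_f) => i; rewrite permE.
have [u2 u2E] : exists u2 : {perm T2}, forall i, w (inr i) = inr (u2 i).
  pose f i := if w (inr i) is inr j then j else i.
  have fE i : w (inr i) = inr (f i).
    by rewrite /f; have := cw (inr i); case: (w (inr i)).
  have inj_f : injective f.
    by move=> i j fij; apply/inr_inj/(@perm_inj _ w); rewrite !fE fij.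
  by exists (perm inj_f) => i; rewrite permE.
by exists u1, u2; apply: sumperm_unique.
Qed.

Lemma colour_sumperm u1 u2 t : colour (sumperm u1 u2 t) = colour t.
Proof. by case: t => i; rewrite ?sumperm_inl ?sumperm_inr. Qed.

End SumPerm.

Section Swap.

Variable T : finType.

Definition sw_fun (t : T + T) : T + T :=
  match t with inl i => inr i | inr i => inl i end.
Lemma sw_funK : involutive sw_fun. Proof. by case. Qed.
Definition sw : {perm (T + T)} := perm (can_inj sw_funK).

Lemma swE t : sw t = sw_fun t. Proof. exact: permE. Qed.
Lemma swK : (sw * sw)%g = 1%g.
Proof. by apply/permP=> t; rewrite permM !swE sw_funK perm1. Qed.
Lemma swV : (sw^-1)%g = sw.
Proof. by apply/eqP; rewrite eq_invg_mul swK. Qed.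
Lemma sumperm_sw (u v : {perm T}) : (sumperm u v * sw = sw * sumperm v u)%g.
Proof.
by apply/permP=> -[i|i]; rewrite permM [RHS]permM !swE /= !(sumperm_inl, sumperm_inr).
Qed.
Lemma sumpermJ_sw (u v : {perm T}) : (sumperm u v ^ sw = sumperm v u)%g.
Proof. by rewrite conjgE sumperm_sw mulKg. Qed.
Lemma colour_sw t : colour (sw t) = ~~ colour t.
Proof. by rewrite swE; case: t. Qed.

End Swap.

(** * Specht characters and Littlewood-Richardson coefficients *)

Section Pull.

Variables (K : fieldType) (gT1 gT2 : finGroupType).
Variables (G1 : {group gT1}) (G2 : {group gT2}) (phi : gT1 -> gT2).
Hypothesis phiG : forall x, x \in G1 -> phi x \in G2.
Hypothesis phi1 : phi 1%g = 1%g.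
Hypothesis phiM : {in G1 &, forall x y, phi (x * y)%g = (phi x * phi y)%g}.

Lemma pull_mx_repr m (r : mx_representation K G2 m) :
  mx_repr G1 (fun x => r (phi x)).
Proof.
split=> [|x y Gx Gy]; first by rewrite phi1 repr_mx1.
by rewrite phiM // repr_mxM ?phiG.
Qed.
Definition pull_repr m (r : mx_representation K G2 m) :=
  MxRepresentation (pull_mx_repr r).

End Pull.

Section EmbSums.

Variables (T1 T2 : finType) (f : T1 -> T2).
Hypothesis inj_f : injective f.

Lemma Sym_embP (S : {set T2}) (w : {perm T2}) : S =i codom f ->
  reflect (exists u, w = emb f u) (w \in Sym S).
Proof.
move=> SE; apply: (iffP idP) => [|[u ->]].
  rewrite inE => on_w; apply: emb_onto => // x; rewrite -SE.
  exact: out_perm.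
rewrite inE; apply/subsetP=> x; rewrite inE SE.
by apply: contraR => fx; rewrite emb_out.
Qed.

Lemma big_Sym_emb (V : nmodType) (S : {set T2}) (F : {perm T2} -> V) :
  S =i codom f -> \sum_(w in Sym S) F w = \sum_u F (emb f u).
Proof.
move=> SE; transitivity (\sum_(u in [set: {perm T1}]) F (emb f u)); last first.
  by apply: eq_bigl => u; rewrite inE.
rewrite -(big_imset F (A := [set: {perm T1}])) /=; last first.
  by move=> u v _ _; apply: emb_inj.
apply: eq_bigl => w; apply/(Sym_embP _ SE)/imsetP => [[u ->]|[u _ ->]].
  by exists u; rewrite ?inE.
by exists u.
Qed.

End EmbSums.

(** Young symmetrizers depend only on which cells share a row and which share a
    column, not on the indices of the rows and columns.  So the rows of a tableau
    may be permuted, even when the result is not a Young diagram. *)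

Section Relabel.

Variables (K : fieldType) (T1 T2 : finType) (f : T1 -> T2).
Variables (row1 col1 : T1 -> nat) (row2 col2 : T2 -> nat).
Hypothesis inj_f : injective f.
Hypothesis f_onto : forall t, t \in codom f.

Lemma big_emb_onto (V : nmodType) (F : {perm T2} -> V) :
  \sum_w F w = \sum_u F (emb f u).
Proof.
rewrite -(big_Sym_emb inj_f (S := [set: T2])) => [|t]; last by rewrite inE f_onto.
by apply: eq_bigl => w; rewrite inE; apply/esym/subsetP=> x _; rewrite inE.
Qed.

Lemma preserving_emb (g1 : T1 -> nat) (g2 : T2 -> nat) (u : {perm T1}) :
    (forall i j, (g2 (f i) == g2 (f j)) = (g1 i == g1 j)) ->
  (emb f u \in preserving g2) = (u \in preserving g1).
Proof.
move=> g12; apply/preservingP/preservingP=> pu t; last first.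
  by have /codomP[i ->] := f_onto t; rewrite emb_in //; apply/eqP; rewrite g12 pu.
by apply/eqP; rewrite -g12 -emb_in // pu.
Qed.

Hypothesis row12 : forall i j, (row2 (f i) == row2 (f j)) = (row1 i == row1 j).
Hypothesis col12 : forall i j, (col2 (f i) == col2 (f j)) = (col1 i == col1 j).

Lemma young_elt_emb u : young_elt K row2 col2 (emb f u) = young_elt K row1 col1 u.
Proof.
rewrite /young_elt big_mkcond big_emb_onto /= [RHS]big_mkcond; apply: eq_bigr => x _.
rewrite (preserving_emb _ row12); case: ifP => // _.
rewrite big_mkcond big_emb_onto /= [RHS]big_mkcond; apply: eq_bigr => y _.
by rewrite (preserving_emb _ col12) -embM // (inj_eq (emb_inj inj_f)) odd_emb.
Qed.

Lemma young_idem_emb u : young_idem K row2 col2 (emb f u) = young_idem K row1 col1 u.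
Proof.
rewrite /young_idem young_elt_emb; congr (_^-1 * _); rewrite /hook big_emb_onto.
by apply: eq_bigr => x _; rewrite -embV // !young_elt_emb.
Qed.

End Relabel.

Section Shapes.

Definition yrow (l : seq nat) (i : 'I_(sumn l)) : nat := reshape_index l i.
Definition ycol (l : seq nat) (i : 'I_(sumn l)) : nat := reshape_offset l i.

Lemma lj_shape l : left_justified (yrow (l := l)) (ycol (l := l)).
Proof.
split=> [i j [rij cij]|t j jt].
  by apply: val_inj; rewrite /= -(reshape_indexK l i) -(reshape_indexK l j) -/(yrow _) rij -/(ycol _) cij.
have jl : (j < nth 0 l (yrow t))%N by apply: ltn_trans jt (reshape_offsetP _).
exists (Ordinal (flatten_indexP jl)); first exact: flatten_indexKl.
exact: flatten_indexKr.
Qed.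

Variable K : fieldType.

(** The idempotent attached to the tableau of shape l filled row by
    row, and its character. *)
Definition yidem (l : seq nat) : {perm 'I_(sumn l)} -> K := young_idem K (yrow (l := l)) (ycol (l := l)).
Definition schi l (x : {perm 'I_(sumn l)}) : K := \sum_g yidem (x^-1 ^ g)%g.

End Shapes.

Arguments yidem K l _ : clear implicits.

Definition winj n k m (le_km : (k + m <= n)%N) (i : 'I_m) : 'I_n :=
  Ordinal (leq_trans (etrans (ltn_add2l k i m) (ltn_ord i)) le_km).

Section Window.

Variables (n k m : nat) (le_km : (k + m <= n)%N).
Lemma winj_inj : injective (winj le_km).
Proof. by move=> i j /(congr1 val)/= /eqP; rewrite eqn_add2l => /eqP/val_inj. Qed.

Lemma window_winj : window n k m =i codom (winj le_km).
Proof.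
move=> x; rewrite inE; apply/andP/codomP=> [[kx xkm]|[i ->]]; last first.
  by rewrite leq_addr ltn_add2l ltn_ord.
have xm : (x - k < m)%N by rewrite ltn_subLR.
by exists (Ordinal xm); apply: val_inj; rewrite /= subnKC.
Qed.

End Window.

Section SpechtTransport.

Variables (K : fieldType) (n k : nat) (l : seq nat).
Hypothesis charK : [pchar K] =i pred0.
Hypothesis le_kl : (k + sumn l <= n)%N.

Let f := winj le_kl.
Let inj_f : injective f := @winj_inj _ _ _ le_kl.

Lemma symGP (w : {perm 'I_n}) : reflect (exists u, w = emb f u) (w \in symG n k l).
Proof. exact: Sym_embP inj_f _ _ (window_winj le_kl). Qed.

Lemma emb_symG u : emb f u \in symG n k l.
Proof. by apply/symGP; exists u. Qed.

Lemma big_symG (V : nmodType) (F : {perm 'I_n} -> V) :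
  \sum_(w in symG n k l) F w = \sum_u F (emb f u).
Proof. exact: big_Sym_emb inj_f _ _ _ (window_winj le_kl). Qed.

Lemma emb_row_stab u : (emb f u \in row_stab n k l) = (u \in preserving (yrow (l := l))).
Proof.
rewrite inE emb_symG /=; apply/forall_inP/preservingP => [ru t|ru x].
  have := ru (f t); rewrite window_winj codom_f => /(_ isT) /eqP.
  by rewrite emb_in //= !addKn.
rewrite window_winj => /codomP[t ->]; rewrite /same_row emb_in //= !addKn.
exact/eqP/ru.
Qed.

Lemma emb_col_stab u : (emb f u \in col_stab n k l) = (u \in preserving (ycol (l := l))).
Proof.
rewrite inE emb_symG /=; apply/forall_inP/preservingP => [ru t|ru x].
  have := ru (f t); rewrite window_winj codom_f => /(_ isT) /eqP.
  by rewrite emb_in //= !addKn.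
rewrite window_winj => /codomP[t ->]; rewrite /same_col emb_in //= !addKn.
exact/eqP/ru.
Qed.

(** Extension of a group algebra element along [emb f]. *)
Definition pushed (z : {perm 'I_(sumn l)} -> K) (w : {perm 'I_n}) : K :=
  \sum_(u | emb f u == w) z u.

Lemma pushed_emb z u : pushed z (emb f u) = z u.
Proof.
by rewrite /pushed (big_pred1 u) // => v; rewrite (inj_eq (emb_inj inj_f)).
Qed.

Lemma aeval_symG m (r : mx_representation K (symG n k l) m) z :
  aeval r (pushed z) = \sum_u z u *: r (emb f u).
Proof. by rewrite /aeval big_symG; apply: eq_bigr => u _; rewrite pushed_emb. Qed.

Lemma young_symmetrizerE : young_symmetrizer K n k l =
  gvec (symG n k l) (pushed (young_elt K (yrow (l := l)) (ycol (l := l)))).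
Proof.
rewrite /gvec big_symG /young_symmetrizer.
have row_sub u : u \in row_stab n k l -> u \in symG n k l by rewrite inE => /andP[].
have col_sub u : u \in col_stab n k l -> u \in symG n k l by rewrite inE => /andP[].
transitivity (\sum_(u in preserving (yrow (l := l))) \sum_(v in preserving (ycol (l := l)))
   (-1) ^+ odd_perm v *: delta_mx 0 (gring_index (symG n k l) (emb f (u * v))) : 'rV[K]_#|symG n k l|).
  rewrite (eq_bigl (fun u => (u \in symG n k l) && (u \in row_stab n k l))); last first.
    by move=> u; case: (boolP (u \in row_stab n k l)) => [/row_sub->|]; rewrite ?andbF.
  rewrite big_mkcondr big_symG [RHS]big_mkcond; apply: eq_bigr => u _ /=.
  rewrite emb_row_stab; case: ifP => // _.
  rewrite (eq_bigl (fun v => (v \in symG n k l) && (v \in col_stab n k l))); last first.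
    by move=> v; case: (boolP (v \in col_stab n k l)) => [/col_sub->|]; rewrite ?andbF.
  rewrite big_mkcondr big_symG [RHS]big_mkcond; apply: eq_bigr => v _ /=.
  by rewrite emb_col_stab odd_emb // embM.
under [RHS]eq_bigr do rewrite pushed_emb /young_elt scaler_suml.
rewrite [RHS]exchange_big; apply: eq_bigr => u _ /=.
under [RHS]eq_bigr do rewrite scaler_suml big_mkcondr.
rewrite [RHS]exchange_big; apply: eq_bigr => v _ /=.
rewrite -big_mkcond (big_pred1 (u * v)%g) // => x; by rewrite /= eq_sym.
Qed.

Lemma specht_ch : specht K n k l = ch (symG n k l) (pushed (yidem K l)).
Proof.
rewrite /specht /specht_repr young_symmetrizerE.
rewrite (cyclic_char (hook_neq0 charK (lj_shape l))) => [|m r].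
  apply/ffunP=> x; rewrite !ffunE; case: ifP => // _; apply: eq_bigr => g _.
  by rewrite /pushed mulr_sumr.
have phiG u : u \in [set: {perm 'I_(sumn l)}]%G -> emb f u \in symG n k l.
  by move=> _; apply: emb_symG.
have phiM : {in [set: {perm 'I_(sumn l)}]%G &, forall x y, emb f (x * y) = (emb f x * emb f y)%g}.
  by move=> x y _ _; apply: embM.
have := young_sq charK (lj_shape l) (pull_repr phiG (emb1 inj_f) phiM r).
suff -> : aeval (pull_repr phiG (emb1 inj_f) phiM r) (young_elt K (yrow (l := l)) (ycol (l := l)))
   = aeval r (pushed (young_elt K (yrow (l := l)) (ycol (l := l)))) by [].
by rewrite aeval_symG /aeval; apply: eq_bigl => x; rewrite inE.
Qed.

Lemma specht_emb u : specht K n k l (emb f u) = schi K u.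
Proof.
rewrite specht_ch ffunE emb_symG big_symG; apply: eq_bigr => g _.
by rewrite -embV // -(pushed_emb (yidem K l)) !conjgE -embV // !embM.
Qed.

Lemma specht_char : is_char (symG n k l) (specht K n k l).
Proof. by rewrite /specht; eexists; eexists. Qed.

End SpechtTransport.

Section LittlewoodRichardson.

Variable K : fieldType.
Hypothesis charK : [pchar K] =i pred0.

Lemma aeval_setT (gT : finGroupType) m (r : mx_representation K [set: gT]%G m) z :
  aeval r z = \sum_u z u *: r u.
Proof. by apply: eq_bigl => x; rewrite inE. Qed.

Lemma aeval_young_pull (gT : finGroupType) (G : {group gT}) l
    (phi : {perm 'I_(sumn l)} -> gT) m (r : mx_representation K G m) :
    (forall u, phi u \in G) -> phi 1%g = 1%g ->
    (forall u v, phi (u * v)%g = (phi u * phi v)%g) ->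
  let A := \sum_u yidem K _ u *: r (phi u) in A *m A = A.
Proof.
move=> phiG phi1 phiM /=.
have phiG' u : u \in [set: {perm 'I_(sumn l)}]%G -> phi u \in G by [].
have phiM' : {in [set: {perm 'I_(sumn l)}]%G &, forall x y, phi (x * y)%g = (phi x * phi y)%g} by [].
have := young_idemP charK (lj_shape l) (pull_repr phiG' phi1 phiM' r).
by rewrite !aeval_setT.
Qed.

Lemma mx_comm_sum (I J : finType) m (F : I -> 'M[K]_m) (E : J -> 'M[K]_m) :
  (forall i j, F i *m E j = E j *m F i) ->
  (\sum_i F i) *m (\sum_j E j) = (\sum_j E j) *m (\sum_i F i).
Proof.
move=> FE; rewrite mulmx_suml [RHS]mulmx_sumr; apply: eq_bigr => i _.
by rewrite mulmx_sumr mulmx_suml; apply: eq_bigr.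
Qed.

Lemma idem_comm_mul m (A B : 'M[K]_m) : A *m A = A -> B *m B = B ->
  A *m B = B *m A -> A *m B *m (A *m B) = A *m B.
Proof.
move=> AA BB AB; transitivity (A *m A *m (B *m B)); last by rewrite AA BB.
by rewrite -!mulmxA (mulmxA B) -AB !mulmxA.
Qed.

Lemma winj_id n (H : (0 + n <= n)%N) : winj H =1 id.
Proof. by move=> i; apply: val_inj. Qed.

Lemma symG_full l x : x \in symG (sumn l) 0 l.
Proof.
have H : (0 + sumn l <= sumn l)%N by [].
apply/(symGP H); exists x; rewrite (eq_emb _ (winj_id H)).
by rewrite emb_id.
Qed.

Lemma specht_full l x : specht K (sumn l) 0 l x = schi K x.
Proof.
have H : (0 + sumn l <= sumn l)%N by [].
by rewrite -(specht_emb charK H) (eq_emb _ (winj_id H)) emb_id.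
Qed.

(** Inducing the external product of two right ideals gives the right ideal of
    the product of the two commuting idempotents, and pairing it with the
    character of nu is evaluation. *)
Lemma LRcoefE l m nu (H0 : (0 + sumn l <= sumn nu)%N)
    (H1 : (sumn l + sumn m <= sumn nu)%N) : (sumn l + sumn m = sumn nu)%N ->
  (LRcoef K l m nu)%:R = \sum_u \sum_v yidem K l u * yidem K m v *
     schi K (l := nu) (emb (winj H0) u * emb (winj H1) v).
Proof.
move=> lm_nu; rewrite /LRcoef lm_nu eqxx.
set n := sumn nu in H0 H1 *; set G := symG n 0 nu; set H := symG n 0 l; set L := symG n (sumn l) m.
have inj0 := @winj_inj _ _ _ H0; have inj1 := @winj_inj _ _ _ H1.
have dis (i : 'I_(sumn l)) (j : 'I_(sumn m)) : winj H0 i != winj H1 j.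
  by rewrite -val_eqE /= add0n neq_ltn ltn_addr ?ltn_ord.
have cHL : (L \subset 'C(H))%g.
  apply/subsetP=> _ /(symGP H1)[v ->]; apply/centP=> _ /(symGP H0)[u ->].
  by apply/commute_sym/emb_commute.
have tiHL : (H :&: L = 1)%g.
  apply/trivgP/subsetP=> x /setIP[/(symGP H0)[u uE] /(symGP H1)[v vE]].
  rewrite inE; apply/eqP/permP=> y; rewrite perm1.
  have [/codomP[i yi]|yl] := boolP (y \in codom (winj H0)); last by rewrite uE emb_out.
  rewrite vE emb_out //; apply/codomP=> -[j yj].
  by move: (dis i j); rewrite -yi -yj eqxx.
rewrite (specht_ch charK H0) (specht_ch charK H1).
rewrite boxprod_ch //; set z := fun x => _.
have sHLG : (H <*> L \subset G)%g by apply/subsetP=> x _; apply: symG_full.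
have zE x : z x = \sum_u \sum_v (if (emb (winj H0) u * emb (winj H1) v == x)%g then
    yidem K l u * yidem K m v else 0).
  rewrite /z (big_symG H0); apply: eq_bigr => u _; rewrite big_mkcondr (big_symG H1).
  by apply: eq_bigr => v _; rewrite !pushed_emb.
have z_out x : (x \notin H <*> L)%g -> z x = 0.
  move=> xHL; rewrite /z big1 // => u Hu; rewrite big1 // => v /andP[Lv /eqP uv].
  by case/negP: xHL; rewrite -uv /= cent_joinEr ?mem_mulg.
rewrite (indf_ch charK) //.
have aevalz mm (r : mx_representation K G mm) : aeval r z =
    (\sum_u yidem K l u *: r (emb (winj H0) u)) *m
    (\sum_v yidem K m v *: r (emb (winj H1) v)).
  rewrite /aeval; under eq_bigl do rewrite symG_full.
  under eq_bigr do rewrite zE scaler_suml.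
  rewrite exchange_big mulmx_suml; apply: eq_bigr => u _ /=.
  under eq_bigr do rewrite scaler_suml.
  rewrite exchange_big mulmx_sumr; apply: eq_bigr => v _ /=.
  rewrite (bigD1 (emb (winj H0) u * emb (winj H1) v)%g) //= eqxx big1 ?addr0.
    by rewrite -scalemxAl -scalemxAr scalerA repr_mxM ?symG_full.
  by move=> x /negPf; rewrite eq_sym => ->; rewrite scale0r.
have idz : idem G z.
  move=> mm r; rewrite aevalz; apply: idem_comm_mul.
  - apply: aeval_young_pull => [u||u v]; rewrite ?symG_full ?emb1 ?embM //.
  - apply: aeval_young_pull => [u||u v]; rewrite ?symG_full ?emb1 ?embM //.
  - apply: mx_comm_sum => u v; rewrite -!scalemxAl -!scalemxAr -!repr_mxM ?symG_full //.
    rewrite !scalerA mulrC; congr (_ *: r _); exact: emb_commute.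
rewrite (mult_ip charK); last 2 first.
- exact: is_char_ch.
- exact: specht_char.
rewrite (ip_ch charK); last exact/classfun_char/specht_char.
rewrite (eq_bigl xpredT) => [|x]; last by rewrite symG_full.
under eq_bigr do rewrite zE mulr_suml.
rewrite exchange_big; apply: eq_bigr => u _ /=.
under eq_bigr do rewrite mulr_suml.
rewrite exchange_big; apply: eq_bigr => v _ /=.
rewrite (bigD1 (emb (winj H0) u * emb (winj H1) v)%g) //= eqxx big1 ?addr0.
  by rewrite specht_full.
by move=> x /negPf; rewrite eq_sym => ->; rewrite mul0r.
Qed.

End LittlewoodRichardson.

(** * Pairs of diagrams and the exchange of two equal diagrams *)

Section SwapSign.

Variable T : finType.

Lemma odd_sw : odd_perm (sw T) = odd #|T|.
Proof.
pose base (t : T + T) := match t with inl i | inr i => i end.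
have prodE s : uniq s -> forall t, (\prod_(i <- s) tperm (inl i : T + T) (inr i))%g t =
    if base t \in s then sw T t else t.
  elim: s => [|i s IH] /= => [_ t|/andP[nis us] t]; first by rewrite big_nil perm1.
  rewrite big_cons permM (IH us) in_cons.
  case: t => j /=; have [->|nji] := eqVneq j i.
  - by rewrite tpermL /= (negPf nis) swE.
  - by rewrite tpermD //=; apply/eqP => -[] // ji; rewrite ji eqxx in nji.
  - by rewrite tpermR /= (negPf nis) swE.
  - by rewrite tpermD //=; apply/eqP => -[] // ji; rewrite ji eqxx in nji.
have -> : sw T = (\prod_(i <- enum T) tperm (inl i : T + T) (inr i))%g.
  by apply/permP=> t; rewrite prodE ?enum_uniq // mem_enum.
rewrite cardE; elim: (enum T) => [|i s IH]; first by rewrite big_nil odd_perm1.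
by rewrite big_cons odd_permM odd_tperm IH.
Qed.

End SwapSign.

Section PairFunctions.

Variables (K : fieldType) (T1 T2 : finType).
Variables (e1 : {perm T1} -> K) (e2 : {perm T2} -> K).

(** The product of the elements e1 and e2 of two group algebras, as an element
    of the group algebra of the permutations of T1 + T2. *)
Definition FR (v : {perm (T1 + T2)}) : K :=
  \sum_u1 \sum_(u2 | sumperm u1 u2 == v) e1 u1 * e2 u2.

Lemma FR_sum u1 u2 : FR (sumperm u1 u2) = e1 u1 * e2 u2.
Proof.
rewrite /FR (bigD1 u1) //= [X in _ + X]big1 ?addr0 => [|v1 nv1].
  rewrite (big_pred1 u2) // => v2; by rewrite sumperm_inj eqxx.
by rewrite big1 // => v2; rewrite sumperm_inj (negPf nv1).
Qed.

Lemma FR_colour v : FR v != 0 -> forall t, colour (v t) = colour t.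
Proof.
move=> nz t; have [//|ne] := eqVneq (colour (v t)) (colour t); case/eqP: nz.
rewrite /FR big1 // => u1 _; rewrite big1 // => u2 /eqP vE.
by case/eqP: ne; rewrite -vE colour_sumperm.
Qed.

Lemma sum_FR (V : lmodType K) (F : {perm (T1 + T2)} -> V) :
  \sum_v FR v *: F v = \sum_u1 \sum_u2 (e1 u1 * e2 u2) *: F (sumperm u1 u2).
Proof.
under eq_bigr do rewrite scaler_suml.
rewrite exchange_big; apply: eq_bigr => u1 _ /=.
under eq_bigr do rewrite scaler_suml big_mkcond.
rewrite exchange_big; apply: eq_bigr => u2 _ /=.
rewrite (bigD1 (sumperm u1 u2)) //= eqxx big1 ?addr0 // => v.
by rewrite eq_sym => /negPf->.
Qed.

Lemma sum_FRm (F : {perm (T1 + T2)} -> K) :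
  \sum_v FR v * F v = \sum_u1 \sum_u2 (e1 u1 * e2 u2) * F (sumperm u1 u2).
Proof. exact: (@sum_FR K^o). Qed.

End PairFunctions.

Section SwapFunctions.

Variables (K : fieldType) (T : finType) (e : {perm T} -> K).

(** The element e e sw.  All its terms exchange the two colours. *)
Definition FD (v : {perm (T + T)}) : K := FR e e (v * sw T)%g.

Lemma FD_colour v : FD v != 0 -> forall t, colour (v t) = ~~ colour t.
Proof.
move=> nz t; have := FR_colour nz t; rewrite permM swE.
by case: (v t) => i /= <-.
Qed.

Lemma sum_FD (V : lmodType K) (F : {perm (T + T)} -> V) :
  \sum_v FD v *: F v = \sum_u1 \sum_u2 (e u1 * e u2) *: F (sumperm u1 u2 * sw T)%g.
Proof.
rewrite (reindex_inj (mulIg (sw T))) /= -(sum_FR e e (fun v => F (v * sw T)%g)).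
by apply: eq_bigr => v _; rewrite /FD -mulgA swK mulg1.
Qed.

Lemma FR_conj_sw v : FR e e (v ^ sw T) = FR e e v.
Proof.
have [nz|z] := eqVneq (FR e e v) 0; last first.
  by have [u1 [u2 ->]] := sumperm_colour (FR_colour z); rewrite sumpermJ_sw !FR_sum mulrC.
rewrite nz; apply/eqP; apply: contraTT isT => nz'.
have [u1 [u2 vE]] := sumperm_colour (FR_colour nz').
have vE' : v = sumperm u2 u1 by rewrite -sumpermJ_sw -vE -conjgM swK conjg1.
by move: nz'; rewrite vE FR_sum; move: nz; rewrite vE' FR_sum mulrC => ->; rewrite eqxx.
Qed.

Lemma FD_conj_sw v : FD (v ^ sw T) = FD v.
Proof.
by rewrite /FD -[RHS]FR_conj_sw conjMg [(sw T ^ sw T)%g]conjgE mulKg.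
Qed.

End SwapFunctions.

Section Coef3.

Variables (K : fieldType) (gT : finGroupType).

Lemma aeval_coef3 (z z' : gT -> K) y x :
  (aeval (regular_repr K [set: gT]%G) z *m regular_repr K [set: gT]%G y *m
     aeval (regular_repr K [set: gT]%G) z') (gring_index [set: gT]%G 1) (gring_index [set: gT]%G x) =
  \sum_v z v * z' (y^-1 * v^-1 * x)%g.
Proof.
rewrite -mulmxA aeval_regular_mul; apply: eq_big => [v|v _]; first by rewrite inE.
congr (_ * _); rewrite mxE (bigD1 (gring_index [set: gT]%G (v * y)%g)) //= regular_mxE ?inE //.
rewrite !gring_indexK ?inE // eqxx mul1r aeval_regularE ?inE // invMg.
rewrite big1 ?addr0 // => i ni.
rewrite regular_mxE ?inE // gring_indexK ?inE //.
suff /negPf-> : (enum_val i != v * y)%g by rewrite mul0r.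
by apply: contraNneq ni => <-; rewrite gring_valK.
Qed.

End Coef3.

Section DoubleShape.

Variables (K : fieldType) (l : seq nat).
Hypothesis charK : [pchar K] =i pred0.

Let D := 'I_(sumn l).
Let e : {perm D} -> K := yidem K l.

(** The tableau obtained by stacking two copies of the diagram l: all rows of the
    first copy come before the rows of the second one.  The
    lengths of its rows need not be monotone, but it is left justified. *)
Definition drow (t : D + D) : nat :=
  match t with inl i => yrow i | inr i => (size l + yrow i)%N end.
Definition dcol (t : D + D) : nat :=
  match t with inl i | inr i => ycol i end.

Lemma lj_double : left_justified drow dcol.
Proof.
have [inj_rc lj] := lj_shape l.
have rl (i : D) : (yrow i < size l)%N by apply: reshape_indexP.
split=> [[i|i] [j|j] [] /=|[i|i] j /=].
- by move=> r c; congr inl; apply: inj_rc; rewrite r c.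
- by move=> r _; have := rl i; rewrite r ltnNge leq_addr.
- by move=> r _; have := rl j; rewrite -r ltnNge leq_addr.
- by move=> /addnI r c; congr inr; apply: inj_rc; rewrite r c.
- by move=> /lj[t r c]; exists (inl t).
- by move=> /lj[t r c]; exists (inr t); rewrite //= r.
Qed.

Lemma drow_colour t : (colour t) = (size l <= drow t)%N.
Proof.
by case: t => i /=; rewrite ?leq_addr // leqNgt (reshape_indexP (ltn_ord i)).
Qed.

Lemma preserving_drowP (w : {perm (D + D)}) :
  reflect (exists u1 u2, [/\ w = sumperm u1 u2, u1 \in preserving (yrow (l := l))
                           & u2 \in preserving (yrow (l := l))])
          (w \in preserving drow).
Proof.
apply: (iffP (preservingP _ _)) => [rw|[u1 [u2 [-> /preservingP r1 /preservingP r2]]]]; last first.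
  by case=> i; rewrite ?(sumperm_inl, sumperm_inr) /= ?r1 ?r2.
have [u1 [u2 wE]] : exists u1 u2, w = sumperm u1 u2.
  by apply: sumperm_colour => t; rewrite !drow_colour rw.
exists u1, u2; split=> //; apply/preservingP=> i.
  by have := rw (inl i); rewrite wE sumperm_inl.
by have := rw (inr i); rewrite wE sumperm_inr => /addnI.
Qed.

Definition dyidem : {perm (D + D)} -> K := young_idem K drow dcol.

(** The exchange sw preserves the columns of the stacked tableau and normalises
    its row group, and it commutes with the product B of the two column sums.
    The row sum of the stacked tableau is the product of the two row sums, so
    e e is a multiple of that row sum times B and [young_sign] applies. *)
Lemma double_sign_mx m (r : mx_representation K [set: {perm (D + D)}]%G m) g :
  aeval r dyidem *m r g *m aeval r (FD e) =
    (-1) ^+ sumn l *: (aeval r dyidem *m r g *m aeval r (FR e e)).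
Proof.
have rM x y : r (x * y)%g = r x *m r y by rewrite repr_mxM ?inE.
pose a1 := \sum_(u in preserving (yrow (l := l))) r (sumperm u 1).
pose a2 := \sum_(u in preserving (yrow (l := l))) r (sumperm 1 u).
pose b1 := \sum_(u in preserving (ycol (l := l))) (-1) ^+ odd_perm u *: r (sumperm u 1).
pose b2 := \sum_(u in preserving (ycol (l := l))) (-1) ^+ odd_perm u *: r (sumperm 1 u).
pose h := hook K (yrow (l := l)) (ycol (l := l)).
have phi1E (u v : {perm D}) : (sumperm (u * v) 1 = sumperm u 1 * sumperm v 1 :> {perm (D + D)})%g.
  by rewrite sumpermM mulg1.
have phi2E (u v : {perm D}) : (sumperm 1 (u * v) = sumperm 1 u * sumperm 1 v :> {perm (D + D)})%g.
  by rewrite sumpermM mulg1.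
have phiG (phi : {perm D} -> {perm (D + D)}) u : u \in [set: {perm D}]%G -> phi u \in [set: {perm (D + D)}]%G by rewrite !inE.
pose r1 := pull_repr (phiG (fun u => sumperm u 1)) (sumperm1 _ _) (in2W phi1E) r.
pose r2 := pull_repr (phiG (fun u => sumperm 1 u)) (sumperm1 _ _) (in2W phi2E) r.
have e1E : \sum_u e u *: r (sumperm u 1) = h^-1 *: (a1 *m b1).
  have := aeval_young (yrow (l := l)) (ycol (l := l)) r1.
  by rewrite -[a1 *m b1]/(rowsum _ r1 *m colsum _ r1) => <-; rewrite -aevalZ aeval_setT.
have e2E : \sum_u e u *: r (sumperm 1 u) = h^-1 *: (a2 *m b2).
  have := aeval_young (yrow (l := l)) (ycol (l := l)) r2.
  by rewrite -[a2 *m b2]/(rowsum _ r2 *m colsum _ r2) => <-; rewrite -aevalZ aeval_setT.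
have comm12 (u v : {perm D}) : r (sumperm u 1) *m r (sumperm 1 v) = r (sumperm 1 v) *m r (sumperm u 1).
  by rewrite -!rM !sumpermM !mul1g !mulg1.
have FRE : aeval r (FR e e) = (h^-1 * h^-1) *: (rowsum drow r *m (b1 *m b2)).
  have -> : rowsum drow r = a1 *m a2.
    pose R := preserving (yrow (l := l)).
    have -> : rowsum drow r = \sum_(p in setX R R) r (sumperm p.1 p.2).
      rewrite -(big_imset r (h := fun p => sumperm p.1 p.2)) /=; last first.
        move=> [u v] [u' v'] _ _ /= /eqP; rewrite sumperm_inj.
        by case/andP=> /eqP-> /eqP->.
      apply: eq_bigl => w; apply/preserving_drowP/imsetP.
        by case=> u [v [-> Ru Rv]]; exists (u, v); first exact/setXP.
      by case=> -[u v] /setXP[Ru Rv] ->; exists u, v.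
    rewrite (eq_bigl (fun p => (p.1 \in R) && (p.2 \in R))) => [|p]; last by rewrite inE.
    rewrite -(pair_big (mem R) (mem R) (fun u v => r (sumperm u v))) /a1 mulmx_suml.
    apply: eq_bigr => u _; rewrite /a2 mulmx_sumr; apply: eq_bigr => v _.
    by rewrite -rM sumpermM mulg1 mul1g.
  have ba : b1 *m a2 = a2 *m b1.
    rewrite /b1 mulmx_suml mulmx_sumr; apply: eq_bigr => u _.
    rewrite -scalemxAl -scalemxAr; congr (_ *: _).
    by rewrite /a2 mulmx_suml mulmx_sumr; apply: eq_bigr => v _.
  rewrite aeval_setT sum_FR.
  transitivity ((h^-1 *: (a1 *m b1)) *m (h^-1 *: (a2 *m b2))).
    rewrite -e1E -e2E mulmx_suml; apply: eq_bigr => u _.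
    rewrite mulmx_sumr; apply: eq_bigr => v _.
    by rewrite -scalemxAl -scalemxAr scalerA -rM sumpermM mulg1 mul1g.
  rewrite -scalemxAl -scalemxAr scalerA; congr (_ *: _).
  by rewrite -!mulmxA (mulmxA b1) ba !mulmxA.
have FDE : aeval r (FD e) = aeval r (FR e e) *m r (sw D).
  rewrite !aeval_setT sum_FD sum_FR mulmx_suml; apply: eq_bigr => u _.
  by rewrite mulmx_suml; apply: eq_bigr => v _; rewrite rM scalemxAl.
rewrite FDE mulmxA FRE /dyidem aevalZ; do 4 rewrite -?scalemxAl -?scalemxAr.
have := young_sign charK lj_double (r := r) g (t := sw D) (B := b1 *m b2).
rewrite odd_sw card_ord signr_odd => -> //.
- by rewrite !scalerA mulrC mulrA.
- by apply/preservingP=> -[i|i]; rewrite swE.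
- apply/setP=> w; rewrite mem_conjg swV; apply/preserving_drowP/preserving_drowP.
    case=> u1 [u2 [wE R1 R2]]; exists u2, u1; split=> //.
    by rewrite -sumpermJ_sw -wE -conjgM swK conjg1.
  by case=> u1 [u2 [-> R1 R2]]; exists u2, u1; rewrite sumpermJ_sw.
- have bb : b1 *m b2 = b2 *m b1.
    rewrite /b1 mulmx_suml mulmx_sumr; apply: eq_bigr => u _.
    rewrite -scalemxAl -scalemxAr; congr (_ *: _).
    rewrite /b2 mulmx_suml mulmx_sumr; apply: eq_bigr => v _.
    by rewrite -scalemxAl -scalemxAr comm12.
  have b1s : b1 *m r (sw D) = r (sw D) *m b2.
    rewrite /b1 /b2 mulmx_suml mulmx_sumr; apply: eq_bigr => u _.
    by rewrite -scalemxAl -scalemxAr -!rM sumperm_sw.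
  have b2s : b2 *m r (sw D) = r (sw D) *m b1.
    rewrite /b1 /b2 mulmx_suml mulmx_sumr; apply: eq_bigr => u _.
    by rewrite -scalemxAl -scalemxAr -!rM sumperm_sw.
  by rewrite -mulmxA b2s mulmxA b1s -mulmxA -bb.
Qed.

Lemma double_sign :
  \sum_v dyidem v * (\sum_y FD e (v^-1 ^ y)%g) =
    (-1) ^+ sumn l * \sum_v dyidem v * (\sum_y FR e e (v^-1 ^ y)%g).
Proof.
transitivity (\sum_y \sum_v dyidem v * FD e (v^-1 ^ y)%g).
  by rewrite exchange_big; apply: eq_bigr => v _; rewrite mulr_sumr.
transitivity ((-1) ^+ sumn l * \sum_y \sum_v dyidem v * FR e e (v^-1 ^ y)%g); last first.
  by rewrite exchange_big; congr (_ * _); apply: eq_bigr => v _; rewrite mulr_sumr.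
rewrite mulr_sumr; apply: eq_bigr => y _.
have /matrixP/(_ (gring_index _ 1) (gring_index _ y)) :=
  double_sign_mx (regular_repr K [set: {perm (D + D)}]%G) y.
rewrite [in RHS]mxE !aeval_coef3.
by under eq_bigr do rewrite -mulgA -conjgE; under [in RHS]eq_bigr do rewrite -mulgA -conjgE.
Qed.

(** Sorting the rows of the stacked tableau gives the tableau of shape
    l u l. *)
Lemma double_relabel : exists2 f : D + D -> 'I_(sumn (part_union l l)),
  injective f & forall v, yidem K _ (emb f v) = dyidem v.
Proof.
set nu := part_union l l.
have sum_nu : sumn nu = (sumn l + sumn l)%N.
  by rewrite -sumn_cat; apply/perm_sumn; rewrite perm_sort.
have /(perm_iotaP 0)[Is perm_Is llE] : perm_eq (l ++ l) nu.
  by rewrite perm_sym perm_sort.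
have size_Is : size Is = (size l + size l)%N by rewrite -size_cat llE size_map.
have drow_lt t : (drow t < size Is)%N.
  rewrite size_Is; case: t => i /=; rewrite ?ltn_add2l ?reshape_indexP //.
  by apply: ltn_addr; apply: reshape_indexP.
have dcolP t : (dcol t < nth 0 nu (nth 0 Is (drow t)))%N.
  rewrite -(nth_map 0 0 (nth 0 nu)) // -llE nth_cat.
  case: t => i /=; first by rewrite reshape_indexP // reshape_offsetP.
  by rewrite [(size l + _ < _)%N]ltnNge leq_addr /= addKn reshape_offsetP.
pose f t := Ordinal (flatten_indexP (dcolP t)).
have rowf t : yrow (f t) = nth 0 Is (drow t) by apply: flatten_indexKl.
have colf t : ycol (f t) = dcol t by apply: flatten_indexKr.
have uniq_Is : uniq Is by rewrite (perm_uniq perm_Is) iota_uniq.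
have rowff i j : (yrow (f i) == yrow (f j)) = (drow i == drow j).
  by rewrite !rowf nth_uniq.
have inj_f : injective f.
  move=> i j fij; apply: (proj1 lj_double); congr (_, _); last by rewrite -!colf fij.
  by apply/eqP; rewrite -rowff fij.
exists f => // v; apply: young_idem_emb => // [t|i j]; last by rewrite !colf.
by apply: inj_card_onto; rewrite // card_sum !card_ord sum_nu.
Qed.

End DoubleShape.

(** * Signed permutations and their characters *)

Section SignedPerm.

Variable T : finType.
Implicit Types (v w y : {perm T}) (S Q : {ffun T -> bool}).

Definition sp_fun v S (x : T * bool) : T * bool := (v x.1, x.2 (+) S (v x.1)).
Lemma sp_fun_inj v S : injective (sp_fun v S).
Proof. by move=> [t b] [t' b'] [/perm_inj-> /addIb->]. Qed.
(** The signed permutation v followed by the change of the signs of the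
    coordinates in S. *)
Definition sp v S : {perm (T * bool)} := perm (@sp_fun_inj v S).

Definition sadd S Q : {ffun T -> bool} := [ffun t => S t (+) Q t].
Definition sact w S : {ffun T -> bool} := [ffun t => S (w^-1 t)%g].
Definition szero : {ffun T -> bool} := [ffun => false].

Lemma spE v S t b : sp v S (t, b) = (v t, b (+) S (v t)).
Proof. exact: permE. Qed.

Lemma spM v S w Q : (sp v S * sp w Q)%g = sp (v * w) (sadd (sact w S) Q).
Proof.
apply/permP=> -[t b]; rewrite permM !spE permM !ffunE permK.
by rewrite addbA.
Qed.

Lemma sp1 : sp 1 szero = 1%g.
Proof. by apply/permP=> -[t b]; rewrite spE !perm1 ffunE addbF. Qed.

Lemma sp_inj v S w Q : (sp v S == sp w Q) = (v == w) && (S == Q).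
Proof.
apply/eqP/andP=> [E|[/eqP-> /eqP->]//].
have vw : v = w by apply/permP=> t; have := congr1 (fun x : {perm _} => (x (t, false)).1) E; rewrite !spE.
split; apply/eqP=> //; apply/ffunP=> t.
have := congr1 (fun x : {perm _} => (x (v^-1 t, false)%g).2) E.
by rewrite !spE -vw permKV.
Qed.

Lemma spV v S : ((sp v S)^-1)%g = sp v^-1 (sact v^-1 S).
Proof.
apply/eqP; rewrite eq_invg_mul spM mulgV -sp1; apply/eqP; congr sp.
by apply/ffunP=> t; rewrite !ffunE addbb.
Qed.

Lemma sp_split v S : sp v S = (sp v szero * sp 1 S)%g.
Proof.
rewrite spM mulg1; congr sp; apply/ffunP=> t.
by rewrite !ffunE addFb.
Qed.

Lemma liftM v w : sp (v * w) szero = (sp v szero * sp w szero)%g.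
Proof. by rewrite spM; congr sp; apply/ffunP=> i; rewrite !ffunE. Qed.

Lemma sp1M S Q : (sp 1 S * sp 1 Q)%g = sp 1 (sadd S Q).
Proof.
rewrite spM mulg1; congr sp; apply/ffunP=> t.
by rewrite !ffunE invg1 perm1.
Qed.

Lemma spJ v S y Q : (sp v S ^ sp y Q)%g =
  sp (v ^ y) (sadd (sadd (sact y S) Q) (sact (v ^ y)%g Q)).
Proof.
rewrite conjgE spV !spM -conjgE; congr sp; apply/ffunP=> t.
rewrite !ffunE invgK; have -> : ((v ^ y)^-1 t = y ((v * y)^-1 t))%g.
  by rewrite conjgE invMg invgK permM.
exact: addbC.
Qed.

(** The exponent of the linear character of the group of sign changes that is -1
    on the coordinates in c and 1 on the others. *)
Definition lamc (c : T -> bool) S : bool := \big[addb/false]_t (c t && S t).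

Lemma lamc_sadd c S Q : lamc c (sadd S Q) = lamc c S (+) lamc c Q.
Proof. by rewrite -big_split; apply: eq_bigr => t _; rewrite ffunE andb_addr. Qed.

Lemma lamc_sact c w S : lamc c (sact w S) = lamc (fun t => c (w t)) S.
Proof.
rewrite /lamc (reindex_inj (@perm_inj _ w)); apply: eq_bigr => t _.
by rewrite ffunE permK.
Qed.

Lemma lamc_szero c : lamc c szero = false.
Proof. by rewrite /lamc big1 // => t _; rewrite ffunE andbF. Qed.

Lemma eq_lamc c c' S : c =1 c' -> lamc c S = lamc c' S.
Proof. by move=> cc; apply: eq_bigr => t _; rewrite cc. Qed.

Definition par S := lamc xpredT S.

Lemma lamc_addb c d S : lamc (fun t => c t (+) d) S = lamc c S (+) (d && par S).
Proof.
case: d => /=; last by rewrite addbF; apply: eq_lamc => t; rewrite addbF.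
by rewrite /par /lamc -big_split; apply: eq_bigr => t _ /=; case: (c t); case: (S t).
Qed.

Lemma par_sact w S : par (sact w S) = par S.
Proof. exact: lamc_sact. Qed.

(** Both types are treated at once: [d] tells whether only even sign changes are
    allowed (type D) or all of them (type B). *)
Definition inW (d : bool) S := d ==> ~~ par S.

Lemma inW_sadd d S Q : inW d S -> inW d Q -> inW d (sadd S Q).
Proof. by case: d => //=; rewrite /inW /= /par lamc_sadd => /negPf-> /negPf->. Qed.
Lemma inW_sact d w S : inW d (sact w S) = inW d S.
Proof. by rewrite /inW par_sact. Qed.
Lemma inW_szero d : inW d szero.
Proof. by rewrite /inW /par lamc_szero implybT. Qed.

Definition Wg_set d : {set {perm (T * bool)}} :=
  [set sp p.1 p.2 | p in [set p : {perm T} * {ffun T -> bool} | inW d p.2]].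

Lemma Wg_setP d x : reflect (exists v S, inW d S /\ x = sp v S) (x \in Wg_set d).
Proof.
apply: (iffP imsetP) => [[[v S]]|[v [S [dS ->]]]]; last by exists (v, S); rewrite ?inE.
by rewrite inE => dS ->; exists v, S.
Qed.

Lemma Wg_group_set d : group_set (Wg_set d).
Proof.
apply/group_setP; split=> [|_ _ /Wg_setP[v [S [dS ->]]] /Wg_setP[w [Q [dQ ->]]]].
  by apply/Wg_setP; exists 1%g, szero; rewrite inW_szero sp1.
apply/Wg_setP; rewrite spM; exists (v * w)%g, (sadd (sact w S) Q); split=> //.
by rewrite inW_sadd ?inW_sact.
Qed.
Definition Wg d : {group {perm (T * bool)}} := Group (Wg_group_set d).

Lemma WgP d x : reflect (exists v S, inW d S /\ x = sp v S) (x \in Wg d).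
Proof. exact: Wg_setP. Qed.

Lemma sp_Wg d v S : (sp v S \in Wg d) = inW d S.
Proof.
apply/WgP/idP => [[w [Q [dQ /eqP]]]|dS]; last by exists v, S.
by rewrite sp_inj => /andP[_ /eqP->].
Qed.

Lemma big_Wg (V : nmodType) d (F : {perm (T * bool)} -> V) :
  \sum_(x in Wg d) F x = \sum_v \sum_(S | inW d S) F (sp v S).
Proof.
rewrite /Wg /= /Wg_set big_imset /=; last first.
  by move=> [v S] [w Q] _ _ /= /eqP; rewrite sp_inj => /andP[/eqP-> /eqP->].
rewrite (eq_bigl (fun p => xpredT p.1 && inW d p.2)) => [|p]; last by rewrite inE.
by rewrite -(pair_big xpredT (inW d) (fun v S => F (sp v S))).
Qed.

End SignedPerm.

Arguments inW {T} d S : simpl never.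

Section SignedFunctions.

Variables (K : fieldType) (T : finType) (c : T -> bool).
Hypothesis charK : [pchar K] =i pred0.
Implicit Types (v w y : {perm T}) (S Q : {ffun T -> bool}) (F : {perm T} -> K).

Definition Neven d : K := #|[pred S : {ffun T -> bool} | inW d S]|%:R.

Lemma Neven_neq0 d : Neven d != 0.
Proof.
apply: natrK_neq0 => //; apply/card_gt0P; exists (szero T).
by rewrite inE inW_szero.
Qed.

(** F times the average of the sign changes against the linear character
    [lamc c]. *)
Definition zfun d F (x : {perm (T * bool)}) : K :=
  \sum_v \sum_(S | inW d S && (sp v S == x)) F v * (-1) ^+ lamc c S / Neven d.

Lemma zfun_sp d F v S : inW d S -> zfun d F (sp v S) = F v * (-1) ^+ lamc c S / Neven d.
Proof.
move=> dS; rewrite /zfun (bigD1 v) //= [X in _ + X]big1 ?addr0 => [|w nw].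
  rewrite (big_pred1 S) // => Q; rewrite sp_inj eqxx /=.
  by case: eqP => [->|_]; rewrite ?dS ?andbF.
by rewrite big1 // => Q; rewrite sp_inj (negPf nw) andbF.
Qed.

(** Permutations preserving the colouring c, if b is false, or exchanging the two
    colours, if b is true. *)
Definition flips (b : bool) v := forall t, c (v t) = c t (+) b.

(** The character of the idempotent [zfun c d F]: conjugation by sign changes
    has no effect, so only the sum over permutations y remains. *)
Definition Theta F v S : K :=
  \sum_y F (v^-1 ^ y)%g * (-1) ^+ lamc (fun t => c (y t)) S.

(** The condition making F commute with the average of the sign changes.  An
    exchange of colours multiplies [lamc c] by the parity character, so it is
    allowed only for even sign changes. *)
Definition compatible d F := forall v, F v != 0 -> exists2 b, flips b v & d || ~~ b.

Lemma ch_zfun d F v S : compatible d F -> inW d S ->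
  ch (Wg T d) (zfun d F) (sp v S) = Theta F v S.
Proof.
move=> compF dS; rewrite ffunE sp_Wg dS big_Wg; apply: eq_bigr => y _.
have [F0|nzF] := eqVneq (F (v^-1 ^ y)%g) 0.
  rewrite F0 mul0r big1 // => Q dQ.
  rewrite spV spJ zfun_sp ?F0 ?mul0r //.
  by rewrite !inW_sadd ?inW_sact.
have [b bw db] := compF _ nzF.
rewrite (eq_bigr (fun _ => F (v^-1 ^ y)%g * (-1) ^+ lamc (fun t => c (y t)) S / Neven d)).
  rewrite sumr_const -[LHS]mulr_natr mulfVK //; exact: Neven_neq0.
move=> Q dQ; rewrite spV spJ zfun_sp; last by rewrite !inW_sadd ?inW_sact.
have par_b (P : {ffun T -> bool}) : inW d P -> b && par P = false.
  by move: db; rewrite /inW; case: (d); case: (b) => //= _ /negPf.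
congr (_ * (-1) ^+ (nat_of_bool _) / _); rewrite !lamc_sadd !lamc_sact.
have -> : lamc (fun t => c ((v^-1 ^ y)%g t)) Q = lamc c Q.
  by rewrite (eq_lamc _ bw) lamc_addb par_b // addbF.
rewrite -addbA addbb addbF -[RHS]addbF -(par_b S dS) -lamc_addb.
apply: eq_lamc => t; rewrite -bw conjgE !permM permK.
by [].
Qed.

Lemma char_sum0 (E : pred {ffun T -> bool}) (lam : {ffun T -> bool} -> bool) S0 :
    (forall S Q, E S -> E Q -> E (sadd S Q)) ->
    (forall S Q, lam (sadd S Q) = lam S (+) lam Q) ->
    E S0 -> lam S0 ->
  \sum_(S | E S) (-1) ^+ lam S = 0 :> K.
Proof.
move=> addE addlam E0 lam0.
have addK S : sadd (sadd S S0) S0 = S.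
  by apply/ffunP=> t; rewrite !ffunE -addbA addbb addbF.
have EE S : E (sadd S S0) = E S.
  by apply/idP/idP=> [/addE/(_ E0)|/addE/(_ E0)]; rewrite ?addK.
have : \sum_(S | E S) (-1) ^+ lam S = - \sum_(S | E S) (-1) ^+ lam S :> K.
  have inj0 : injective ((@sadd T)^~ S0) by apply: (can_inj (g := (@sadd T)^~ S0)).
  rewrite [LHS](reindex_inj inj0) /= -sumrN (eq_bigl _ _ EE).
  by apply: eq_bigr => S _; rewrite addlam lam0 signr_addb /= mulrN1.
move/eqP; rewrite -addr_eq0 -mulr2n -mulr_natl mulf_eq0.
by rewrite (negPf (natrK_neq0 charK _)) //= => /eqP.
Qed.

End SignedFunctions.

Lemma big_colour (V : nmodType) (T1 T2 : finType) (F : {perm (T1 + T2)} -> V) :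
  \sum_(y : {perm (T1 + T2)} | [forall t, colour (y t) == colour t]) F y =
  \sum_y1 \sum_y2 F (sumperm y1 y2).
Proof.
rewrite pair_big /=.
transitivity (\sum_(p in [set: {perm T1} * {perm T2}]) F (sumperm p.1 p.2)); last first.
  by apply: eq_bigl => p; rewrite inE.
rewrite -(big_imset F (h := fun p => sumperm p.1 p.2)) /=.
  apply: eq_bigl => y; apply/forallP/imsetP => [cy|[[y1 y2] _ ->] t]; last first.
    by rewrite colour_sumperm.
  have [y1 [y2 ->]] := sumperm_colour (fun t => eqP (cy t)).
  by exists (y1, y2); rewrite ?inE.
by move=> [u v] [u' v'] _ _ /= /eqP; rewrite sumperm_inj => /andP[/eqP-> /eqP->].
Qed.

(** * Characters of type D on a coloured set *)

Section EvenAverage.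

Variables (K : fieldType) (T : finType).
Hypothesis charK : [pchar K] =i pred0.
Hypothesis T_gt0 : (0 < #|T|)%N.

(** Orthogonality of the linear characters of the group of even sign changes;
    two of them agree exactly when the colourings are equal or opposite. *)
Lemma avg_even (c c' : T -> bool) :
  \sum_(S : {ffun T -> bool} | inW true S)
     (-1) ^+ lamc c S * (-1) ^+ lamc c' S / Neven K T true =
  \sum_(b : bool) [forall t, c' t == c t (+) b]%:R :> K.
Proof.
have [t0 _] := card_gt0P T_gt0.
pose lam S := lamc c S (+) lamc c' S.
have lamE S : lam S = lamc (fun t => c t (+) c' t) S.
  rewrite /lam /lamc -big_split; apply: eq_bigr => t _ /=.
  by case: (c t); case: (c' t); case: (S t).
rewrite -mulr_suml (eq_bigr (fun S => (-1) ^+ lam S)) => [|S _]; last by rewrite signr_addb.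
case: (boolP [exists b, [forall t, c' t == c t (+) b]]) => [/existsP[b /forallP cb]|none].
  rewrite (eq_bigr (fun=> 1)) => [|S eS]; last first.
    rewrite lamE; move: eS; rewrite /inW /= /par => /negPf parS.
    case: b cb => cb.
      rewrite (@eq_lamc _ _ xpredT) ?parS // => t.
      by rewrite (eqP (cb t)) addbA addbb.
    rewrite (@eq_lamc _ _ (fun=> false)) /lamc ?big1 // => t.
    by rewrite (eqP (cb t)) addbA addbb.
  rewrite sumr_const -[_ *+ _]/(Neven K T true) mulfV ?Neven_neq0 // (bigD1 b) //= big1 ?addr0 => [|b' nb].
    by rewrite (introT forallP cb).
  suff /negPf-> : ~~ [forall t, c' t == c t (+) b'] by [].
  apply/forallPn; exists t0; rewrite (eqP (cb t0)).
  by move: nb; case: b {cb}; case: b'; case: (c t0).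
rewrite [RHS]big1 => [|b _]; last by have := existsPn none b => /negPf->.
have /forallPn[t1 nt1] := existsPn none false.
have /forallPn[t2 nt2] := existsPn none true.
(* t1 and t2 witness that c' is neither c nor its opposite *)
pose S0 := [ffun t => (t == t1) (+) (t == t2)] : {ffun T -> bool}.
have sumS0 (p : T -> bool) : lamc p S0 = p t1 (+) p t2.
  rewrite /lamc; under eq_bigr do rewrite ffunE andb_addr.
  rewrite big_split /= (bigD1 t1) //= [X in _ (+) X (+) _]big1 => [|t /negPf->]; last by rewrite andbF.
  rewrite (bigD1 t2) //= [X in _ (+) (_ (+) X)]big1 => [|t /negPf->]; last by rewrite andbF.
  by rewrite !eqxx !andbT !addbF.
rewrite (char_sum0 charK (S0 := S0)) ?mul0r //.
- by move=> S Q; apply: inW_sadd.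
- by move=> S Q; rewrite !lamE lamc_sadd.
- by rewrite /inW /= /par sumS0.
- rewrite lamE sumS0; move: nt1 nt2; rewrite addbF addbT.
  by case: (c t1); case: (c' t1); case: (c t2); case: (c' t2).
Qed.

End EvenAverage.

Section ClassCh.
Variables (K : fieldType) (gT : finGroupType) (G : {group gT}).
Lemma classfun_ch (z : gT -> K) : classfun G (ch G z).
Proof.
move=> x y Gx Gy; rewrite !ffunE groupJ // Gx (reindex_inj (mulgI y^-1%g)) /=.
apply: eq_big => [g|g Gg]; first by rewrite groupMl ?groupV.
by rewrite -conjVg -conjgM mulKVg.
Qed.
Lemma ch_lin a b (z z' : gT -> K) x :
  ch G (fun y => a * z y + b * z' y) x = a * ch G z x + b * ch G z' x.
Proof.
rewrite !ffunE; case: ifP => _; last by rewrite !mulr0 addr0.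
by rewrite big_split !mulr_sumr.
Qed.
Lemma eq_ch (z z' : gT -> K) : z =1 z' -> ch G z = ch G z'.
Proof. by move=> zz; apply/ffunP=> x; rewrite !ffunE; case: ifP => // _; apply: eq_bigr. Qed.
End ClassCh.

Section Pairing.

Variables (K : fieldType) (T : finType) (c : T -> bool).
Hypothesis charK : [pchar K] =i pred0.
Hypothesis T_gt0 : (0 < #|T|)%N.

Lemma zfun_lin d a b (F F' : {perm T} -> K) x :
  zfun c d (fun v => a * F v + b * F' v) x = a * zfun c d F x + b * zfun c d F' x.
Proof.
rewrite /zfun !mulr_sumr -big_split; apply: eq_bigr => v _ /=.
rewrite !mulr_sumr -big_split; apply: eq_bigr => S _ /=.
by rewrite !mulrDl !mulrA.
Qed.

Lemma ip_zfun (F F' : {perm T} -> K) : compatible c true F' ->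
  ip (Wg T true) (ch (Wg T true) (zfun c true F)) (ch (Wg T true) (zfun c true F')) =
  \sum_(b : bool) \sum_v \sum_(y : {perm T} | [forall t, c (y t) == c t (+) b]) F v * F' (v^-1 ^ y)%g.
Proof.
move=> compF'; rewrite ip_ch //; last exact: classfun_ch.
rewrite big_Wg [RHS]exchange_big /=; apply: eq_bigr => v _.
transitivity (\sum_(y : {perm T}) F v * F' (v^-1 ^ y)%g *
   \sum_(b : bool) [forall t, c (y t) == c t (+) b]%:R).
  transitivity (\sum_(S : {ffun T -> bool} | inW true S) \sum_(y : {perm T}) F v * F' (v^-1 ^ y)%g *
       ((-1) ^+ lamc c S * (-1) ^+ lamc (fun t => c (y t)) S / Neven K T true)).
    apply: eq_bigr => S eS; rewrite zfun_sp // ch_zfun // /Theta mulr_sumr.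
    by apply: eq_bigr => y _; ring.
  rewrite exchange_big; apply: eq_bigr => y _.
  by rewrite -mulr_sumr (avg_even charK T_gt0).
rewrite (eq_bigr _ (fun y _ => mulr_sumr _ _ _ _)) exchange_big.
apply: eq_bigr => b _; rewrite [RHS]big_mkcond.
by apply: eq_bigr => y _; case: ifP => _; rewrite ?mulr1 ?mulr0.
Qed.

Section Aeval.
Variables (m : nat) (r : mx_representation K (Wg T true) m).

Definition lift_sum (F : {perm T} -> K) : 'M[K]_m := \sum_v F v *: r (sp v (szero T)).
Definition sign_sum : 'M[K]_m :=
  \sum_(S : {ffun T -> bool} | inW true S) ((-1) ^+ lamc c S / Neven K T true) *: r (sp 1 S).

Let WM x y : x \in Wg T true -> y \in Wg T true -> r (x * y)%g = r x *m r y.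
Proof. exact: repr_mxM. Qed.

Lemma lift_Wg d (v : {perm T}) : sp v (szero T) \in Wg T d.
Proof. by rewrite sp_Wg inW_szero. Qed.

Lemma aeval_zfun F : aeval r (zfun c true F) = lift_sum F *m sign_sum.
Proof.
rewrite /aeval big_Wg /lift_sum mulmx_suml; apply: eq_bigr => v _.
rewrite mulmx_sumr; apply: eq_bigr => S eS.
rewrite -scalemxAl -scalemxAr -WM ?lift_Wg ?sp_Wg // -sp_split zfun_sp //.
by rewrite scalerA mulrA.
Qed.

Lemma sign_sum_idem : sign_sum *m sign_sum = sign_sum.
Proof.
have N0 := Neven_neq0 T charK true.
rewrite {1}/sign_sum mulmx_suml.
rewrite (eq_bigr (fun=> (Neven K T true)^-1 *: sign_sum)) => [|S eS].
  by rewrite sumr_const -[LHS]scaler_nat scalerA mulfV ?scale1r.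
have addK : involutive (sadd S).
  by move=> Q; apply/ffunP=> t; rewrite !ffunE addbA addbb.
rewrite /sign_sum mulmx_sumr scaler_sumr [RHS](reindex_inj (can_inj addK)) /=.
apply: eq_big => [Q|Q eQ].
  apply/idP/idP=> [eQ|eSQ]; first exact: inW_sadd.
  by rewrite -[Q]addK inW_sadd.
rewrite -scalemxAl -scalemxAr scalerA -WM ?sp_Wg // sp1M scalerA; congr (_ *: _).
by rewrite lamc_sadd signr_addb mulrAC [in RHS]mulrC -!mulrA.
Qed.

Lemma sign_sum_comm b (v : {perm T}) : flips c b v ->
  sign_sum *m r (sp v (szero T)) = r (sp v (szero T)) *m sign_sum.
Proof.
move=> bv; have actVK : cancel (sact v^-1) (sact v).
  by move=> S; apply/ffunP=> t; rewrite !ffunE invgK permKV.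
rewrite /sign_sum mulmx_suml mulmx_sumr (reindex_inj (can_inj actVK)) /=.
apply: eq_big => [S|S]; first by rewrite inW_sact.
rewrite inW_sact => eS; rewrite -scalemxAl -scalemxAr -!WM ?sp_Wg ?inW_sact ?inW_szero //.
have -> : lamc c (sact v^-1 S) = lamc c S.
  rewrite lamc_sact (eq_lamc (c' := fun t => c t (+) b)) => [|t]; last first.
    by rewrite -{2}[t](permKV v) bv -addbA addbb addbF.
  by rewrite lamc_addb; move: eS; rewrite /inW /= => /negPf->; rewrite andbF addbF.
congr (_ *: r _); rewrite !spM mulg1 mul1g; congr sp; apply/ffunP=> t.
by rewrite !ffunE invgK permKV addbF.
Qed.

Lemma lift_sum_comm F : compatible c true F ->
  sign_sum *m lift_sum F = lift_sum F *m sign_sum.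
Proof.
move=> compF; rewrite /lift_sum mulmx_sumr [RHS]mulmx_suml; apply: eq_bigr => v _.
have [->|nz] := eqVneq (F v) 0; first by rewrite !scale0r mul0mx mulmx0.
have [b bv _] := compF v nz.
by rewrite -scalemxAl -scalemxAr (sign_sum_comm bv).
Qed.

End Aeval.

(** The part F and the average of the sign changes are commuting idempotents. *)
Lemma idem_zfun F : compatible c true F ->
    (forall m (r : mx_representation K (Wg T true) m), lift_sum r F *m lift_sum r F = lift_sum r F) ->
  idem (Wg T true) (zfun c true F).
Proof.
move=> compF FF m r; rewrite aeval_zfun; apply: idem_comm_mul => //.
  exact: sign_sum_idem.
by rewrite lift_sum_comm.
Qed.

End Pairing.

Section Degenerate.

Variables (K : fieldType) (l : seq nat).
Hypothesis charK : [pchar K] =i pred0.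
Hypothesis l_gt0 : (0 < sumn l)%N.

Let D := 'I_(sumn l).
Let e : {perm D} -> K := yidem K l.
Let W := Wg (D + D)%type true.
Let col := @colour D D.

(** The element e e (1 + a sw)/2. *)
Definition Fpm (a : K) (v : {perm (D + D)}) : K := 2%:R^-1 * FR e e v + 2%:R^-1 * a * FD e v.

Lemma compatible_FR (T1 T2 : finType) (e1 : {perm T1} -> K) (e2 : {perm T2} -> K) d :
  compatible (@colour T1 T2) d (FR e1 e2).
Proof.
move=> v nz; exists false; last by rewrite orbT.
by move=> t; rewrite (FR_colour nz) addbF.
Qed.

Lemma compatible_FD : compatible col true (FD e).
Proof. by move=> v nz; exists true => // t; rewrite addbT; apply: FD_colour nz t. Qed.

Lemma compatible_lin d (F F' : {perm (D + D)} -> K) a b :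
  compatible col d F -> compatible col d F' ->
  compatible col d (fun v => a * F v + b * F' v).
Proof.
move=> cF cF' v; have [F0|nz] := eqVneq (F v) 0; last by move=> _; apply: cF.
have [F0'|nz'] := eqVneq (F' v) 0; last by move=> _; apply: cF'.
by rewrite F0 F0' !mulr0 addr0 eqxx.
Qed.

Lemma compatible_Fpm a : compatible col true (Fpm a).
Proof. by apply: compatible_lin; [apply: compatible_FR|apply: compatible_FD]. Qed.

Lemma lift_sum_FR_idem m (r : mx_representation K W m) :
  lift_sum r (FR e e) *m lift_sum r (FR e e) = lift_sum r (FR e e).
Proof.
have rM (x y : {perm (D + D)}) : r (sp (x * y) (szero _)) = r (sp x (szero _)) *m r (sp y (szero _)).
  by rewrite -repr_mxM ?lift_Wg // -liftM.
have -> : lift_sum r (FR e e) = (\sum_u e u *: r (sp (sumperm u 1) (szero _))) *m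
                               (\sum_u e u *: r (sp (sumperm 1 u) (szero _))).
  rewrite /lift_sum sum_FR mulmx_suml; apply: eq_bigr => u _.
  rewrite mulmx_sumr; apply: eq_bigr => v _.
  by rewrite -scalemxAl -scalemxAr scalerA -rM sumpermM mulg1 mul1g.
apply: idem_comm_mul.
- apply: (aeval_young_pull charK (phi := fun u => sp (sumperm u 1) (szero _))) => [u||u v].
  + exact: lift_Wg.
  + by rewrite sumperm1 sp1.
  + by rewrite -liftM sumpermM mulg1.
- apply: (aeval_young_pull charK (phi := fun u => sp (sumperm 1 u) (szero _))) => [u||u v].
  + exact: lift_Wg.
  + by rewrite sumperm1 sp1.
  + by rewrite -liftM sumpermM mulg1.
apply: mx_comm_sum => u v; rewrite -!scalemxAl -!scalemxAr -!rM !sumpermM.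
by rewrite !mulg1 !mul1g !scalerA mulrC.
Qed.

Lemma idem_Fpm a : a * a = 1 -> idem W (zfun col true (Fpm a)).
Proof.
move=> aa; apply: idem_zfun => //; first exact: compatible_Fpm.
move=> m r.
have rM (x y : {perm (D + D)}) : r (sp (x * y) (szero _)) = r (sp x (szero _)) *m r (sp y (szero _)).
  by rewrite -repr_mxM ?lift_Wg // -liftM.
set A := lift_sum r (FR e e); pose t := r (sp (sw D) (szero _)).
have tt : t *m t = 1%:M by rewrite -rM swK sp1 repr_mx1.
have FDE : lift_sum r (FD e) = A *m t.
  rewrite /A /lift_sum sum_FD sum_FR mulmx_suml; apply: eq_bigr => u _.
  by rewrite mulmx_suml; apply: eq_bigr => v _; rewrite rM scalemxAl.
have At : A *m t = t *m A.
  rewrite /A /lift_sum mulmx_suml mulmx_sumr (reindex_inj (conjg_inj (sw D))) /=.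
  apply: eq_bigr => v _; rewrite FR_conj_sw -scalemxAl -scalemxAr -!rM.
  by congr (_ *: r (sp _ _)); rewrite conjgE swV -!mulgA swK mulg1.
have AA : A *m A = A := lift_sum_FR_idem r.
have -> : lift_sum r (Fpm a) = A *m (2%:R^-1 *: (1%:M + a *: t)).
  rewrite -scalemxAr mulmxDr mulmx1 -scalemxAr -FDE /A /lift_sum scalerDr scalerA.
  by rewrite !scaler_sumr -big_split; apply: eq_bigr => v _; rewrite scalerDl !scalerA.
apply: idem_comm_mul => //; last first.
  by rewrite -scalemxAr -scalemxAl mulmxDr mulmxDl mulmx1 mul1mx -scalemxAr -scalemxAl At.
have n2 : (2%:R : K) != 0 by apply: natrK_neq0.
set B := 1%:M + _; have tB : (a *: t) *m B = B.
  by rewrite mulmxDr mulmx1 -scalemxAl -scalemxAr scalerA tt aa scale1r addrC.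
rewrite -scalemxAl -scalemxAr {1}/B mulmxDl mul1mx tB -mulr2n -scaler_nat.
by congr (_ *: _); rewrite scalerA mulVf ?scale1r.
Qed.

(** The two halves of the restriction [Rch], which differ by the sign of
    [Dch]. *)
Definition Xpm (a : K) := ch W (zfun col true (Fpm a)).
Definition Rch := ch W (zfun col true (FR e e)).
Definition Dch := ch W (zfun col true (FD e)).

Lemma XpmE a x : Xpm a x = 2%:R^-1 * Rch x + 2%:R^-1 * a * Dch x.
Proof. by rewrite -ch_lin; congr (fun_of_fin _ x); apply: eq_ch => y; rewrite -zfun_lin. Qed.

Lemma XpmD x : Xpm 1 x + Xpm (-1) x = Rch x.
Proof.
have n2 : (2%:R : K) != 0 by apply: natrK_neq0.
by rewrite !XpmE; field.
Qed.

Lemma is_char_Xpm a : a * a = 1 -> is_char W (Xpm a).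
Proof. by move=> aa; apply/is_char_ch/idem_Fpm. Qed.

Let D_gt0 : (0 < #|{: D + D}|)%N.
Proof. by rewrite card_sum card_ord addn_gt0 l_gt0. Qed.

(** The sum factors into two copies of [young_idem_norm]. *)
Lemma sum_FR_norm : \sum_v \sum_(y : {perm (D + D)} | [forall t, col (y t) == col t]) FR e e v * FR e e (v^-1 ^ y)%g = 1.
Proof.
under eq_bigr do rewrite -mulr_sumr big_colour.
rewrite (sum_FRm e e).
pose nu u := e u * \sum_y e (u^-1 ^ y)%g.
have nu1 : \sum_u nu u = 1.
  rewrite -(young_idem_norm charK (lj_shape l)); apply: eq_bigr => u _.
  exact: mulr_sumr.
transitivity (\sum_u1 \sum_u2 nu u1 * nu u2).
  apply: eq_bigr => u1 _; apply: eq_bigr => u2 _; rewrite /nu [RHS]mulrACA; congr (_ * _).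
  rewrite mulr_suml; apply: eq_bigr => y1 _; rewrite mulr_sumr; apply: eq_bigr => y2 _.
  by rewrite sumpermV sumpermJ FR_sum.
rewrite (eq_bigr (fun u1 => nu u1 * 1)) => [|u1 _]; last by rewrite -mulr_sumr nu1.
by rewrite -mulr_suml nu1 mulr1.
Qed.

(** One contribution from the permutations preserving the colours, and an equal
    one from those exchanging them. *)
Lemma Rch_norm : ip W Rch Rch = 2%:R.
Proof.
rewrite /Rch ip_zfun //; last exact: compatible_FR.
rewrite big_bool /= addrC.
have E0 : \sum_v \sum_(y : {perm (D + D)} | [forall t, col (y t) == col t (+) false])
      FR e e v * FR e e (v^-1 ^ y)%g = 1.
  rewrite -sum_FR_norm; apply: eq_bigr => v _; apply: eq_bigl => y.
  by apply: eq_forallb => t; rewrite addbF.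
rewrite E0; have -> : \sum_v \sum_(y : {perm (D + D)} | [forall t, col (y t) == col t (+) true])
      FR e e v * FR e e (v^-1 ^ y)%g = 1; last by [].
rewrite -E0; apply: eq_bigr => v _; rewrite (reindex_inj (mulIg (sw D))) /=.
apply: eq_big => [y|y _]; last by rewrite conjgM FR_conj_sw.
by apply: eq_forallb => t; rewrite permM /col colour_sw addbT addbF (inj_eq (can_inj negbK)).
Qed.

(** So the two halves of R have the same degree, and neither is 0. *)
Lemma Dch1 : Dch 1%g = 0.
Proof.
rewrite -(sp1 (D + D)%type) /Dch ch_zfun ?inW_szero //; last exact: compatible_FD.
rewrite /Theta big1 // => y _; rewrite invg1 conj1g.
have [->|/FD_colour nz] := eqVneq (FD e 1%g) 0; first by rewrite mul0r.
by have := nz (inl (Ordinal l_gt0)); rewrite perm1.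
Qed.

Lemma Rch1 : Rch 1%g != 0.
Proof.
rewrite -(sp1 (D + D)%type) /Rch ch_zfun ?inW_szero //; last exact: compatible_FR.
rewrite /Theta (eq_bigr (fun=> e 1%g * e 1%g)) => [|y _]; last first.
  by rewrite invg1 conj1g lamc_szero mulr1 -sumperm1 FR_sum.
have nze : e 1%g != 0 := young_idem1_neq0 charK (lj_shape l).
rewrite sumr_const -mulr_natr; apply: mulf_neq0; first exact: mulf_neq0.
by apply: natrK_neq0 => //; apply/card_gt0P; exists 1%g.
Qed.

Lemma irrchar_Xpm a : a * a = 1 -> irrchar W (Xpm a).
Proof.
have n2 : (2%:R : K) != 0 by apply: natrK_neq0.
have nz b : Xpm b 1%g != 0.
  by rewrite XpmE Dch1 mulr0 addr0 mulf_neq0 ?invr_eq0 ?Rch1.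
move=> aa; apply: (irrchar_two charK (psi := Xpm (- a))) => //.
- exact: is_char_Xpm.
- by apply: is_char_Xpm; rewrite mulrNN.
by rewrite -Rch_norm; apply: eq_ip => x _; rewrite !XpmE; field.
Qed.

Lemma irrchar_Rch_constituent A : irrchar W A -> ip W Rch A != 0 ->
  exists2 a, a = 1 \/ a = -1 & A = Xpm a.
Proof.
move=> irrA; have -> : ip W Rch A = ip W (Xpm 1) A + ip W (Xpm (-1)) A.
  transitivity (ip W (fun x => 1 * Xpm 1 x + 1 * Xpm (-1) x) A).
    by apply: eq_ip => // x _; rewrite !mul1r XpmD.
  by rewrite ip_linl !mul1r.
have [E1|nz1 _] := eqVneq (ip W (Xpm 1) A) 0; last first.
  exists 1; first by left.
  by apply/esym/(irrchar_eq charK _ irrA nz1)/irrchar_Xpm; rewrite mulr1.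
rewrite E1 add0r => nz; exists (-1); first by right.
by apply/esym/(irrchar_eq charK _ irrA nz)/irrchar_Xpm; rewrite mulrNN mulr1.
Qed.

End Degenerate.

(** * Reflection subgroups as groups of signed permutations *)

Section SignedWindow.

Variable n : nat.
Implicit Types (S : {set 'I_n}) (v w : {perm 'I_n}) (Q : {ffun 'I_n -> bool}).

Definition supported S Q := [forall i, (i \notin S) ==> ~~ Q i].
Lemma supportedP S Q : reflect (forall i, i \notin S -> Q i = false) (supported S Q).
Proof.
by apply: (iffP forallP) => sQ i; [move=> Si; have := sQ i; rewrite Si => /negPf
  | apply/implyP=> /sQ->].
Qed.

Definition WS_set S d : {set sperm n} :=
  [set sp p.1 p.2 | p in [set p : {perm 'I_n} * {ffun 'I_n -> bool} |
                          [&& p.1 \in Sym S, supported S p.2 & inW d p.2]]].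

Lemma WS_setP S d x : reflect (exists v Q, [/\ v \in Sym S, supported S Q, inW d Q & x = sp v Q])
  (x \in WS_set S d).
Proof.
apply: (iffP imsetP) => [[[v Q]]|[v [Q [Sv SQ dQ ->]]]].
  by rewrite inE => /and3P[Sv SQ dQ] ->; exists v, Q.
by exists (v, Q); rewrite // inE /= Sv SQ.
Qed.

Lemma Sym_out S v i : v \in Sym S -> i \notin S -> v i = i.
Proof. by rewrite inE => Sv; apply: out_perm. Qed.

Lemma WS_group_set S d : group_set (WS_set S d).
Proof.
apply/group_setP; split=> [|_ _ /WS_setP[v [Q [Sv SQ dQ ->]]] /WS_setP[w [P [Sw SP dP ->]]]].
  apply/WS_setP; exists 1%g, (szero _); rewrite group1 inW_szero sp1; split=> //.
  by apply/supportedP=> i _; rewrite ffunE.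
apply/WS_setP; exists (v * w)%g, (sadd (sact w Q) P); rewrite groupM // spM; split=> //.
  apply/supportedP=> i Si; rewrite !ffunE (supportedP _ _ SP) // addbF.
  by rewrite (Sym_out (groupVr Sw)) // (supportedP _ _ SQ).
by rewrite inW_sadd ?inW_sact.
Qed.
(** The group of type D, if d is true, or B, if d is false, on the coordinates in
    S. *)
Definition WS S d : {group sperm n} := Group (WS_group_set S d).

Lemma WSP S d x : reflect (exists v Q, [/\ v \in Sym S, supported S Q, inW d Q & x = sp v Q])
  (x \in WS S d).
Proof. exact: WS_setP. Qed.

Lemma WS_mono S S' d : S \subset S' -> WS S d \subset WS S' d.
Proof.
move=> SS'; apply/subsetP=> _ /WSP[v [Q [Sv SQ dQ ->]]]; apply/WSP; exists v, Q; split=> //.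
  by move: Sv; rewrite !inE => /subset_trans; apply.
by apply/supportedP=> i S'i; apply: (supportedP _ _ SQ); apply: contra S'i; apply/subsetP.
Qed.

Lemma Sym_tperm S i j : i \in S -> j \in S -> tperm i j \in Sym S.
Proof.
by move=> Si Sj; rewrite inE; apply/subsetP=> z; rewrite inE; case: tpermP => [->|->|_ _ /eqP].
Qed.

Definition delta i : {ffun 'I_n -> bool} := [ffun j => j == i].

Lemma par_delta i : par (delta i) = true.
Proof.
rewrite /par /lamc (bigD1 i) //= ffunE eqxx big1 // => j /negPf ji.
by rewrite ffunE ji.
Qed.

Lemma swapE (i j : 'I_n) : swap i j = sp (tperm i j) (szero _).
Proof.
have tE (c b : bool) t : tperm (i, c) (j, c) (t, b) = (if b == c then tperm i j t else t, b).
  have [->|nb] := eqVneq b c.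
    have inj_c : injective (fun t : 'I_n => (t, c)) by move=> x y [].
    by rewrite -(inj_tperm i j t inj_c).
  by rewrite tpermD // xpair_eqE eq_sym [c == b]eq_sym (negPf nb) andbF.
apply/permP=> -[t b]; rewrite spE ffunE addbF permM !tE.
by case: b.
Qed.

Lemma flipE (i : 'I_n) : flip i = sp 1 (delta i).
Proof.
apply/permP=> -[t b]; rewrite spE ffunE perm1 /flip.
have [->|nti] := eqVneq t i; first by case: b; rewrite ?tpermL ?tpermR.
by rewrite addbF tpermD // xpair_eqE eq_sym (negPf nti).
Qed.

Lemma liftJ v w : sp (v ^ w) (szero _) = (sp v (szero _) ^ sp w (szero _))%g.
Proof. by rewrite spJ; congr sp; apply/ffunP=> i; rewrite !ffunE. Qed.

Lemma signJ Q w : (sp 1 Q ^ sp w (szero _))%g = sp 1 (sact w Q).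
Proof. by rewrite spJ conj1g; congr sp; apply/ffunP=> i; rewrite !ffunE !addbF. Qed.

Lemma sact_delta i w : sact w (delta i) = delta (w i).
Proof. by apply/ffunP=> j; rewrite !ffunE -(inj_eq (@perm_inj _ w)) permKV. Qed.

Lemma sact_sadd w Q P : sact w (sadd Q P) = sadd (sact w Q) (sact w P).
Proof. by apply/ffunP=> i; rewrite !ffunE. Qed.

(** A group containing the swaps of adjacent coordinates of a window contains all
    its permutations; to contain the group of type D it suffices to have one
    double sign change, and one sign change suffices for type B, as the others
    are conjugate. *)

Section Generation.

Variables (k m : nat) (G : {group sperm n}).
Hypothesis le_km : (k + m <= n)%N.
Hypothesis G_swap : forall i j : 'I_n, (k <= i)%N -> (i.+1 < k + m)%N -> j = i.+1 :> nat -> swap i j \in G.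

Lemma gen_swap (i j : 'I_n) : i \in window n k m -> j \in window n k m -> swap i j \in G.
Proof.
have key d : forall i j : 'I_n, (k <= i)%N -> (j < k + m)%N -> j = (i + d).+1 :> nat -> swap i j \in G.
  elim: d => [|d IH] {}i {}j ki jm jE; first by apply: G_swap => //; lia.
  have ltj : (j.-1 < n)%N by have := ltn_ord j; lia.
  pose h := Ordinal ltj; have hE : h = (i + d).+1 :> nat by rewrite /= jE addnS.
  have -> : swap i j = (swap i h ^ swap h j)%g.
    rewrite !swapE -liftJ; congr sp; rewrite tpermJ tpermL tpermD //.
    - by apply/eqP=> /(congr1 (@nat_of_ord n)); lia.
    - by apply/eqP=> /(congr1 (@nat_of_ord n)); lia.
  by rewrite groupJ //; [apply: IH; lia | apply: G_swap; lia].
rewrite !inE => /andP[ki im] /andP[kj jm].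
have [ij|ji|/val_inj->] := ltngtP i j.
- by apply: (key (j - i.+1)%N) => //; lia.
- by rewrite swapE tpermC -swapE; apply: (key (i - j.+1)%N) => //; lia.
- by rewrite swapE tperm1 sp1 group1.
Qed.

Lemma gen_lift v : v \in Sym (window n k m) -> sp v (szero _) \in G.
Proof.
have inj_f := @winj_inj _ _ _ le_km.
case/(Sym_embP inj_f _ (window_winj le_km)) => u ->.
have [ts [-> _]] := emb_prod_tperm u inj_f.
elim: ts => [|t ts IH]; first by rewrite big_nil sp1 group1.
rewrite big_cons liftM groupM // -swapE; apply: gen_swap;
  by rewrite window_winj codom_f.
Qed.

Lemma gen_even (i0 j0 : 'I_n) : i0 \in window n k m -> j0 \in window n k m -> i0 != j0 ->
  sp 1 (sadd (delta i0) (delta j0)) \in G -> WS (window n k m) true \subset G.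
Proof.
move=> Si0 Sj0 nij Gij.
have Gi i : i \in window n k m -> sp 1 (sadd (delta i) (delta i0)) \in G.
  move=> Si; have [->|nii] := eqVneq i i0.
    have -> : sadd (delta i0) (delta i0) = szero _ by apply/ffunP=> j; rewrite !ffunE addbb.
    by rewrite sp1 group1.
  have -> : sp 1 (sadd (delta i) (delta i0)) =
      (sp 1 (sadd (delta i0) (delta j0)) ^ sp (tperm i j0) (szero _))%g.
    rewrite signJ sact_sadd !sact_delta tpermR tpermD //; last by rewrite eq_sym.
    by congr sp; apply/ffunP=> j; rewrite !ffunE addbC.
  by rewrite groupJ // gen_lift // Sym_tperm.
apply/subsetP=> _ /WSP[v [Q [Sv SQ dQ ->]]]; rewrite sp_split groupM ?gen_lift //.
(* Q is the product of the double sign changes at i and i0 for i in Q: as Q is even, the changes at i0 cancel *)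
have key s : uniq s -> (\prod_(i <- s | Q i) sp 1 (sadd (delta i) (delta i0)))%g =
    sp 1 [ffun j => ((j \in s) && Q j) (+) (odd (count Q s) && (j == i0))].
  elim: s => [|i s IH] /= => [_|/andP[nis us]].
    by rewrite big_nil -sp1; congr sp; apply/ffunP=> j; rewrite !ffunE.
  rewrite big_cons (IH us) oddD; case Qi: (Q i) => /=; last first.
    congr sp; apply/ffunP=> j; rewrite !ffunE in_cons.
    by have [->|//] := eqVneq j i; rewrite Qi !andbF.
  rewrite spM mulg1; congr sp; apply/ffunP=> j; rewrite !ffunE invg1 perm1 in_cons.
  have [->|nji] := eqVneq j i; first by rewrite (negPf nis) Qi /=; case: (odd _); case: (i == i0).
  by rewrite /=; case: (j \in s); case: (Q j); case: (odd _); case: (j == i0).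
have -> : Q = [ffun j => ((j \in enum 'I_n) && Q j) (+) (odd (count Q (enum 'I_n)) && (j == i0))].
  apply/ffunP=> j; rewrite !ffunE mem_enum /=.
  suff -> : odd (count Q (enum 'I_n)) = par Q by move: dQ; rewrite /inW /= => /negPf->; rewrite addbF.
  rewrite /par /lamc -big_enum /=; elim: (enum 'I_n) => [|i s IH]; first by rewrite big_nil.
  by rewrite big_cons /= oddD IH; case: (Q i).
rewrite -key ?enum_uniq // big_seq_cond; apply: group_prod => i /andP[_ Qi].
by apply: Gi; apply: contraLR Qi => Si; rewrite (supportedP _ _ SQ).
Qed.

Lemma gen_all (i0 : 'I_n) : i0 \in window n k m -> flip i0 \in G ->
  WS (window n k m) false \subset G.
Proof.
move=> Si0; rewrite flipE => Gi0.
have Gi i : i \in window n k m -> sp 1 (delta i) \in G.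
  move=> Si; have -> : sp 1 (delta i) = (sp 1 (delta i0) ^ sp (tperm i0 i) (szero _))%g.
    by rewrite signJ sact_delta tpermL.
  by rewrite groupJ // gen_lift // Sym_tperm.
apply/subsetP=> _ /WSP[v [Q [Sv SQ _ ->]]]; rewrite sp_split groupM ?gen_lift //.
have G_even P : supported (window n k m) P -> par P = false -> sp 1 P \in G.
  move=> SP eP; case: (pickP [pred j | (j \in window n k m) && (j != i0)]) => [j /andP[Sj nj]|none].
    have sWG : WS (window n k m) true \subset G.
      by apply: (gen_even Sj Si0 nj); rewrite -sp1M; apply: groupM; apply: Gi.
    by apply: (subsetP sWG); apply/WSP; exists 1%g, P; rewrite group1 /inW eP.
  have P0 : P = szero _.
    have Pj j : j != i0 -> P j = false.
      move=> nj; have := none j; rewrite /= nj andbT => /negbT.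
      exact: (supportedP _ _ SP).
    apply/ffunP=> j; rewrite ffunE; have [->|/Pj//] := eqVneq j i0.
    by rewrite -eP /par /lamc (bigD1 i0) //= big1 ?addbF // => j' /Pj->.
  by rewrite P0 sp1 group1.
case pQ: (par Q); last exact: G_even.
have -> : Q = sadd (sadd Q (delta i0)) (delta i0).
  by apply/ffunP=> j; rewrite !ffunE -addbA addbb addbF.
rewrite -sp1M; apply: groupM (Gi _ Si0); apply: G_even; last by rewrite /par lamc_sadd -!/(par _) pQ par_delta.
apply/supportedP=> j Sj; rewrite !ffunE (supportedP _ _ SQ) //.
by case: eqP => // E; rewrite E Si0 in Sj.
Qed.

End Generation.

End SignedWindow.

Section TypeDSubgroups.

Variable n : nat.
Implicit Types (S : {set 'I_n}) (i j : 'I_n).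

Lemma lift_WS S d (v : {perm 'I_n}) : v \in Sym S -> sp v (szero _) \in WS S d.
Proof.
move=> Sv; apply/WSP; exists v, (szero _); rewrite inW_szero; split=> //.
by apply/supportedP=> i _; rewrite ffunE.
Qed.

Lemma swap_WS S d i j : i \in S -> j \in S -> swap i j \in WS S d.
Proof. by move=> Si Sj; rewrite swapE lift_WS ?Sym_tperm. Qed.

Lemma flip_WS S i : i \in S -> flip i \in WS S false.
Proof.
move=> Si; rewrite flipE; apply/WSP; exists 1%g, (delta i); rewrite group1; split=> //.
by apply/supportedP=> j Sj; rewrite ffunE; case: eqP => // E; rewrite E Si in Sj.
Qed.

(** The extra generators of type D: the swap of i and j with a change of both
    signs. *)
Definition dswap i j : sperm n := (flip j * swap i j * flip j)%g.

Lemma dswapE i j : dswap i j = sp (tperm i j) (sadd (delta i) (delta j)).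
Proof.
rewrite /dswap !flipE swapE !spM mul1g mulg1; congr sp; apply/ffunP=> k.
rewrite !ffunE invg1 perm1 addbF tpermV; congr (_ (+) _).
by case: tpermP => [->|->|/eqP/negPf ki /eqP/negPf kj]; rewrite ?eqxx // ?ki ?kj // eq_sym.
Qed.

Lemma dswap_sym i j : dswap i j = dswap j i.
Proof. by rewrite !dswapE tpermC; congr sp; apply/ffunP=> k; rewrite !ffunE addbC. Qed.

Lemma dswap_WS S i j : i \in S -> j \in S -> i != j -> dswap i j \in WS S true.
Proof.
move=> Si Sj nij; rewrite dswapE; apply/WSP; eexists; eexists; split; last by [].
- exact: Sym_tperm.
- apply/supportedP=> k Sk; rewrite !ffunE.
  by case: eqP => [E|_]; [rewrite E Si in Sk | case: eqP => // E; rewrite E Sj in Sk].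
- by rewrite /inW /= /par lamc_sadd -!/(par _) !par_delta.
Qed.

Lemma dswap_gen (G : {group sperm n}) i j : swap i j \in G -> dswap i j \in G ->
  sp 1 (sadd (delta i) (delta j)) \in G.
Proof.
move=> Gs Gd; have -> : sp 1 (sadd (delta i) (delta j)) = (swap i j * dswap i j)%g.
  rewrite swapE dswapE spM tperm2; congr sp; apply/ffunP=> k.
  by rewrite !ffunE addFb.
exact: groupM.
Qed.

Lemma adj_swapE i j : j = i.+1 :> nat -> adj_swap n j = swap i j.
Proof.
by move=> jE; rewrite /adj_swap {1}jE /= !valK.
Qed.

Lemma gentE i k : k = i.+1 -> gent n k = flip i.
Proof. by move=> ->; rewrite /gent /= valK. Qed.

Lemma gens_adj i j : j = i.+1 :> nat -> gens n j = swap i j.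
Proof.
move=> jE; have j0 : (j == 0%N :> nat) = false by lia.
have jn : (j == n :> nat) = false by have := ltn_ord j; lia.
by rewrite /gens j0 jn (@adj_swapE i j).
Qed.

Lemma gens_0 i j : i = 0%N :> nat -> j = 1%N :> nat -> gens n 0 = dswap i j.
Proof.
move=> i0 j1; have ji : j = i.+1 :> nat by rewrite i0.
rewrite /gens eqxx (@gentE i) ?i0 // -j1 (@adj_swapE i j) // dswap_sym.
by rewrite /dswap !swapE tpermC.
Qed.

Lemma gens_n i j : j = i.+1 :> nat -> n = j.+1 -> gens n n = dswap i j.
Proof.
move=> jE nE; have n0 : (n == 0)%N = false by lia.
have n1 : n.-1 = j by lia.
by rewrite /gens n0 eqxx n1 (@gentE j) // (@adj_swapE i j).
Qed.

Lemma window_Ord k m x (ltx : (x < n)%N) : (Ordinal ltx \in window n k m) = (k <= x < k + m)%N.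
Proof. by rewrite inE. Qed.

Lemma genbyP (I : seq nat) (G : {group sperm n}) :
  reflect (forall x, x \in I -> gens n x \in G) (genby n I \subset G).
Proof.
rewrite gen_subG; apply: (iffP subsetP) => [sIG x Ix|sIG x].
  by apply: sIG; rewrite inE map_f.
by rewrite inE => /mapP[y Iy ->]; apply: sIG.
Qed.

Lemma mem_genby (I : seq nat) x : x \in I -> gens n x \in genby n I.
Proof. by move=> Ix; apply: mem_gen; rewrite inE map_f. Qed.

(** Type D_1 is trivial, a single sign cannot be changed. *)
Lemma WS_trivial S (G : {group sperm n}) : (#|S| <= 1)%N -> WS S true \subset G.
Proof.
move=> S1; apply/subsetP=> _ /WSP[v [Q [Sv SQ dQ ->]]].
have -> : v = 1%g by move: Sv; rewrite inE => /perm_on_id; apply.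
suff -> : Q = szero _ by rewrite sp1 group1.
apply/ffunP=> i; rewrite ffunE; case Qi: (Q i) => //.
have Si : i \in S by apply: contraTT isT => /(supportedP _ _ SQ); rewrite Qi.
move: dQ; rewrite /inW /= /par /lamc (bigD1 i) //= Qi big1 // => j nj.
apply: (supportedP _ _ SQ); apply: contra nj => Sj.
by apply/eqP/(card_le1_eqP S1).
Qed.

Lemma card_window1 k : (#|window n k 1| <= 1)%N.
Proof.
apply/card_le1_eqP=> i j; rewrite !inE => Si Sj; apply: val_inj => /=.
by move: Si Sj; lia.
Qed.

Lemma Wtilde_WS k m : (k + m <= n)%N -> Wtilde n k m :=: WS (window n k m) false.
Proof.
move=> km; apply/eqP; rewrite eqEsubset; apply/andP; split.
  rewrite gen_subG subUset; apply/andP; split.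
    apply/subsetP=> x; rewrite inE => /mapP[y]; rewrite mem_index_iota => /andP[ky ym] ->.
    have ly : (y < n)%N by lia.
    have ly1 : (y.-1 < n)%N by lia.
    have -> : adj_swap n y = swap (Ordinal ly1) (Ordinal ly).
      by rewrite -(@adj_swapE (Ordinal ly1) (Ordinal ly)) //=; lia.
    by apply: swap_WS; rewrite window_Ord; lia.
  case: eqP => [|/eqP m0]; first by rewrite sub0set.
  have lkm : ((k + m).-1 < n)%N by lia.
  rewrite sub1set (@gentE (Ordinal lkm)) /=; last by lia.
  by apply: flip_WS; rewrite window_Ord; lia.
have [m0|m_gt0] := posnP m.
  apply/subsetP=> _ /WSP[v [Q [Sv SQ dQ ->]]].
  have S0 : window n k m = set0 by apply/setP=> i; rewrite !inE m0; lia.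
  have -> : v = 1%g by move: Sv; rewrite inE => /perm_on_id; apply; rewrite S0 cards0.
  suff -> : Q = szero _ by rewrite sp1 group1.
  by apply/ffunP=> i; rewrite ffunE (supportedP _ _ SQ) // S0 inE.
have lkm : ((k + m).-1 < n)%N by lia.
apply: (@gen_all _ _ _ _ km _ (Ordinal lkm)).
- move=> i j ki im jE; rewrite -adj_swapE //; apply: mem_gen; rewrite inE; apply/orP; left.
  by rewrite inE map_f // mem_index_iota; lia.
- by rewrite window_Ord; lia.
apply: mem_gen; rewrite inE; apply/orP; right; rewrite -(@gentE _ (k + m)%N) /=; last by lia.
have m0F : (m == 0)%N = false by lia.
by rewrite m0F inE eqxx.
Qed.

Lemma gen_WS k m (G : {group sperm n}) : (k + m <= n)%N -> (1 < m)%N ->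
    (forall i j, (k <= i)%N -> (i.+1 < k + m)%N -> j = i.+1 :> nat -> swap i j \in G) ->
    (exists i j, [/\ i \in window n k m, j \in window n k m, j = i.+1 :> nat & dswap i j \in G]) ->
  WS (window n k m) true \subset G.
Proof.
move=> km m1 Gs [i [j [Si Sj jE Gd]]]; apply: (gen_even km Gs Si Sj).
  by apply/eqP=> E; move: jE; rewrite E; lia.
apply: dswap_gen => //; apply: Gs => //; move: Si Sj; rewrite !inE; lia.
Qed.

Lemma Wfull_WS : (1 < n)%N -> Wfull n :=: WS (window n 0 n) true.
Proof.
move=> n1; rewrite /Wfull n1.
have l1 : (n.-1 < n)%N by lia.
have l2 : (n.-2 < n)%N by lia.
have gnE : gens n n = dswap (Ordinal l2) (Ordinal l1) by apply: gens_n => /=; lia.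
have nl : Ordinal l2 != Ordinal l1 by rewrite -val_eqE /=; lia.
apply/eqP; rewrite eqEsubset; apply/andP; split.
  apply/genbyP=> x; rewrite mem_index_iota => /andP[x0 xn].
  have [->|nx] := eqVneq x n; first by rewrite gnE dswap_WS // window_Ord; lia.
  have lx : (x < n)%N by lia.
  have lx1 : (x.-1 < n)%N by lia.
  rewrite (@gens_adj (Ordinal lx1) (Ordinal lx)) /=; last by lia.
  by rewrite swap_WS // window_Ord; lia.
apply: gen_WS => // [i j ki im jE|].
  by rewrite -(gens_adj jE) mem_genby // mem_index_iota; lia.
exists (Ordinal l2), (Ordinal l1); rewrite !window_Ord -gnE; split=> //=; try lia.
by rewrite mem_genby // mem_index_iota; lia.
Qed.

Lemma Wleft_WS a : (0 < a < n)%N -> Wleft n a :=: WS (window n 0 a) true.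
Proof.
move=> /andP[a0 an]; rewrite /Wleft; case: eqP => [->|/eqP a1].
  apply/eqP; rewrite eqEsubset sub1G /=.
  by apply: (WS_trivial 1%G); apply: card_window1.
have l0 : (0 < n)%N by lia.
have l1 : (1 < n)%N by lia.
have g0E : gens n 0 = dswap (Ordinal l0) (Ordinal l1) by apply: gens_0.
apply/eqP; rewrite eqEsubset; apply/andP; split.
  apply/genbyP=> x; rewrite mem_iota => /andP[_ xa].
  have [->|nx] := eqVneq x 0%N; first by rewrite g0E dswap_WS // window_Ord; lia.
  have lx : (x < n)%N by lia.
  have lx1 : (x.-1 < n)%N by lia.
  rewrite (@gens_adj (Ordinal lx1) (Ordinal lx)) /=; last by lia.
  by rewrite swap_WS // window_Ord; lia.
apply: gen_WS => // [||i j ki im jE|]; try lia.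
  by rewrite -(gens_adj jE) mem_genby // mem_iota; lia.
exists (Ordinal l0), (Ordinal l1); rewrite !window_Ord -g0E; split=> //=; try lia.
by rewrite mem_genby // mem_iota; lia.
Qed.

Lemma Wright_WS a b : (0 < a)%N -> (0 < b)%N -> (a + b = n)%N ->
  Wright n a b :=: WS (window n a b) true.
Proof.
move=> a0 b0 abn; rewrite /Wright; case: eqP => [->|/eqP b1].
  apply/eqP; rewrite eqEsubset sub1G /=.
  by apply: (WS_trivial 1%G); apply: card_window1.
have l1 : (n.-1 < n)%N by lia.
have l2 : (n.-2 < n)%N by lia.
have gnE : gens n n = dswap (Ordinal l2) (Ordinal l1) by apply: gens_n => /=; lia.
have nl : Ordinal l2 != Ordinal l1 by rewrite -val_eqE /=; lia.
apply/eqP; rewrite eqEsubset; apply/andP; split.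
  apply/genbyP=> x; rewrite mem_index_iota => /andP[x0 xn].
  have [->|nx] := eqVneq x n; first by rewrite gnE dswap_WS // window_Ord; lia.
  have lx : (x < n)%N by lia.
  have lx1 : (x.-1 < n)%N by lia.
  rewrite (@gens_adj (Ordinal lx1) (Ordinal lx)) /=; last by lia.
  by rewrite swap_WS // window_Ord; lia.
apply: gen_WS => // [||i j ki im jE|]; try lia.
  by rewrite -(gens_adj jE) mem_genby // mem_index_iota; lia.
exists (Ordinal l2), (Ordinal l1); rewrite !window_Ord -gnE; split=> //=; try lia.
by rewrite mem_genby // mem_index_iota; lia.
Qed.

Lemma WaWb_join a b : (4 <= n)%N -> (0 < a)%N -> (0 < b)%N -> (a + b = n)%N ->
  WaWb n a :=: (Wleft n a <*> Wright n a b)%g.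
Proof.
move=> n4 a0 b0 abn; apply/eqP; rewrite eqEsubset join_subG; apply/and3P; split.
- apply/genbyP=> x; rewrite mem_filter mem_iota => /andP[xE /andP[_ xn]].
  have [xa|ax] := ltnP x a.
    apply: (subsetP (joing_subl _ _)); rewrite /Wleft; move: xE.
    case: eqP => [a1|_ _]; first by rewrite !inE; lia.
    by rewrite mem_genby // mem_iota; lia.
  apply: (subsetP (joing_subr _ _)); rewrite /Wright; move: xE.
  case: eqP => [a1|na1]; first by case: eqP => [|_]; rewrite ?inE => *; [lia|rewrite mem_genby // mem_index_iota; lia].
  case: eqP => [a1|nan]; rewrite !inE => xE; first by lia.
  by case: eqP => [|_]; [lia|rewrite mem_genby // mem_index_iota; lia].
- rewrite /Wleft; case: eqP => [|/eqP a1]; first by rewrite sub1G.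
  apply/genbyP=> x; rewrite mem_iota => /andP[_ xa]; apply: mem_genby.
  rewrite mem_filter mem_iota (negPf a1); apply/andP; split; last by lia.
  by case: eqP; rewrite !inE; lia.
- rewrite /Wright; case: eqP => [|/eqP b1]; first by rewrite sub1G.
  apply/genbyP=> x; rewrite mem_index_iota => /andP[ax xn]; apply: mem_genby.
  rewrite mem_filter mem_iota; apply/andP; split; last by lia.
  by case: eqP => [|_]; [|case: eqP]; rewrite !inE; lia.
Qed.

(** The symmetric group on S, without sign changes. *)
Definition LS_set S : {set sperm n} := [set sp v (szero _) | v in Sym S].
Lemma LS_group_set S : group_set (LS_set S).
Proof.
apply/group_setP; split=> [|_ _ /imsetP[v Sv ->] /imsetP[w Sw ->]].
  by rewrite -sp1; apply: imset_f; rewrite group1.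
by rewrite -liftM; apply: imset_f; rewrite groupM.
Qed.
Definition LS S : {group sperm n} := Group (LS_group_set S).

Lemma genby_LS k m : (k + m <= n)%N -> (0 < m)%N ->
  genby n (index_iota k.+1 (k + m)) :=: LS (window n k m).
Proof.
move=> km m0; apply/eqP; rewrite eqEsubset; apply/andP; split.
  apply/genbyP=> x; rewrite mem_index_iota => /andP[kx xm].
  have lx : (x < n)%N by lia.
  have lx1 : (x.-1 < n)%N by lia.
  rewrite (@gens_adj (Ordinal lx1) (Ordinal lx)) /=; last by lia.
  by rewrite swapE; apply/imset_f/Sym_tperm; rewrite window_Ord; lia.
apply/subsetP=> _ /imsetP[v Sv ->]; apply: (gen_lift km _ Sv) => i j ki im jE.
by rewrite -(gens_adj jE) mem_genby // mem_index_iota; lia.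
Qed.

Lemma genby_conj (I J : seq nat) t :
    (forall x, x \in I -> (gens n x ^ flip t \in genby n J)%g) ->
    (forall x, x \in J -> (gens n x ^ flip t \in genby n I)%g) ->
  (genby n J :=: genby n I :^ flip t)%g.
Proof.
have tt : ((flip t)^-1 = flip t :> sperm n)%g by apply: tpermV.
move=> IJ JI; apply/eqP; rewrite eqEsubset; apply/andP; split.
  by apply/genbyP=> x Jx; rewrite mem_conjg tt JI.
rewrite sub_conjg tt; apply/(genbyP _ (genby n J :^ flip t)%G) => x Ix.
by rewrite /= mem_conjg tt IJ.
Qed.

Lemma flipV i : ((flip i)^-1 = flip i :> sperm n)%g.
Proof. exact: tpermV. Qed.

Lemma swap_flip i j : (swap i j ^ flip j = dswap i j :> sperm n)%g.
Proof. by rewrite conjgE flipV mulgA. Qed.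

Lemma dswap_flip i j : (dswap i j ^ flip j = swap i j :> sperm n)%g.
Proof. by rewrite -swap_flip -conjgM tperm2 conjg1. Qed.

Lemma swap_flip_out i j t : t != i -> t != j -> (swap i j ^ flip t = swap i j :> sperm n)%g.
Proof.
move=> ti tj; rewrite !swapE flipE spJ conjg1; congr sp; apply/ffunP=> k.
rewrite !ffunE addFb tpermV; case: tpermP => [->|->|_ _]; rewrite ?addbb //.
  by rewrite eq_sym (negPf ti) eq_sym (negPf tj).
by rewrite eq_sym (negPf tj) eq_sym (negPf ti).
Qed.

(** Conjugating by the sign change of the last coordinate replaces the last
    generator s_(n-1) by s_n and fixes the others. *)
Lemma Hright_LS k m (I : bool -> seq nat) (s : bool) (t : 'I_n) :
    (1 < m)%N -> (k + m)%N = n -> t = n.-1 :> nat ->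
    I false = index_iota k.+1 n -> I true = rcons (index_iota k.+1 n.-1) n ->
  (genby n (I s) :=: LS (window n k m) :^ (flip t ^+ s))%g.
Proof.
move=> m1 kmn tE I0 I1; have kmn' : (k + m <= n)%N by rewrite kmn.
have LSE : genby n (I false) :=: LS (window n k m).
  by rewrite I0 -(genby_LS kmn') ?kmn //; lia.
case: s; last by rewrite expg0 conjsg1 LSE.
rewrite expg1 -LSE; have l2 : (n.-2 < n)%N by lia.
have gnE : gens n n = dswap (Ordinal l2) t by apply: gens_n => /=; lia.
have gn1E : gens n n.-1 = swap (Ordinal l2) t by rewrite -(@gens_adj (Ordinal l2) t) ?tE //=; lia.
have gxE x : (k < x)%N -> (x < n.-1)%N -> (gens n x ^ flip t = gens n x)%g.
  move=> kx xn; have lx : (x < n)%N by lia.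
  have lx1 : (x.-1 < n)%N by lia.
  rewrite (@gens_adj (Ordinal lx1) (Ordinal lx)) /=; last by lia.
  by apply: swap_flip_out; rewrite -val_eqE /= tE; lia.
apply: genby_conj => x; rewrite ?I0 ?I1.
  rewrite mem_index_iota => /andP[kx xn].
  have [->|nx] := eqVneq x n.-1.
    by rewrite gn1E swap_flip -gnE mem_genby // mem_rcons inE eqxx.
  rewrite gxE //; last by lia.
  by rewrite mem_genby // mem_rcons inE mem_index_iota; lia.
rewrite mem_rcons inE => /orP[/eqP->|].
  by rewrite gnE dswap_flip -gn1E mem_genby // mem_index_iota; lia.
rewrite mem_index_iota => /andP[kx xn]; rewrite gxE // mem_genby // mem_index_iota.
lia.
Qed.

(** Conjugating by the sign change of the first coordinate replaces the first
    generator s_1 by s_0 and fixes the others. *)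
Lemma Hleft_LS a (s : bool) (t : 'I_n) : (1 < a)%N -> (a <= n)%N -> t = 0%N :> nat ->
  (Hleft n a s :=: LS (window n 0 a) :^ (flip t ^+ s))%g.
Proof.
move=> a1 an tE; have an' : (0 + a <= n)%N by [].
have LSE : genby n (index_iota 1 a) :=: LS (window n 0 a).
  by rewrite -(genby_LS an') //; lia.
case: s; last by rewrite expg0 conjsg1 LSE.
have l1 : (1 < n)%N by lia.
have g0E : gens n 0 = dswap (Ordinal l1) t by rewrite dswap_sym; apply: gens_0.
have g1E : gens n 1 = swap (Ordinal l1) t.
  by rewrite swapE tpermC -swapE -(@gens_adj t (Ordinal l1)) //= tE.
have gxE x : (1 < x)%N -> (x < a)%N -> (gens n x ^ flip t = gens n x)%g.
  move=> kx xn; have lx : (x < n)%N by lia.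
  have lx1 : (x.-1 < n)%N by lia.
  rewrite (@gens_adj (Ordinal lx1) (Ordinal lx)) /=; last by lia.
  by apply: swap_flip_out; rewrite -val_eqE /= tE; lia.
rewrite expg1 -LSE; apply: genby_conj => x.
  rewrite mem_index_iota => /andP[x1 xa]; have [->|nx] := eqVneq x 1%N.
    by rewrite g1E swap_flip -g0E mem_genby // inE.
  rewrite gxE //; last by lia.
  by rewrite mem_genby // inE mem_index_iota; lia.
rewrite inE => /orP[/eqP->|].
  by rewrite g0E dswap_flip -g1E mem_genby // mem_index_iota; lia.
rewrite mem_index_iota => /andP[kx xn]; rewrite gxE // mem_genby // mem_index_iota.
lia.
Qed.

End TypeDSubgroups.

(** * Signed permutations transported to the coordinates *)

Section Phi.

Variables (T : finType) (n : nat) (f : T -> 'I_n).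
Hypothesis inj_f : injective f.

Definition on_coord (p : T * bool) : 'I_n * bool := (f p.1, p.2).
Lemma on_coord_inj : injective on_coord.
Proof. by move=> [t b] [t' b'] [/inj_f-> ->]. Qed.

(** Signed permutations of T as signed permutations of the coordinates indexed by
    the image of f.  This is an isomorphism from [Wg T d] to the group [WS]
    attached to that image. *)
Definition Phi (x : {perm (T * bool)}) : sperm n := emb on_coord x.

Definition ext (S : {ffun T -> bool}) : {ffun 'I_n -> bool} :=
  [ffun i => if [pick t | f t == i] is Some t then S t else false].

Lemma ext_in S t : ext S (f t) = S t.
Proof.
rewrite ffunE; case: pickP => [j /eqP/inj_f->//|].
by move/(_ t); rewrite eqxx.
Qed.

Lemma ext_out S i : i \notin codom f -> ext S i = false.
Proof.
move=> fi; rewrite ffunE; case: pickP => // t /eqP ft.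
by case/negP: fi; rewrite -ft codom_f.
Qed.

Lemma ext_szero : ext (szero T) = szero _.
Proof.
apply/ffunP=> i; rewrite [RHS]ffunE.
have [/codomP[t ->]|fi] := boolP (i \in codom f); last exact: ext_out.
by rewrite ext_in ffunE.
Qed.

Lemma Phi_sp v S : Phi (sp v S) = sp (emb f v) (ext S).
Proof.
apply/esym/emb_unique; first exact: on_coord_inj.
  by move=> [t b]; rewrite /on_coord spE /= spE emb_in // ext_in.
move=> [i b] fi; have fi' : i \notin codom f.
  by apply: contra fi => /codomP[t ->]; apply/codomP; exists (t, b).
by rewrite spE emb_out // ext_out // addbF.
Qed.

Lemma PhiM x y : Phi (x * y) = (Phi x * Phi y)%g.
Proof. exact/embM/on_coord_inj. Qed.
Lemma PhiV x : Phi x^-1 = (Phi x)^-1%g.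
Proof. exact/embV/on_coord_inj. Qed.
Lemma Phi1 : Phi 1 = 1%g.
Proof. exact/emb1/on_coord_inj. Qed.
Lemma PhiJ x y : Phi (x ^ y) = (Phi x ^ Phi y)%g.
Proof. by rewrite !conjgE !PhiM PhiV. Qed.
Lemma Phi_inj : injective Phi.
Proof. exact/emb_inj/on_coord_inj. Qed.

Lemma big_codom (R : Type) (idx : R) (op : Monoid.com_law idx) (F : 'I_n -> R) :
    (forall i, i \notin codom f -> F i = idx) ->
  \big[op/idx]_i F i = \big[op/idx]_t F (f t).
Proof.
move=> F_out; rewrite (bigID (mem (codom f))) /= [X in op _ X]big1 // Monoid.mulm1.
rewrite -big_uniq; last by rewrite map_inj_uniq // enum_uniq.
by rewrite codomE big_map big_enum.
Qed.

Lemma par_ext S : par (ext S) = par S.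
Proof.
rewrite /par /lamc [LHS]big_codom /= => [|i /ext_out->//].
by apply: eq_bigr => t _; rewrite ext_in.
Qed.

Lemma inW_ext d S : inW d (ext S) = inW d S.
Proof. by rewrite /inW par_ext. Qed.

Lemma unsign_sp (v : {perm 'I_n}) Q : unsign (sp v Q) = v.
Proof.
rewrite /unsign; have -> : [ffun i => (sp v Q (i, false)).1] = val v.
  by apply/ffunP=> i; rewrite ffunE spE /= -pvalE.
exact: valKd.
Qed.

Lemma epsilon'_sp (K : fieldType) (v : {perm 'I_n}) Q : epsilon' K (sp v Q) = (-1) ^+ par Q.
Proof.
rewrite /epsilon' /par /lamc [in RHS](reindex_inj (@perm_inj _ v)) /=.
under eq_bigr do rewrite spE /=.
by rewrite (big_morph (fun b : bool => (-1) ^+ b : K) (@signr_addb K) (erefl _)).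
Qed.

Variable S0 : {set 'I_n}.
Hypothesis S0E : S0 =i codom f.

Lemma WS_PhiP d w : reflect (exists2 x, x \in Wg T d & w = Phi x) (w \in WS S0 d).
Proof.
apply: (iffP (WSP _ _ _)) => [[v [Q [Sv SQ dQ ->]]]|[_ /WgP[v [S [dS ->]]] ->]].
  have [u vE] := Sym_embP inj_f v S0E Sv.
  have QE : Q = ext [ffun t => Q (f t)].
    apply/ffunP=> i; have [/codomP[t ->]|fi] := boolP (i \in codom f).
      by rewrite ext_in ffunE.
    by rewrite ext_out // (supportedP _ _ SQ) // S0E.
  exists (sp u [ffun t => Q (f t)]); last by rewrite Phi_sp -QE vE.
  by rewrite sp_Wg -inW_ext -QE.
exists (emb f v), (ext S); split; last exact: Phi_sp.
- by apply/(Sym_embP inj_f _ S0E); exists v.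
- by apply/supportedP=> i; rewrite S0E; apply: ext_out.
- by rewrite inW_ext.
Qed.

Lemma big_WS (V : nmodType) d (F : sperm n -> V) :
  \sum_(w in WS S0 d) F w = \sum_(x in Wg T d) F (Phi x).
Proof.
rewrite -(big_imset F (h := Phi)) /=; last by move=> x y _ _ /Phi_inj.
by apply: eq_bigl => w; apply/WS_PhiP/imsetP.
Qed.

Lemma card_WS d : #|WS S0 d| = #|Wg T d|.
Proof.
have -> : #|Wg T d| = #|[set Phi x | x in Wg T d]|.
  by apply/esym/card_imset/Phi_inj.
by apply: eq_card => w; apply/WS_PhiP/imsetP.
Qed.

Lemma Phi_WS d x : (Phi x \in WS S0 d) = (x \in Wg T d).
Proof.
by apply/WS_PhiP/idP => [[y Wy /Phi_inj->]|Wx] //; exists x.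
Qed.

Variable K : fieldType.

Definition pushP (z : {perm (T * bool)} -> K) (w : sperm n) : K :=
  \sum_(x | Phi x == w) z x.

Lemma pushP_Phi z x : pushP z (Phi x) = z x.
Proof. by rewrite /pushP (big_pred1 x) // => y; rewrite (inj_eq Phi_inj). Qed.

Lemma ch_Phi d (z : sperm n -> K) x :
  ch (WS S0 d) z (Phi x) = ch (Wg T d) (fun y => z (Phi y)) x.
Proof.
rewrite !ffunE Phi_WS; case: ifP => // _; rewrite big_WS.
by apply: eq_bigr => g _; rewrite -PhiV -PhiJ.
Qed.

Lemma ip_Phi d (F F' : sperm n -> K) :
  ip (WS S0 d) F F' = ip (Wg T d) (fun x => F (Phi x)) (fun x => F' (Phi x)).
Proof.
rewrite /ip card_WS big_WS; congr (_ * _); apply: eq_bigr => x _.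
by rewrite PhiV.
Qed.

Lemma irrchar_Phi d (chi : {ffun sperm n -> K}) : irrchar (WS S0 d) chi ->
  irrchar (Wg T d) [ffun x => chi (Phi x)].
Proof.
case=> m [r /mx_irrP[m0 irr_r] ->].
have phiG x : x \in Wg T d -> Phi x \in WS S0 d by rewrite Phi_WS.
have phiM : {in Wg T d &, forall x y, Phi (x * y)%g = (Phi x * Phi y)%g}.
  by move=> x y _ _; apply: PhiM.
exists m, (pull_repr phiG Phi1 phiM r).
  apply/mx_irrP; split=> // U /mxmoduleP modU; apply: irr_r.
  by apply/mxmoduleP=> w /WS_PhiP[x Wx ->]; apply: modU.
by apply/ffunP=> x; rewrite !ffunE Phi_WS.
Qed.

End Phi.

Arguments Wtilde n k m : simpl never.
Arguments WS {n} S d : simpl never.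
Arguments Wg T d : simpl never.

(** * Characters of type B in terms of idempotents *)

Section DisjointWindows.

Variables (n : nat) (S1 S2 : {set 'I_n}).
Hypothesis dis : forall i, i \in S1 -> i \notin S2.

Lemma sact_disjoint (S S' : {set 'I_n}) (w : {perm 'I_n}) Q :
  (forall i, i \in S -> i \notin S') ->
  w \in Sym S -> supported S' Q -> sact w Q = Q.
Proof.
move=> disS Sw SQ; apply/ffunP=> i; rewrite ffunE.
have [Si|nSi] := boolP (i \in S); last by rewrite (Sym_out (groupVr Sw)).
have Swi : (w^-1 i)%g \in S.
  by move: (groupVr Sw); rewrite inE => /perm_closed->.
by rewrite !(supportedP _ _ SQ) ?disS.
Qed.

Lemma dis_sym i : i \in S2 -> i \notin S1.
Proof. by move=> S2i; apply/negP=> /dis; rewrite S2i. Qed.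

Lemma WS_cent d1 d2 : (WS S2 d2 \subset 'C(WS S1 d1))%g.
Proof.
apply/subsetP=> _ /WSP[w [P [Sw SP dP ->]]]; apply/centP=> _ /WSP[v [Q [Sv SQ dQ ->]]].
rewrite /commute !spM (sact_disjoint _ Sw SQ); last exact: dis_sym.
rewrite (sact_disjoint dis Sv SP); congr sp.
  apply: (@perm_onC _ S2 S1); rewrite ?inE in Sv Sw * => //.
  by rewrite disjoint_sym disjoints_subset; apply/subsetP=> i /dis; rewrite inE.
by apply/ffunP=> i; rewrite !ffunE addbC.
Qed.

Lemma WS_TI d1 d2 : (WS S1 d1 :&: WS S2 d2 = 1)%g.
Proof.
apply/trivgP/subsetP=> _ /setIP[/WSP[v [Q [Sv SQ dQ ->]]] /WSP[w [P [Sw SP dP /eqP]]]].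
rewrite sp_inj => /andP[/eqP vw /eqP QP]; rewrite inE; apply/eqP; rewrite -sp1; congr sp.
  apply/permP=> i; rewrite perm1; have [Si|Si] := boolP (i \in S1).
    by rewrite vw (Sym_out Sw) ?dis.
  by rewrite (Sym_out Sv).
apply/ffunP=> i; rewrite ffunE; have [Si|Si] := boolP (i \in S1).
  by rewrite QP (supportedP _ _ SP) ?dis.
by rewrite (supportedP _ _ SQ).
Qed.

End DisjointWindows.

Section PhiSplit.

Variables (T1 T2 : finType) (n : nat) (F : T1 + T2 -> 'I_n).
Hypothesis inj_F : injective F.

Let Fl (i : T1) := F (inl i).
Let Fr (i : T2) := F (inr i).
Let inj_Fl : injective Fl. Proof. by move=> i j /inj_F[]. Qed.
Let inj_Fr : injective Fr. Proof. by move=> i j /inj_F[]. Qed.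

Definition Sl (S : {ffun T1 + T2 -> bool}) : {ffun T1 -> bool} := [ffun t => S (inl t)].
Definition Sr (S : {ffun T1 + T2 -> bool}) : {ffun T2 -> bool} := [ffun t => S (inr t)].

Lemma Phi_split (u1 : {perm T1}) (u2 : {perm T2}) S :
  Phi F (sp (sumperm u1 u2) S) = (Phi Fl (sp u1 (Sl S)) * Phi Fr (sp u2 (Sr S)))%g.
Proof.
have out_r i b : on_coord F (inl i, b) \notin codom (on_coord Fr).
  by apply/codomP=> -[[j b']] [/inj_F].
have out_l i b : on_coord F (inr i, b) \notin codom (on_coord Fl).
  by apply/codomP=> -[[j b']] [/inj_F].
apply/permP=> x; rewrite permM.
have [/codomP[[[i|i] b] ->]|Fx] := boolP (x \in codom (on_coord F)).
- rewrite /Phi (emb_in _ _ (on_coord_inj inj_F)) spE sumperm_inl.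
  rewrite -[on_coord F (inl i, b)]/(on_coord Fl (i, b)) (emb_in _ _ (on_coord_inj inj_Fl)) spE.
  rewrite -[on_coord Fl _]/(on_coord F (inl (u1 i), b (+) Sl S (u1 i))) (emb_out _ (on_coord_inj inj_Fr)) //.
  by rewrite ffunE.
- rewrite /Phi (emb_in _ _ (on_coord_inj inj_F)) spE sumperm_inr.
  rewrite (emb_out _ (on_coord_inj inj_Fl)) //.
  rewrite -[on_coord F (inr i, b)]/(on_coord Fr (i, b)) (emb_in _ _ (on_coord_inj inj_Fr)) spE.
  by rewrite ffunE.
rewrite /Phi (emb_out _ (on_coord_inj inj_F)) //.
have Flx : x \notin codom (on_coord Fl).
  by apply: contra Fx => /codomP[[i b] ->]; apply/codomP; exists (inl i, b).
have Frx : x \notin codom (on_coord Fr).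
  by apply: contra Fx => /codomP[[i b] ->]; apply/codomP; exists (inr i, b).
by rewrite (emb_out _ (on_coord_inj inj_Fl)) // (emb_out _ (on_coord_inj inj_Fr)).
Qed.

Lemma lamc_colour (S : {ffun T1 + T2 -> bool}) : lamc (@colour T1 T2) S = par (Sr S).
Proof.
rewrite /lamc big_sumType /= big1 // addFb; apply: eq_bigr => t _.
by rewrite ffunE.
Qed.

Lemma lamc_join (c : T1 + T2 -> bool) (S : {ffun T1 + T2 -> bool}) :
  lamc c S = lamc (fun t => c (inl t)) (Sl S) (+) lamc (fun t => c (inr t)) (Sr S).
Proof. by rewrite /lamc big_sumType; congr (_ (+) _); apply: eq_bigr => t _; rewrite ffunE. Qed.

Definition Sjoin (S : {ffun T1 -> bool}) (Q : {ffun T2 -> bool}) : {ffun T1 + T2 -> bool} :=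
  [ffun t => match t with inl i => S i | inr i => Q i end].
Lemma SjoinK S Q : Sl (Sjoin S Q) = S /\ Sr (Sjoin S Q) = Q.
Proof. by split; apply/ffunP=> t; rewrite !ffunE. Qed.

End PhiSplit.

Lemma Neven_false (K : fieldType) (T : finType) : Neven K T false = 2%:R ^+ #|T|.
Proof.
rewrite /Neven -natrX; congr (_%:R); rewrite -(card_bool) -card_ffun.
by apply: eq_card => S; rewrite !inE.
Qed.

Section BcharFormula.

Variables (K : fieldType) (n : nat).
Hypothesis charK : [pchar K] =i pred0.

(** The two factors of [Bchar]: the inflation of a Specht character is the
    character of the idempotent e averaged against the trivial character of the
    sign changes, and the twist by epsilon' replaces the latter by the parity
    character. *)
Lemma inflate_specht k l (le_kl : (k + sumn l <= n)%N) (c0 : bool) :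
  [ffun w => inflate (WS (window n k (sumn l)) false) (specht K n k l) w *
      (if c0 then epsilon' K w else 1)] =
  ch (WS (window n k (sumn l)) false)
     (pushP (winj le_kl) (zfun (fun=> c0) false (yidem K l))).
Proof.
have inj_f := @winj_inj _ _ _ le_kl.
have SE := window_winj le_kl.
apply/ffunP=> w; rewrite [LHS]ffunE [inflate _ _ _]ffunE.
case: ifPn => [/(WS_PhiP inj_f SE)[_ /WgP[v [S [dS ->]]] ->]|/negPf Ww]; last first.
  by rewrite mul0r ffunE Ww.
rewrite (ch_Phi inj_f SE) (eq_ch _ (pushP_Phi inj_f _)) ch_zfun //; last first.
  by move=> u _; exists false => // t; rewrite addbF.
rewrite (Phi_sp inj_f) unsign_sp (specht_emb charK) /schi /Theta mulr_suml.
apply: eq_bigr => y _; congr (_ * _).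
case: c0; first by rewrite epsilon'_sp (par_ext inj_f).
by rewrite /lamc big1.
Qed.

Section OneLabel.

Variables (k : nat) (l1 l2 : seq nat).
Hypothesis le1 : (k + sumn l1 <= n)%N.
Hypothesis le2 : (k + sumn l1 + sumn l2 <= n)%N.
Let T := ('I_(sumn l1) + 'I_(sumn l2))%type.

Definition wsum (t : 'I_(sumn l1) + 'I_(sumn l2)) : 'I_n :=
  match t with inl i => winj le1 i | inr i => winj le2 i end.

Lemma wsum_inj : injective wsum.
Proof.
move=> [i|i] [j|j] /= E; try by rewrite (winj_inj E).
  by have /= := congr1 val E; have := ltn_ord i; lia.
by have /= := congr1 val E; have := ltn_ord j; lia.
Qed.

Lemma wsum_codom : window n k (sumn l1 + sumn l2) =i codom wsum.
Proof.
move=> x; apply/idP/codomP=> [|[[i|i] ->]]; last 2 first.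
- by rewrite inE /=; have := ltn_ord i; lia.
- by rewrite inE /=; have := ltn_ord i; lia.
rewrite inE => /andP[kx xkm]; have [x1|x1] := ltnP x (k + sumn l1).
  have : x \in window n k (sumn l1) by rewrite inE kx x1.
  by rewrite (window_winj le1) => /codomP[i ->]; exists (inl i).
have : x \in window n (k + sumn l1) (sumn l2) by rewrite inE x1 -addnA xkm.
by rewrite (window_winj le2) => /codomP[i ->]; exists (inr i).
Qed.

(** The character [l1;l2] is induced from the idempotents of its two factors,
    hence it is the character of their product.  On T1 + T2 that product is
    e_l1 e_l2 averaged against the linear character that counts the sign changes
    in T2. *)
Lemma Bchar_Phi (v : {perm T}) S :
  Bchar K n k (l1, l2) (Phi wsum (sp v S)) =
    Theta (@colour _ _) (FR (yidem K l1) (yidem K l2)) v S.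
Proof.
pose U := Wtilde n k (sumn l1); pose V := Wtilde n (k + sumn l1) (sumn l2).
have -> : Bchar K n k (l1, l2) = indf (U <*> V) (Wtilde n k (sumn l1 + sumn l2))
   (boxprod U V (inflate U (specht K n k l1))
      [ffun w => inflate V (specht K n (k + sumn l1) l2) w * epsilon' K w]) by [].
have le12 : (k + (sumn l1 + sumn l2) <= n)%N by rewrite addnA.
have UE : U = WS (window n k (sumn l1)) false by apply/val_inj/Wtilde_WS.
have VE : V = WS (window n (k + sumn l1) (sumn l2)) false by apply/val_inj/Wtilde_WS.
have -> : Wtilde n k (sumn l1 + sumn l2) = WS (window n k (sumn l1 + sumn l2)) false.
  exact/val_inj/Wtilde_WS.
rewrite UE VE {U V UE VE}.
set U := WS (window n k (sumn l1)) false; set V := WS (window n (k + sumn l1) _) false.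
set Wt := WS (window n k (sumn l1 + _)) false.
have dis i : i \in window n k (sumn l1) -> i \notin window n (k + sumn l1) (sumn l2).
  by rewrite !inE; lia.
have cUV : (V \subset 'C(U))%g := WS_cent dis _ _.
have tiUV : (U :&: V = 1)%g := WS_TI dis _ _.
pose zU := pushP (winj le1) (zfun (fun=> false) false (yidem K l1)).
pose zV := pushP (winj le2) (zfun (fun=> true) false (yidem K l2)).
have -> : inflate U (specht K n k l1) = ch U zU.
  rewrite /zU -(inflate_specht le1 false); apply/ffunP=> w.
  by rewrite [RHS]ffunE mulr1.
rewrite (inflate_specht le2 true) -/zV.
pose zz x := \sum_(u in U) \sum_(w in V | (u * w)%g == x) zU u * zV w.
rewrite boxprod_ch // -/zz.
have zzE x : zz x = boxprod U V (finfun zU) (finfun zV) x.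
  by rewrite ffunE; apply: eq_bigr => u _; apply: eq_bigr => w _; rewrite !ffunE.
have inj1 := @winj_inj _ _ _ le1; have inj2 := @winj_inj _ _ _ le2.
have S1 := window_winj le1; have S2 := window_winj le2.
have sub_UV : (U <*> V \subset Wt)%g.
  by rewrite join_subG !WS_mono //; apply/subsetP=> i; rewrite !inE; lia.
rewrite (indf_ch charK (H := (U <*> V)%G) sub_UV); last first.
  by move=> x xUV; rewrite zzE boxprod_out.
rewrite (ch_Phi wsum_inj wsum_codom) -(@ch_zfun _ _ _ charK false) //; last exact: compatible_FR.
have zUE x : zU (Phi (fun i => wsum (inl i)) x) =
    zfun (fun=> false) false (yidem K l1) x := pushP_Phi inj1 _ x.
have zVE x : zV (Phi (fun i => wsum (inr i)) x) =
    zfun (fun=> true) false (yidem K l2) x := pushP_Phi inj2 _ x.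
have zzPhi x : x \in Wg T false -> zz (Phi wsum x) = zfun (@colour _ _) false
    (FR (yidem K l1) (yidem K l2)) x.
  case/WgP=> u [Q [_ ->]]; rewrite zzE zfun_sp //.
  case: (boolP [forall t, colour (u t) == colour t]) => [/forallP cu|].
    have [u1 [u2 ->]] := sumperm_colour (fun t => eqP (cu t)).
    rewrite (Phi_split wsum_inj) boxprodE ?Phi_WS ?sp_Wg //.
    rewrite [finfun zU _]ffunE [finfun zV _]ffunE zUE zVE !zfun_sp // FR_sum lamc_colour.
    rewrite [lamc _ (Sl _)]big1 // mulr1 /=.
    rewrite !Neven_false card_sum exprD -/(par _) invfM.
    move: (yidem K _ u1) (yidem K _ u2) (_ ^+ par _) (_ ^+ #|_|)^-1 (_ ^+ #|_|)^-1 => a1 a2 s p q.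
    ring.
  (* both sides vanish off the permutations preserving the colours *)
  move=> ncu; rewrite boxprod_out //; last first.
    apply: contra ncu; rewrite cent_joinEr // => /mulsgP[x' y'].
    move=> /(WS_PhiP inj1 S1)[_ /WgP[u1 [Q1 [_ ->]]] ->].
    move=> /(WS_PhiP inj2 S2)[_ /WgP[u2 [Q2 [_ ->]]] ->].
    have [P [<- <-]] : exists P, Sl P = Q1 /\ Sr P = Q2.
      by exists (Sjoin Q1 Q2); apply: SjoinK.
    have PE1 z : Phi (winj le1) z = Phi (fun i => wsum (inl i)) z by [].
    have PE2 z : Phi (winj le2) z = Phi (fun i => wsum (inr i)) z by [].
    rewrite PE1 PE2 -(Phi_split wsum_inj) => /(Phi_inj wsum_inj)/eqP; rewrite sp_inj.
    by case/andP=> /eqP-> _; apply/forallP=> t; rewrite colour_sumperm.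
  have [->|nz] := eqVneq (FR (yidem K l1) (yidem K l2) u) 0; first by rewrite !mul0r.
  by case/negP: ncu; apply/forallP=> t; rewrite (FR_colour nz).
rewrite !ffunE; case: ifP => // Wx; apply: eq_bigr => g Wg.
by rewrite zzPhi // groupJ // groupV.
Qed.

End OneLabel.

End BcharFormula.

(** * From labels to idempotents *)

Section Match.

Lemma match_inj (T T' : finType) (h1 h2 : T -> T') :
    injective h1 -> injective h2 -> codom h1 =i codom h2 ->
  exists y : {perm T'}, (forall t, y (h1 t) = h2 t) /\
    (forall x, x \notin codom h1 -> y x = x).
Proof.
move=> inj1 inj2 E; pose g x := if [pick t | h1 t == x] is Some t then h2 t else x.
have g_in t : g (h1 t) = h2 t.
  rewrite /g; case: pickP => [j /eqP/inj1->//|]; by move/(_ t); rewrite eqxx.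
have g_out x : x \notin codom h1 -> g x = x.
  move=> hx; rewrite /g; case: pickP => // t /eqP ht.
  by case/negP: hx; rewrite -ht codom_f.
have inj_g : injective g.
  move=> x x'; have [/codomP[t ->]|nx] := boolP (x \in codom h1);
    have [/codomP[t' ->]|nx'] := boolP (x' \in codom h1).
  - by rewrite !g_in => /inj2->.
  - by rewrite g_in g_out // => E'; case/negP: nx'; rewrite -E' E codom_f.
  - by rewrite g_out // g_in => E'; case/negP: nx; rewrite E' E codom_f.
  - by rewrite !g_out.
by exists (perm inj_g); split=> [t|x hx]; rewrite permE; [apply: g_in | apply: g_out].
Qed.

End Match.

Section PhiInverse.

Variables (K : fieldType) (T : finType) (n : nat) (f : T -> 'I_n).
Hypothesis inj_f : injective f.
Variable S0 : {set 'I_n}.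
Hypothesis S0E : S0 =i codom f.

Lemma is_char_Phi_inv d (chi : {ffun sperm n -> K}) :
    is_char (Wg T d) [ffun x => chi (Phi f x)] ->
    (forall w, w \notin WS S0 d -> chi w = 0) ->
  is_char (WS S0 d) chi.
Proof.
case=> m [r rE] chi_out.
pose psi w : {perm (T * bool)} := odflt 1%g [pick x | Phi f x == w].
have psiK x : psi (Phi f x) = x.
  rewrite /psi; case: pickP => [y /eqP/(Phi_inj inj_f)//|].
  by move/(_ x); rewrite eqxx.
have psiG w : w \in WS S0 d -> psi w \in Wg T d.
  by case/(WS_PhiP inj_f S0E) => x Wx ->; rewrite psiK.
have psi1 : psi 1%g = 1%g by rewrite -(Phi1 inj_f) psiK.
have psiM : {in WS S0 d &, forall x y, psi (x * y)%g = (psi x * psi y)%g}.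
  move=> _ _ /(WS_PhiP inj_f S0E)[x _ ->] /(WS_PhiP inj_f S0E)[y _ ->].
  by rewrite -(PhiM inj_f) !psiK.
exists m, (pull_repr psiG psi1 psiM r); apply/ffunP=> w; rewrite ffunE.
case: ifPn => [/(WS_PhiP inj_f S0E)[x Wx ->]|]; last exact: chi_out.
by have := congr1 (fun h : {ffun _ -> _} => h x) rE; rewrite !ffunE Wx /= psiK.
Qed.

End PhiInverse.

Section Labels.

Variables (K : fieldType) (n k : nat).
Hypothesis charK : [pchar K] =i pred0.

Lemma label_nondeg (W : {group sperm n}) H l1 l2 s X
    (le1 : (k + sumn l1 <= n)%N) (le2 : (k + sumn l1 + sumn l2 <= n)%N) :
    W :=: WS (window n k (sumn l1 + sumn l2)) true -> l1 != l2 ->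
    has_label k (sumn l1 + sumn l2) W H (l1, l2) s X ->
  forall v S, inW true S -> X (Phi (wsum le1 le2) (sp v S)) =
    Theta (@colour _ _) (FR (yidem K l1) (yidem K l2)) v S.
Proof.
move=> WE nl; rewrite /has_label /= (negPf nl) => -> v S eS.
rewrite ffunE WE (Phi_WS (@wsum_inj _ _ _ _ le1 le2) (wsum_codom le1 le2)) sp_Wg eS.
exact: Bchar_Phi.
Qed.

Section Degenerate.

Variables (l : seq nat) (s : bool) (X : {ffun sperm n -> K}).
Variables (W : {group sperm n}) (H : bool -> {group sperm n}) (t0 : 'I_n).
Hypothesis l_gt0 : (0 < sumn l)%N.
Hypothesis le1 : (k + sumn l <= n)%N.
Hypothesis le2 : (k + sumn l + sumn l <= n)%N.
Let m := (sumn l + sumn l)%N.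
Hypothesis WE : W :=: WS (window n k m) true.
Hypothesis t0W : t0 \in window n k m.
Hypothesis HE : (H s :=: LS (window n k m) :^ (flip t0 ^+ s))%g.
Hypothesis labX : has_label k m W H (l, l) s X.

Let D := 'I_(sumn l).
Let T := (D + D)%type.
Let F : T -> 'I_n := wsum le1 le2.
Let inj_F : injective F := wsum_inj (le1:=le1) (le2:=le2).
Let F_codom : window n k m =i codom F := wsum_codom le1 le2.
Let e : {perm D} -> K := yidem K l.
Let nu := part_union l l.
Let X' : {ffun {perm (T * bool)} -> K} := [ffun x => X (Phi F x)].

Let WE' : W = WS (window n k m) true. Proof. exact: val_inj. Qed.

Let sum_nu : sumn nu = m.
Proof. by rewrite /m -sumn_cat; apply/perm_sumn; rewrite perm_sort. Qed.

Lemma resf_Bchar_Phi x :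
  [ffun x => resf W (Bchar K n k (l, l)) (Phi F x)] x = Rch K l x.
Proof.
rewrite ffunE [resf _ _ _]ffunE WE' (Phi_WS inj_F F_codom).
case: ifPn => [/WgP[v [S [eS ->]]]|/negPf Wx]; last by rewrite ffunE Wx.
rewrite /F Bchar_Phi // -(@ch_zfun _ _ _ charK true) //; last exact: compatible_FR.
Qed.

(** The label makes X an irreducible constituent of the restriction, so X is one
    of its two halves. *)
Lemma label_pm : exists2 a : K, a = 1 \/ a = -1 & X' = Xpm l a.
Proof.
move: labX; rewrite /has_label /= eqxx => -[irrX mX _].
have irrX' : irrchar (Wg T true) X' by apply: (irrchar_Phi inj_F F_codom); rewrite -WE'.
apply: (irrchar_Rch_constituent charK l_gt0 irrX').
have charR : is_char W (resf W (Bchar K n k (l, l))).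
  rewrite {1}WE'; apply: (is_char_Phi_inv inj_F F_codom); last first.
    by move=> w Ww; rewrite ffunE WE' (negPf Ww).
  have -> : [ffun x => resf W (Bchar K n k (l, l)) (Phi F x)] = Rch K l.
    by apply/ffunP=> x; rewrite resf_Bchar_Phi.
  apply: is_char_ch; apply: idem_zfun => //; first exact: compatible_FR.
  by move=> mm r; apply: lift_sum_FR_idem.
have -> : ip (Wg T true) (Rch K l) X' = ip W (resf W (Bchar K n k (l, l))) X.
  rewrite WE' (ip_Phi inj_F F_codom); apply: eq_ip => x _; last by rewrite ffunE.
  by rewrite -resf_Bchar_Phi ffunE -WE'.
by rewrite -mult_ip // ?natrK_neq0 //; apply: irrchar_char.
Qed.

Definition dchi (u : {perm T}) : K := \sum_g dyidem K (l := l) (u^-1 ^ g)%g.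

(** Up to conjugation the character of shape l u l is computed on the stacked
    tableau, whose cells are the coordinates of the window. *)
Lemma specht_nu u : specht K n k nu (emb F u) = dchi u.
Proof.
have le_nu : (k + sumn nu <= n)%N by rewrite sum_nu addnA.
have [f inj_f fE] := double_relabel K l.
pose h t := winj le_nu (f t).
have inj_w := @winj_inj _ _ _ le_nu.
have inj_h : injective h by move=> x y /inj_w/inj_f.
have f_onto t : t \in codom f.
  by apply: inj_card_onto; rewrite // card_sum !card_ord -/nu sum_nu.
have codom_h : codom h =i codom F.
  move=> i; rewrite -F_codom -{1}sum_nu (window_winj le_nu).
  apply/codomP/codomP=> [[t ->]|[j ->]]; first by exists (f t).
  by have /codomP[t ->] := f_onto j; exists t.
have [y [y_in y_out]] := match_inj inj_h inj_F codom_h.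
have y_symG : y \in symG n k nu.
  apply/(symGP le_nu)/(emb_onto inj_w) => x xw; apply: y_out.
  by rewrite codom_h -F_codom -{1}sum_nu (window_winj le_nu).
have -> : emb F u = (emb h u ^ y)%g.
  by rewrite embJ //; apply: eq_emb => t; rewrite y_in.
have hE : emb h u = emb (winj le_nu) (emb f u) by rewrite emb_comp.
rewrite (classfun_char (specht_char K n k nu)) // hE; last exact: emb_symG.
rewrite specht_emb // /schi (big_emb_onto inj_f) //; apply: eq_bigr => g _.
by rewrite -embV // !conjgE -embV // -!embM // fE.
Qed.

Let dsum_char : ch [set: {perm T}]%G (dyidem K (l := l)) =1 dchi.
Proof. by move=> u; rewrite ffunE inE; apply: eq_bigl => g; rewrite inE. Qed.

(** Let X = (R + a D)/2.  On the group H of type s, the linear characters in R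
    and D contribute the signs 1 and (-1)^s, because H is the group of unsigned
    permutations conjugated by s single sign changes.  So the pairing of X with
    [l u l] on H is proportional to 1 + a (-1)^s (-1)^|l| by [double_sign], and
    it is nonzero by Frobenius reciprocity. *)
Lemma label_sign a : X' = Xpm l a -> a = 1 \/ a = -1 -> a = (-1) ^+ sumn l * (-1) ^+ s.
Proof.
move=> X'E a_pm; move: labX; rewrite /has_label /= eqxx => -[irrX _ [dd [_ _ [_ mX _] _]]].
have [t1 Ft1] : exists t1, F t1 = t0.
  by have := t0W; rewrite F_codom => /codomP[t1 ->]; exists t1.
(* the s sign changes at t0, transported to T; they conjugate the unsigned permutations to H s *)
pose Q : {ffun T -> bool} := [ffun t => s && (t == t1)].
have parQ : par Q = s.
  rewrite /par /lamc (bigD1 t1) //= ffunE eqxx andbT big1 ?addbF // => t /negPf nt.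
  by rewrite ffunE nt andbF.
have tauE : (flip t0 ^+ s)%g = Phi F (sp 1 Q).
  rewrite (Phi_sp inj_F) (emb1 inj_F); case sE: s.
    rewrite expg1 flipE; congr sp; apply/ffunP=> i; rewrite ffunE.
    have [/codomP[t ->]|fi] := boolP (i \in codom F).
      by rewrite (ext_in inj_F) ffunE sE -Ft1 (inj_eq inj_F).
    rewrite (ext_out _ fi); apply: contraNF fi => /eqP->.
    by rewrite -Ft1 codom_f.
  rewrite expg0 -sp1; congr sp; apply/ffunP=> i; rewrite ffunE.
  have [/codomP[t ->]|fi] := boolP (i \in codom F).
    by rewrite (ext_in inj_F) ffunE sE.
  by rewrite (ext_out _ fi).
pose P u := sadd (sadd (sact 1 (szero T)) Q) (sact u Q).
have PE u : ((sp u (szero _)) ^ (sp 1 Q))%g = sp u (P u) by rewrite spJ conjg1.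
have evenP u : inW true (P u).
  rewrite /inW /= /par !lamc_sadd lamc_sact lamc_szero addFb -!/(par _).
  by rewrite par_sact addbb.
have HP x : reflect (exists u, x = Phi F (sp u (P u))) (x \in H s).
  rewrite HE; apply: (iffP idP) => [|[u ->]].
    case/imsetP=> _ /imsetP[v Sv ->] ->.
    have [u ->] := Sym_embP inj_F v F_codom Sv; exists u.
    by rewrite tauE -PE (PhiJ inj_F) (Phi_sp inj_F _ (szero _)) (ext_szero inj_F).
  rewrite -PE (PhiJ inj_F) -tauE memJ_conjg; apply/imsetP; exists (emb F u).
    by apply/(Sym_embP inj_F _ F_codom); exists u.
  by rewrite (Phi_sp inj_F) (ext_szero inj_F).
have unsignP u S : unsign (Phi F (sp u S)) = emb F u.
  by rewrite (Phi_sp inj_F) unsign_sp.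
have big_H (G : sperm n -> K) : \sum_(x in H s) G x = \sum_u G (Phi F (sp u (P u))).
  transitivity (\sum_(u in [set: {perm T}]) G (Phi F (sp u (P u)))); last first.
    by apply: eq_bigl => u; rewrite inE.
  rewrite -(big_imset G (A := [set: {perm T}]) (h := fun u => Phi F (sp u (P u)))) /=; last first.
    by move=> u v _ _ /(Phi_inj inj_F)/eqP; rewrite sp_inj => /andP[/eqP].
  by apply: eq_bigl => x; apply/HP/imsetP => [[u ->]|[u _ ->]]; exists u; rewrite ?inE.
have sHW : H s \subset W.
  by apply/subsetP=> _ /HP[u ->]; rewrite WE' (Phi_WS inj_F F_codom) sp_Wg.
have char_infl : is_char (H s) (inflate (H s) (specht K n k nu)).
  have le_nu : (k + sumn nu <= n)%N by rewrite sum_nu addnA.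
  have phiG x : x \in H s -> unsign x \in symG n k nu.
    case/HP=> u ->; rewrite unsignP; apply/(Sym_embP inj_F) => [i|]; last by exists u.
    by rewrite -F_codom sum_nu.
  have phi1 : unsign (1%g : sperm n) = 1%g by rewrite -sp1 unsign_sp.
  have phiM : {in H s &, forall x y, unsign (x * y)%g = (unsign x * unsign y)%g}.
    move=> _ _ /HP[u ->] /HP[v ->]; rewrite -(PhiM inj_F) !unsignP spM unsignP.
    exact: embM.
  exists _, (pull_repr phiG phi1 phiM (specht_repr K n k nu)).
  apply/ffunP=> x; rewrite !ffunE; case: ifP => // Hx.
  by rewrite phiG.
have charX := irrchar_char irrX.
have ipE : (mult W (indf (H s) W (inflate (H s) (specht K n k nu))) X)%:R =
    ip (H s) (inflate (H s) (specht K n k nu)) X :> K.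
  rewrite (mult_ip charK) //; last exact: is_char_indf.
  have infl_out x : x \notin H s -> inflate (H s) (specht K n k nu) x = 0.
    by move=> Hx; rewrite ffunE (negPf Hx).
  rewrite -(indf_ip charK sHW infl_out); last exact: classfun_char.
  by congr (ip _ (indf _ _ _) _); apply/ffunP=> x; rewrite [RHS]ffunE.
(* the restriction of X to H s, as a function of the underlying permutation *)
pose ZR u := \sum_y FR e e (u^-1 ^ y)%g; pose ZD u := \sum_y FD e (u^-1 ^ y)%g.
pose Z u := 2%:R^-1 * ZR u + 2%:R^-1 * (a * (-1) ^+ s) * ZD u.
have XE u : X (Phi F (sp u (P u))) = Z u.
  have -> : X (Phi F (sp u (P u))) = X' (sp u (P u)) by rewrite ffunE.
  rewrite X'E XpmE /Rch /Dch !(@ch_zfun _ _ _ charK true) //; last first.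
  - exact: compatible_FR.
  - exact: compatible_FD.
  have lamP c' b : (forall t, c' (u t) = c' t (+) b) -> lamc c' (P u) = b && s.
    move=> cu; rewrite !lamc_sadd !lamc_sact lamc_szero addFb.
    rewrite (eq_lamc Q cu) lamc_addb parQ addbA addbb.
    by [].
  have colu (F' : {perm T} -> K) b y : (F' (u^-1 ^ y)%g != 0 -> forall t, colour ((u^-1 ^ y)%g t) = colour t (+) b) ->
      F' (u^-1 ^ y)%g * (-1) ^+ lamc (fun t => colour (y t)) (P u) = (-1) ^+ (b && s) * F' (u^-1 ^ y)%g.
    have [->|nz] := eqVneq (F' (u^-1 ^ y)%g) 0; first by rewrite mul0r mulr0.
    move=> /(_ isT) cF; rewrite mulrC (lamP _ b) // => t.
    have := cF (y (u t)); rewrite permJ permK => ->.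
    by rewrite -addbA addbb addbF.
  have -> : Theta (@colour _ _) (FR e e) u (P u) = ZR u.
    apply: eq_bigr => y _; rewrite (colu _ false) ?mul1r // => nz t.
    by rewrite (FR_colour nz) addbF.
  have -> : Theta (@colour _ _) (FD e) u (P u) = (-1) ^+ s * ZD u.
    rewrite mulr_sumr; apply: eq_bigr => y _; rewrite (colu _ true) // => nz t.
    by rewrite (FD_colour nz) addbT.
  by rewrite /Z !mulrA.
have classZ : classfun [set: {perm T}]%G Z.
  have cl (F' : {perm T} -> K) x y : \sum_z F' ((x ^ y)^-1 ^ z)%g = \sum_z F' (x^-1 ^ z)%g.
    rewrite (reindex_inj (mulgI y^-1%g)); apply: eq_bigr => z _.
    by rewrite -conjVg -conjgM mulKVg.
  by move=> x y _ _; rewrite /Z /ZR /ZD !cl.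
have ipZ : ip (H s) (inflate (H s) (specht K n k nu)) X =
   (#|H s|%:R)^-1 * (#|{perm T}|%:R * \sum_u dyidem K (l := l) u * Z u).
  rewrite /ip big_H; congr (_ * _).
  transitivity (\sum_u dchi u^-1%g * Z u).
    apply: eq_bigr => u _; rewrite XE -(PhiV inj_F) ffunE (PhiV inj_F) groupV.
    have -> : Phi F (sp u (P u)) \in H s by apply/HP; exists u.
    by rewrite -(PhiV inj_F) spV unsignP specht_nu.
  have := ip_ch charK (dyidem K (l := l)) classZ; rewrite /ip.
  under eq_bigl do rewrite inE; under eq_bigr do rewrite dsum_char.
  rewrite [in X in _ = X -> _](eq_bigl xpredT) => [<-|x]; last by rewrite inE.
  by rewrite cardsT mulrA mulfV ?mul1r // natrK_neq0 //; apply/card_gt0P; exists 1%g.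
have nzmX : ip (H s) (inflate (H s) (specht K n k nu)) X != 0.
  by rewrite -ipE natrK_neq0.
(* double_sign turns the D part into a multiple of the R part *)
have sumZ : \sum_u dyidem K (l := l) u * Z u =
    (1 + a * (-1) ^+ s * (-1) ^+ sumn l) * (2%:R^-1 * \sum_u dyidem K (l := l) u * ZR u).
  have := double_sign l charK; rewrite -/e => dsE.
  rewrite mulrDl mul1r.
  have -> : a * (-1) ^+ s * (-1) ^+ sumn l * (2%:R^-1 * \sum_u dyidem K (l := l) u * ZR u) =
     2%:R^-1 * (a * (-1) ^+ s) * ((-1) ^+ sumn l * \sum_u dyidem K (l := l) u * ZR u) by ring.
  rewrite -dsE [X in _ = X + _]mulr_sumr [X in _ = _ + X]mulr_sumr -big_split.
  by apply: eq_bigr => u _ /=; rewrite /Z -/(ZD u); ring.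
have : a * (-1) ^+ s * (-1) ^+ sumn l != -1.
  apply: contraNneq nzmX => E; rewrite ipZ sumZ E subrr mul0r !mulr0 //.
have sgn_pm (b : nat) : (-1) ^+ b = 1 :> K \/ (-1) ^+ b = -1 :> K.
  by have /eqP := sqrr_sign K b; rewrite sqrf_eq1 => /orP[]/eqP->; [left|right].
case: a_pm => ->; case: (sgn_pm s) => ->; case: (sgn_pm (sumn l)) => ->;
  move=> ne; first [ring | by case/negP: ne; apply/eqP; ring].
Qed.

Lemma label_deg v S : inW true S -> X (Phi F (sp v S)) =
  Theta (@colour _ _) (Fpm (l := l) ((-1) ^+ sumn l * (-1) ^+ s)) v S.
Proof.
move=> eS; have [a a_pm X'E] := label_pm.
rewrite -(label_sign X'E a_pm); have := congr1 (fun h : {ffun _ -> _} => h (sp v S)) X'E.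
rewrite ffunE => ->; rewrite /Xpm (@ch_zfun _ _ _ charK true) //.
exact: compatible_Fpm.
Qed.

End Degenerate.

End Labels.

(** * Triple sums *)

Section Triple.

Variables (K : fieldType) (A1 A2 B1 B2 C1 C2 : finType).
Implicit Types (ja : A1 + A2 -> C1 + C2) (jb : B1 + B2 -> C1 + C2).
Implicit Types (FA : {perm (A1 + A2)} -> K) (FB : {perm (B1 + B2)} -> K)
  (FC : {perm (C1 + C2)} -> K).

(** In [aligned], sa and sb tell whether y carries the colouring of the left, of
    the right coordinates to that of C1 + C2 or to the opposite one.  The
    triple sum pairs the product of FA and FB with the character of FC, keeping
    only the aligned y. *)
Definition aligned ja jb (sa sb : bool) (y : {perm (C1 + C2)}) : bool :=
  [forall t, colour (y (ja t)) == colour t (+) sa] &&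
  [forall t, colour (y (jb t)) == colour t (+) sb].

Definition aligned_sum ja jb sa sb FA FB FC : K :=
  \sum_(y | aligned ja jb sa sb y) \sum_u \sum_w
     FA u * FB w * FC (((emb ja u * emb jb w)^-1) ^ y)%g.

Definition triple_sum ja jb FA FB FC : K :=
  \sum_(sa : bool) \sum_(sb : bool) aligned_sum ja jb sa sb FA FB FC.

(** The permutations in the supports of FA, FB and FC preserve (false) or exchange
    (true) the colours.  Up to the aligned y, those from FA and FB form a single
    permutation from the support of FC, so the three behaviours agree. *)
Lemma aligned_mixed ja jb sa sb FA FB FC ca cb cc :
    injective ja -> injective jb -> (forall t t', ja t != jb t') ->
    (forall u, FA u != 0 -> forall t, colour (u t) = colour t (+) ca) ->
    (forall u, FB u != 0 -> forall t, colour (u t) = colour t (+) cb) ->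
    (forall u, FC u != 0 -> forall t, colour (u t) = colour t (+) cc) ->
    (0 < #|{: A1 + A2}|)%N -> (0 < #|{: B1 + B2}|)%N ->
    (ca != cc) || (cb != cc) ->
  aligned_sum ja jb sa sb FA FB FC = 0.
Proof.
move=> inja injb dis cA cB cC /card_gt0P[ta _] /card_gt0P[tb _] mixed.
rewrite /aligned_sum big1 // => y /andP[/forallP ya /forallP yb].
rewrite big1 // => u _; rewrite big1 // => w _.
have [->|nzA] := eqVneq (FA u) 0; first by rewrite !mul0r.
have [->|nzB] := eqVneq (FB w) 0; first by rewrite mulr0 mul0r.
have [->|nzC] := eqVneq (FC (((emb ja u * emb jb w)^-1) ^ y)%g) 0; first by rewrite mulr0.
have a_out t : ja t \notin codom jb.
  by apply/codomP=> -[t' E]; have := dis t t'; rewrite E eqxx.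
have b_out t : jb t \notin codom ja.
  by apply/codomP=> -[t' E]; have := dis t' t; rewrite E eqxx.
set x := (emb ja u * emb jb w)%g in nzC *.
have xa : x (ja ta) = ja (u ta) by rewrite /x permM (emb_in _ _ inja) (emb_out _ injb).
have xb : x (jb tb) = jb (w tb) by rewrite /x permM (emb_out _ inja) ?(emb_in _ _ injb).
have := cC _ nzC (y (x (ja ta))); rewrite permJ permK {}xa.
rewrite (eqP (ya _)) (eqP (ya _)) (cA _ nzA) => Ea.
have := cC _ nzC (y (x (jb tb))); rewrite permJ permK {}xb.
rewrite (eqP (yb _)) (eqP (yb _)) (cB _ nzB) => Eb.
exfalso; move: Ea Eb mixed.
by case: (colour ta); case: (colour tb); case: ca {cA}; case: cb {cB}; case: cc {cC};
   case: sa {ya}; case: sb {yb}.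
Qed.

Lemma triple_linA ja jb FA FA' FB FC p q :
  triple_sum ja jb (fun u => p * FA u + q * FA' u) FB FC = p * triple_sum ja jb FA FB FC + q * triple_sum ja jb FA' FB FC.
Proof.
rewrite /triple_sum !mulr_sumr -big_split; apply: eq_bigr => sa _ /=.
rewrite !mulr_sumr -big_split; apply: eq_bigr => sb _ /=.
rewrite !mulr_sumr -big_split; apply: eq_bigr => y _ /=.
rewrite !mulr_sumr -big_split; apply: eq_bigr => u _ /=.
rewrite !mulr_sumr -big_split; apply: eq_bigr => w _ /=.
by ring.
Qed.

Lemma triple_linB ja jb FA FB FB' FC p q :
  triple_sum ja jb FA (fun u => p * FB u + q * FB' u) FC = p * triple_sum ja jb FA FB FC + q * triple_sum ja jb FA FB' FC.
Proof.
rewrite /triple_sum !mulr_sumr -big_split; apply: eq_bigr => sa _ /=.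
rewrite !mulr_sumr -big_split; apply: eq_bigr => sb _ /=.
rewrite !mulr_sumr -big_split; apply: eq_bigr => y _ /=.
rewrite !mulr_sumr -big_split; apply: eq_bigr => u _ /=.
rewrite !mulr_sumr -big_split; apply: eq_bigr => w _ /=.
by ring.
Qed.

Lemma triple_linC ja jb FA FB FC FC' p q :
  triple_sum ja jb FA FB (fun u => p * FC u + q * FC' u) = p * triple_sum ja jb FA FB FC + q * triple_sum ja jb FA FB FC'.
Proof.
rewrite /triple_sum !mulr_sumr -big_split; apply: eq_bigr => sa _ /=.
rewrite !mulr_sumr -big_split; apply: eq_bigr => sb _ /=.
rewrite !mulr_sumr -big_split; apply: eq_bigr => y _ /=.
rewrite !mulr_sumr -big_split; apply: eq_bigr => u _ /=.
rewrite !mulr_sumr -big_split; apply: eq_bigr => w _ /=.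
by ring.
Qed.

End Triple.

Definition sumswap (T1 T2 : Type) (t : T1 + T2) : T2 + T1 :=
  match t with inl i => inr i | inr i => inl i end.

Lemma sumswap_inj (T1 T2 : Type) : injective (@sumswap T1 T2).
Proof. by move=> [i|i] [j|j] // [->]. Qed.

(** Exchanging the roles of the two diagrams of A reduces the case sa = true to
    the case sa = false, and similarly for B. *)
Lemma emb_sumswap (T1 T2 T : finType) (j : T1 + T2 -> T) (u1 : {perm T1}) (u2 : {perm T2}) :
  injective j ->
  emb j (sumperm u1 u2) = emb (fun t => j (sumswap t)) (sumperm u2 u1).
Proof.
move=> inj_j; have inj' : injective (fun t : T2 + T1 => j (sumswap t)).
  by move=> x y /inj_j/sumswap_inj.
apply: emb_unique => // [t|x jx].
  by case: t => i; rewrite emb_in // ?sumperm_inl ?sumperm_inr.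
rewrite emb_out //; apply: contra jx => /codomP[t ->].
by apply/codomP; exists (sumswap t); case: t.
Qed.

Section TermSwap.

Variables (K : fieldType) (A1 A2 B1 B2 C1 C2 : finType).
Variables (ja : A1 + A2 -> C1 + C2) (jb : B1 + B2 -> C1 + C2).
Hypotheses (inj_a : injective ja) (inj_b : injective jb).

Lemma forall_sumswap (T1 T2 : finType) (P : T1 + T2 -> bool) :
  [forall t, P t] = [forall t, P (sumswap t)].
Proof.
apply/forallP/forallP=> Pt t; first exact: Pt.
by have := Pt (sumswap t); case: t.
Qed.

Lemma colour_sumswap (T1 T2 : finType) (t : T1 + T2) : colour (sumswap t) = ~~ colour t.
Proof. by case: t. Qed.

Lemma aligned_swapl sb y :
  aligned ja jb true sb y = aligned (fun t => ja (sumswap t)) jb false sb y.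
Proof.
rewrite /aligned; congr (_ && _); rewrite forall_sumswap; apply: eq_forallb => t.
by rewrite colour_sumswap addbT negbK addbF.
Qed.

Lemma aligned_swapr sa y :
  aligned ja jb sa true y = aligned ja (fun t => jb (sumswap t)) sa false y.
Proof.
rewrite /aligned; congr (_ && _); rewrite forall_sumswap; apply: eq_forallb => t.
by rewrite colour_sumswap addbT negbK addbF.
Qed.

Lemma aligned_FR_swapl sb (e1 : {perm A1} -> K) (e2 : {perm A2} -> K) FB FC :
  aligned_sum ja jb true sb (FR e1 e2) FB FC =
  aligned_sum (fun t => ja (sumswap t)) jb false sb (FR e2 e1) FB FC.
Proof.
apply: eq_big => y; first exact: aligned_swapl.
move=> _; rewrite exchange_big [RHS]exchange_big; apply: eq_bigr => w _ /=.
under eq_bigr do rewrite -mulrA; under [RHS]eq_bigr do rewrite -mulrA.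
rewrite !sum_FRm exchange_big; apply: eq_bigr => u2 _; apply: eq_bigr => u1 _.
by rewrite emb_sumswap // [e1 _ * _]mulrC.
Qed.

Lemma aligned_FR_swapr sa (e1 : {perm B1} -> K) (e2 : {perm B2} -> K) FA FC :
  aligned_sum ja jb sa true FA (FR e1 e2) FC =
  aligned_sum ja (fun t => jb (sumswap t)) sa false FA (FR e2 e1) FC.
Proof.
apply: eq_big => y; first exact: aligned_swapr.
move=> _; apply: eq_bigr => u _ /=.
under eq_bigr do rewrite mulrAC mulrC; under [RHS]eq_bigr do rewrite mulrAC mulrC.
rewrite !sum_FRm exchange_big; apply: eq_bigr => u2 _; apply: eq_bigr => u1 _.
by rewrite emb_sumswap // [e1 _ * _]mulrC.
Qed.

End TermSwap.

Section TermSwapD.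

Variables (K : fieldType) (A B C1 C2 : finType).
Variables (ja : A + A -> C1 + C2) (jb : B + B -> C1 + C2).
Hypotheses (inj_a : injective ja) (inj_b : injective jb).

Lemma emb_sw_conj (T' T : finType) (j : T' + T' -> T) u : injective j ->
  emb j u = emb (fun t => j (sumswap t)) (u ^ sw T')%g.
Proof.
move=> inj_j; have inj' : injective (fun t : T' + T' => j (sumswap t)).
  by move=> x y /inj_j/sumswap_inj.
apply: emb_unique => // [t|x jx].
  rewrite emb_in //; congr j.
  have tE : t = sw T' (sumswap t) by rewrite swE; case: t.
  by rewrite {2}tE permJ swE; case: (u _).
rewrite emb_out //; apply: contra jx => /codomP[t ->].
by apply/codomP; exists (sumswap t); case: t.
Qed.

Lemma aligned_FD_swapl sb (e : {perm A} -> K) FB FC :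
  aligned_sum ja jb true sb (FD e) FB FC =
  aligned_sum (fun t => ja (sumswap t)) jb false sb (FD e) FB FC.
Proof.
apply: eq_big => y; first exact: aligned_swapl.
move=> _; rewrite [RHS](reindex_inj (conjg_inj (sw A))) /=.
by apply: eq_bigr => u _; rewrite FD_conj_sw; apply: eq_bigr => w _; rewrite -emb_sw_conj.
Qed.

Lemma aligned_FD_swapr sa (e : {perm B} -> K) FA FC :
  aligned_sum ja jb sa true FA (FD e) FC =
  aligned_sum ja (fun t => jb (sumswap t)) sa false FA (FD e) FC.
Proof.
apply: eq_big => y; first exact: aligned_swapr.
move=> _; apply: eq_bigr => u _; rewrite [RHS](reindex_inj (conjg_inj (sw B))) /=.
by apply: eq_bigr => w _; rewrite FD_conj_sw -emb_sw_conj.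
Qed.

End TermSwapD.

Definition copair (T1 T2 T : Type) (f : T1 -> T) (g : T2 -> T) (t : T1 + T2) : T :=
  match t with inl t => f t | inr t => g t end.

Lemma copair_inj (T1 T2 : Type) (T : eqType) (f : T1 -> T) (g : T2 -> T) :
    injective f -> injective g -> (forall t t', f t != g t') ->
  injective (copair f g).
Proof.
move=> inj_f inj_g dis [t|t] [t'|t'] /= E.
- by rewrite (inj_f _ _ E).
- by have := dis t t'; rewrite E eqxx.
- by have := dis t' t; rewrite E eqxx.
- by rewrite (inj_g _ _ E).
Qed.

Lemma emb_sumperm (A1 A2 C1 C2 : finType) (j : A1 + A2 -> C1 + C2) k1 k2 u1 u2 :
    injective j -> (forall i, j (inl i) = inl (k1 i)) -> (forall i, j (inr i) = inr (k2 i)) ->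
  emb j (sumperm u1 u2) = sumperm (emb k1 u1) (emb k2 u2).
Proof.
move=> inj_j j1 j2.
have inj1 : injective k1 by move=> x y E; apply/inl_inj/inj_j; rewrite !j1 E.
have inj2 : injective k2 by move=> x y E; apply/inr_inj/inj_j; rewrite !j2 E.
apply/esym/emb_unique => // [[i|i]|[i|i] ni].
- by rewrite sumperm_inl j1 !sumperm_inl (emb_in _ _ inj1) j1.
- by rewrite sumperm_inr j2 !sumperm_inr (emb_in _ _ inj2) j2.
- rewrite sumperm_inl emb_out //; apply: contra ni => /codomP[t ->].
  by rewrite -j1 codom_f.
- rewrite sumperm_inr emb_out //; apply: contra ni => /codomP[t ->].
  by rewrite -j2 codom_f.
Qed.

Lemma leq_card_colour (T C1 C2 : finType) (f : T -> C1 + C2) b :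
    injective f -> (forall t, colour (f t) = b) ->
  (#|T| <= if b then #|C2| else #|C1|)%N.
Proof.
move=> inj_f cf; rewrite -(card_codom inj_f); case: b cf => cf.
  rewrite -(card_codom (@inr_inj C1 C2)); apply: subset_leq_card.
  by apply/subsetP=> _ /codomP[t ->]; have := cf t; case: (f t) => // i _; apply: codom_f.
rewrite -(card_codom (@inl_inj C1 C2)); apply: subset_leq_card.
by apply/subsetP=> _ /codomP[t ->]; have := cf t; case: (f t) => // i _; apply: codom_f.
Qed.

(** * Evaluation of the aligned sums *)

Section AlignedSum.

Variables (K : fieldType) (l1 l2 m1 m2 g1 g2 : seq nat).
Hypothesis charK : [pchar K] =i pred0.

Local Notation A := ('I_(sumn l1) + 'I_(sumn l2))%type.
Local Notation B := ('I_(sumn m1) + 'I_(sumn m2))%type.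
Local Notation C := ('I_(sumn g1) + 'I_(sumn g2))%type.

Variables (ja : A -> C) (jb : B -> C).
Hypotheses (inj_a : injective ja) (inj_b : injective jb).
Hypothesis dis : forall t t', ja t != jb t'.

Local Notation jab := (copair ja jb).
Let inj_ab : injective jab := copair_inj inj_a inj_b dis.

(** The existence of an aligned y forces the sizes to match, since it sends the
    cells of each colour to cells of the same colour. *)
Lemma aligned_size y : aligned ja jb false false y ->
  (sumn l1 + sumn m1 <= sumn g1)%N /\ (sumn l2 + sumn m2 <= sumn g2)%N.
Proof.
case/andP=> /forallP ya /forallP yb.
pose f1 (t : 'I_(sumn l1) + 'I_(sumn m1)) := y (jab (match t with inl i => inl (inl i) | inr i => inr (inl i) end)).
pose f2 (t : 'I_(sumn l2) + 'I_(sumn m2)) := y (jab (match t with inl i => inl (inr i) | inr i => inr (inr i) end)).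
have inj1 : injective f1 by move=> [i|i] [j|j] /perm_inj/inj_ab // [->].
have inj2 : injective f2 by move=> [i|i] [j|j] /perm_inj/inj_ab // [->].
split.
  have := @leq_card_colour _ _ _ f1 false inj1; rewrite card_sum !card_ord; apply.
  by case=> i; rewrite /f1 /= ?(eqP (ya _)) ?(eqP (yb _)).
have := @leq_card_colour _ _ _ f2 true inj2; rewrite card_sum !card_ord; apply.
by case=> i; rewrite /f2 /= ?(eqP (ya _)) ?(eqP (yb _)).
Qed.

Section MatchingSizes.

Hypotheses (s1 : (sumn l1 + sumn m1 = sumn g1)%N) (s2 : (sumn l2 + sumn m2 = sumn g2)%N).
Hypotheses (H1 : (0 + sumn l1 <= sumn g1)%N) (H2 : (0 + sumn l2 <= sumn g2)%N).
Hypotheses (K1 : (sumn l1 + sumn m1 <= sumn g1)%N) (K2 : (sumn l2 + sumn m2 <= sumn g2)%N).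

Lemma ab_onto c : c \in codom jab.
Proof. by apply: inj_card_onto; rewrite // !card_sum !card_ord -s1 -s2 addnACA. Qed.

(** All aligned permutations differ by permutations preserving the colours.  The
    one chosen here puts the cells in the positions used in [LRcoefE]. *)
Lemma straighten : exists y0 : {perm C},
  [/\ forall i, y0 (ja (inl i)) = inl (winj H1 i), forall i, y0 (ja (inr i)) = inr (winj H2 i),
      forall i, y0 (jb (inl i)) = inl (winj K1 i) & forall i, y0 (jb (inr i)) = inr (winj K2 i)].
Proof.
pose h (t : (A + B)%type) : C := match t with
  | inl (inl i) => inl (winj H1 i) | inl (inr i) => inr (winj H2 i)
  | inr (inl i) => inl (winj K1 i) | inr (inr i) => inr (winj K2 i) end.
have inj_h : injective h.
  move=> [[i|i]|[i|i]] [[j|j]|[j|j]] //= => [] [] E.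
  - by congr (inl (inl _)); apply: val_inj.
  - by have := ltn_ord i; rewrite -[val i]/(0 + i)%N E ltnNge leq_addr.
  - by congr (inl (inr _)); apply: val_inj.
  - by have := ltn_ord i; rewrite -[val i]/(0 + i)%N E ltnNge leq_addr.
  - by have := ltn_ord j; rewrite -[val j]/(0 + j)%N -E ltnNge leq_addr.
  - by congr (inr (inl _)); apply/val_inj/(addnI E).
  - by have := ltn_ord j; rewrite -[val j]/(0 + j)%N -E ltnNge leq_addr.
  - by congr (inr (inr _)); apply/val_inj/(addnI E).
have h_onto c : c \in codom h.
  by apply: inj_card_onto; rewrite // !card_sum !card_ord -s1 -s2 addnACA.
have [y0 [y0E _]] : exists y : {perm C}, (forall t, y (jab t) = h t) /\
    (forall x, x \notin codom jab -> y x = x).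
  by apply: match_inj => // c; rewrite ab_onto h_onto.
exists y0; split=> i.
- exact: (y0E (inl (inl i))).
- exact: (y0E (inl (inr i))).
- exact: (y0E (inr (inl i))).
- exact: (y0E (inr (inr i))).
Qed.

Variable y0 : {perm C}.
Hypothesis y0a1 : forall i, y0 (ja (inl i)) = inl (winj H1 i).
Hypothesis y0a2 : forall i, y0 (ja (inr i)) = inr (winj H2 i).
Hypothesis y0b1 : forall i, y0 (jb (inl i)) = inl (winj K1 i).
Hypothesis y0b2 : forall i, y0 (jb (inr i)) = inr (winj K2 i).

Lemma big_aligned (F : {perm C} -> K) :
  \sum_(y | aligned ja jb false false y) F y = \sum_y1 \sum_y2 F (y0 * sumperm y1 y2)%g.
Proof.
rewrite -(big_colour (fun y => F (y0 * y)%g)) (reindex_inj (mulgI y0)) /=.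
have ca t : colour (y0 (ja t)) = colour t by case: t => i; rewrite ?y0a1 ?y0a2.
have cb t : colour (y0 (jb t)) = colour t by case: t => i; rewrite ?y0b1 ?y0b2.
apply: eq_bigl => y; apply/andP/forallP => [[/forallP ya /forallP yb] c|cy].
  have /codomP[t cE] := ab_onto (y0^-1 c)%g.
  rewrite -[c](permKV y0) cE; case: t {cE} => t /=.
    by rewrite ca; have := ya t; rewrite permM addbF.
  by rewrite cb; have := yb t; rewrite permM addbF.
split; apply/forallP=> t; rewrite permM addbF (eqP (cy _)); [exact/eqP/ca|exact/eqP/cb].
Qed.

Lemma straight_split u1 u2 w1 w2 :
  ((emb ja (sumperm u1 u2) * emb jb (sumperm w1 w2)) ^ y0)%g =
  sumperm (emb (winj H1) u1 * emb (winj K1) w1) (emb (winj H2) u2 * emb (winj K2) w2).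
Proof.
rewrite conjMg !embJ // (emb_sumperm _ _ _ y0a1 y0a2) ?(emb_sumperm _ _ _ y0b1 y0b2); last first.
- by move=> x y /perm_inj/inj_a.
- by move=> x y /perm_inj/inj_b.
exact: sumpermM.
Qed.

(** In straight position the aligned y are pairs of permutations of the cells of
    g1 and of g2, and everything separates according to the colours. *)
Lemma aligned_FR_straight : aligned_sum ja jb false false
    (FR (yidem K l1) (yidem K l2)) (FR (yidem K m1) (yidem K m2))
    (FR (yidem K g1) (yidem K g2)) =
  (LRcoef K l1 m1 g1)%:R * (LRcoef K l2 m2 g2)%:R.
Proof.
rewrite (LRcoefE charK H1 K1 s1) (LRcoefE charK H2 K2 s2) /aligned_sum big_aligned.
set e1 := yidem K l1; set e2 := yidem K l2.
set d1 := yidem K m1; set d2 := yidem K m2.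
have inner u w : \sum_y1 \sum_y2 FR (yidem K g1) (yidem K g2)
   (((emb ja (sumperm u.1 u.2) * emb jb (sumperm w.1 w.2))^-1 ^ (y0 * sumperm y1 y2)))%g =
   schi K (emb (winj H1) u.1 * emb (winj K1) w.1)%g * schi K (emb (winj H2) u.2 * emb (winj K2) w.2)%g.
  rewrite /schi mulr_suml; apply: eq_bigr => y1 _; rewrite mulr_sumr; apply: eq_bigr => y2 _.
  by rewrite conjgM conjVg straight_split sumpermV sumpermJ FR_sum.
transitivity (\sum_u1 \sum_u2 \sum_w1 \sum_w2 (e1 u1 * e2 u2) * ((d1 w1 * d2 w2) *
   (schi K (emb (winj H1) u1 * emb (winj K1) w1)%g * schi K (emb (winj H2) u2 * emb (winj K2) w2)%g))).
  transitivity (\sum_u FR e1 e2 u * \sum_w FR d1 d2 w * \sum_y1 \sum_y2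
     FR (yidem K g1) (yidem K g2) (((emb ja u * emb jb w)^-1 ^ (y0 * sumperm y1 y2)))%g).
    rewrite pair_big exchange_big; apply: eq_bigr => u _ /=.
    rewrite exchange_big mulr_sumr; apply: eq_bigr => w _ /=.
    rewrite [X in _ = _ * (_ * X)]pair_big mulrA [RHS]mulr_sumr; by apply: eq_bigr.
  rewrite (sum_FRm e1 e2); apply: eq_bigr => u1 _; apply: eq_bigr => u2 _.
  rewrite (sum_FRm d1 d2) mulr_sumr; apply: eq_bigr => w1 _; rewrite mulr_sumr; apply: eq_bigr => w2 _.
  by rewrite (inner (u1, u2) (w1, w2)).
rewrite [RHS]mulr_suml; apply: eq_bigr => u1 _.
rewrite exchange_big [RHS]mulr_suml; apply: eq_bigr => w1 _ /=.
rewrite mulr_sumr; apply: eq_bigr => u2 _; rewrite mulr_sumr; apply: eq_bigr => w2 _.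
set p := schi K _; set q := schi K _.
move: (e1 u1) (e2 u2) (d1 w1) (d2 w2) p q => a b c d p q; ring.
Qed.

End MatchingSizes.

(** When the sizes do not match, both sides vanish. *)
Lemma aligned_FR : (sumn l1 + sumn l2 + (sumn m1 + sumn m2) = sumn g1 + sumn g2)%N ->
  aligned_sum ja jb false false
    (FR (yidem K l1) (yidem K l2)) (FR (yidem K m1) (yidem K m2))
    (FR (yidem K g1) (yidem K g2)) =
  (LRcoef K l1 m1 g1)%:R * (LRcoef K l2 m2 g2)%:R.
Proof.
move=> tot; have [s1|ns1] := eqVneq (sumn l1 + sumn m1)%N (sumn g1).
  have s2 : (sumn l2 + sumn m2 = sumn g2)%N.
    by apply/eqP; rewrite -(eqn_add2l (sumn g1)) -tot -s1 addnACA.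
  have H1 : (0 + sumn l1 <= sumn g1)%N by rewrite add0n -s1 leq_addr.
  have H2 : (0 + sumn l2 <= sumn g2)%N by rewrite add0n -s2 leq_addr.
  have K1 : (sumn l1 + sumn m1 <= sumn g1)%N by rewrite s1.
  have K2 : (sumn l2 + sumn m2 <= sumn g2)%N by rewrite s2.
  have [y0 [a1 a2 b1 b2]] := straighten s1 s2 H1 H2 K1 K2.
  exact: (aligned_FR_straight s1 s2 a1 a2 b1 b2).
rewrite {1}/LRcoef (negPf ns1) mul0r /aligned_sum big_pred0 // => y; apply/negP=> /aligned_size[le1 le2].
case/eqP: ns1; apply/eqP; rewrite eqn_leq le1 -(leq_add2r (sumn g2)) -tot addnACA.
by rewrite leq_add2l.
Qed.

End AlignedSum.

Section SwapConvolution.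

Variables (K : fieldType) (l m g : seq nat).
Hypothesis charK : [pchar K] =i pred0.

(** The twisted version of the factorisation for FR: with an exchange of the
    colours, the two sums over y1 and y2 are coupled, and the sum over y1 is a
    convolution e e = e. *)
Lemma sum_FD_conj (x1 x2 : {perm 'I_(sumn g)}) :
  \sum_y1 \sum_y2 FD (yidem K g) ((sumperm x1 x2 * sw _)^-1 ^ sumperm y1 y2)%g =
  schi K (x2 * x1)%g.
Proof.
rewrite exchange_big; apply: eq_bigr => y2 _ /=.
rewrite -[RHS](young_idem_conv charK (lj_shape g)) (reindex_inj (mulgI (x1 * y2)%g)) /=.
apply: eq_bigr => v _; rewrite [RHS]mulrC -/(yidem K _ _) -FR_sum; congr (FR _ _ _).
have assoc (p t q : {perm ('I_(sumn g) + 'I_(sumn g))%type}) :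
  ((t * q) ^ p * t = p^-1 * (t * (q * p * t)))%g by rewrite conjgE !mulgA.
rewrite invMg swV assoc !sumpermV sumpermM sumperm_sw mulgA -[in LHS]mulgA.
rewrite [X in (_ * X)%g]mulgA swK mul1g sumpermM; congr sumperm.
  by rewrite conjgE !invMg !mulgA.
by rewrite -!mulgA !mulKg.
Qed.

Hypotheses (s1 : (sumn l + sumn m = sumn g)%N).
Hypotheses (H : (0 + sumn l <= sumn g)%N) (L : (sumn l + sumn m <= sumn g)%N).

Local Notation A := ('I_(sumn l) + 'I_(sumn l))%type.
Local Notation B := ('I_(sumn m) + 'I_(sumn m))%type.
Local Notation C := ('I_(sumn g) + 'I_(sumn g))%type.

Variables (ja : A -> C) (jb : B -> C).
Hypotheses (inj_a : injective ja) (inj_b : injective jb).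
Hypothesis dis : forall t t', ja t != jb t'.

Lemma straight_sw (y0 : {perm C}) :
    (forall i, y0 (ja (inl i)) = inl (winj H i)) -> (forall i, y0 (ja (inr i)) = inr (winj H i)) ->
    (forall i, y0 (jb (inl i)) = inl (winj L i)) -> (forall i, y0 (jb (inr i)) = inr (winj L i)) ->
  ((emb ja (sw _) * emb jb (sw _)) ^ y0)%g = sw _.
Proof.
move=> a1 a2 b1 b2; apply/permP=> c.
have /codomP[t cE] := ab_onto inj_a inj_b dis s1 s1 (y0^-1 c)%g.
have a_out t' : ja t' \notin codom jb.
  by apply/codomP=> -[t1 E]; have := dis t' t1; rewrite E eqxx.
have b_out t' : jb t' \notin codom ja.
  by apply/codomP=> -[t1 E]; have := dis t1 t'; rewrite E eqxx.
rewrite -[c](permKV y0) cE permJ permM swE; case: t {cE} => t /=.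
  by rewrite (emb_in _ _ inj_a) (emb_out _ inj_b) // swE; case: t => i /=; rewrite ?a1 ?a2.
by rewrite (emb_out _ inj_a) // (emb_in _ _ inj_b) swE; case: t => i /=; rewrite ?b1 ?b2.
Qed.

Lemma sum_yidem_conv l' (F : {perm 'I_(sumn l')} -> K) :
  \sum_u1 \sum_u2 yidem K _ u1 * yidem K _ u2 * F (u2 * u1)%g = \sum_u yidem K _ u * F u.
Proof.
rewrite exchange_big; transitivity (\sum_u2 \sum_u yidem K _ u2 * yidem K _ (u2^-1 * u)%g * F u).
  apply: eq_bigr => u2 _ /=; rewrite (reindex_inj (mulgI u2^-1%g)) /=.
  by apply: eq_bigr => u _; rewrite mulKVg; congr (_ * _); apply: mulrC.
rewrite exchange_big; apply: eq_bigr => u _ /=; rewrite -mulr_suml; congr (_ * _).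
exact: (young_idem_conv charK (lj_shape l') u).
Qed.

(** The three exchanges of colours cancel, leaving the convolutions of the
    idempotents for l, for m and for g with themselves. *)
Lemma aligned_FD : aligned_sum ja jb false false (FD (yidem K l)) (FD (yidem K m))
    (FD (yidem K g)) = (LRcoef K l m g)%:R.
Proof.
have [y0 [a1 a2 b1 b2]] := straighten inj_a inj_b dis s1 s1 H H L L.
rewrite (LRcoefE charK H L s1) /aligned_sum (big_aligned inj_a inj_b dis s1 s1 a1 a2 b1 b2).
set e := yidem K l; set d := yidem K m.
have dis' i j : winj H i != winj L j.
  by rewrite -val_eqE /= add0n neq_ltn ltn_addr ?ltn_ord.
have injH := @winj_inj _ _ _ H; have injL := @winj_inj _ _ _ L.
have inner u w : \sum_y1 \sum_y2 FD (yidem K g)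
   (((emb ja (sumperm u.1 u.2 * sw _) * emb jb (sumperm w.1 w.2 * sw _))^-1 ^ (y0 * sumperm y1 y2)))%g =
   schi K (emb (winj H) (u.2 * u.1) * emb (winj L) (w.2 * w.1))%g.
  have swap4 (gT : finGroupType) (x t z r : gT) : commute t z -> (x * t * (z * r) = x * z * (t * r))%g.
    by move=> tz; rewrite -!mulgA; congr (_ * _)%g; rewrite !mulgA tz.
  rewrite (embM _ _ injH) (embM _ _ injL) (swap4 _ _ _ _ _ (emb_commute u.1 w.2 injH injL dis')).
  rewrite -sum_FD_conj; apply: eq_bigr => y1 _; apply: eq_bigr => y2 _; congr (FD _ _).
  rewrite (embM _ _ inj_a) (embM _ _ inj_b) (swap4 _ _ _ _ _ (emb_commute (sw _) (sumperm w.1 w.2) inj_a inj_b dis)).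
  rewrite conjgM conjVg conjMg (straight_sw a1 a2 b1 b2).
  by rewrite (straight_split inj_a inj_b a1 a2 b1 b2).
transitivity (\sum_u1 \sum_u2 \sum_w1 \sum_w2 (e u1 * e u2) * ((d w1 * d w2) *
   schi K (emb (winj H) (u2 * u1) * emb (winj L) (w2 * w1))%g)).
  transitivity (\sum_u FR e e u * \sum_w FR d d w * \sum_y1 \sum_y2
     FD (yidem K g) (((emb ja (u * sw _) * emb jb (w * sw _))^-1 ^ (y0 * sumperm y1 y2)))%g).
    rewrite pair_big exchange_big (reindex_inj (mulIg (sw _))); apply: eq_bigr => u _ /=.
    rewrite exchange_big mulr_sumr (reindex_inj (mulIg (sw _))); apply: eq_bigr => w _ /=.
    rewrite [X in _ = _ * (_ * X)]pair_big mulrA [RHS]mulr_sumr; apply: eq_bigr => p _.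
    by rewrite /FD -!mulgA !swK !mulg1.
  rewrite (sum_FRm e e); apply: eq_bigr => u1 _; apply: eq_bigr => u2 _.
  rewrite (sum_FRm d d) mulr_sumr; apply: eq_bigr => w1 _; rewrite mulr_sumr; apply: eq_bigr => w2 _.
  by rewrite (inner (u1, u2) (w1, w2)).
transitivity (\sum_u1 \sum_u2 (e u1 * e u2) * \sum_w d w *
    schi K (emb (winj H) (u2 * u1) * emb (winj L) w)%g).
  apply: eq_bigr => u1 _; apply: eq_bigr => u2 _.
  rewrite -(sum_yidem_conv (fun w => schi K (emb (winj H) (u2 * u1) * emb (winj L) w)%g)).
  by rewrite mulr_sumr; apply: eq_bigr => w1 _; rewrite mulr_sumr.
rewrite (sum_yidem_conv (fun u => \sum_w d w * schi K (emb (winj H) u * emb (winj L) w)%g)).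
apply: eq_bigr => u _; rewrite mulr_sumr; apply: eq_bigr => w _; exact: mulrA.
Qed.

End SwapConvolution.

(** * The multiplicity as a triple sum *)

Section PairingFormula.

Variables (K : fieldType) (n : nat).
Hypothesis charK : [pchar K] =i pred0.
Variables (A1 A2 B1 B2 C1 C2 : finType).
Local Notation TA := (A1 + A2)%type.
Local Notation TB := (B1 + B2)%type.
Local Notation TC := (C1 + C2)%type.
Variables (fa : TA -> 'I_n) (fb : TB -> 'I_n) (fc : TC -> 'I_n).
Variables (ja : TA -> TC) (jb : TB -> TC).
Hypotheses (inj_fa : injective fa) (inj_fb : injective fb) (inj_fc : injective fc).
Hypotheses (fcja : forall t, fc (ja t) = fa t) (fcjb : forall t, fc (jb t) = fb t).
Hypothesis fc_onto : forall i, i \in codom fc.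
Hypotheses (TA_gt0 : (0 < #|{: TA}|)%N) (TB_gt0 : (0 < #|{: TB}|)%N).
Variables (SA SB : {set 'I_n}).
Hypotheses (SAE : SA =i codom fa) (SBE : SB =i codom fb).
Hypothesis dis : forall i, i \in SA -> i \notin SB.
Hypothesis cover : forall i, (i \in SA) || (i \in SB).

Let dis_ab t t' : fa t != fb t'.
Proof.
apply/eqP=> E; have := @dis (fa t); rewrite SAE codom_f => /(_ isT).
by rewrite E SBE codom_f.
Qed.

Let inj_ja : injective ja. Proof. by move=> x y E; apply: inj_fa; rewrite -!fcja E. Qed.
Let inj_jb : injective jb. Proof. by move=> x y E; apply: inj_fb; rewrite -!fcjb E. Qed.

Local Notation fab := (copair fa fb).
Let fab_inj : injective fab := copair_inj inj_fa inj_fb dis_ab.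
Let fab_fc t : fc (copair ja jb t) = fab t. Proof. by case: t => t /=. Qed.
Let jab_inj : injective (copair ja jb).
Proof. by move=> x y E; apply: fab_inj; rewrite -!fab_fc E. Qed.

(** The sign change on C1 + C2 corresponding to S and Q, through the common
    embedding in the coordinates. *)
Definition pullsign (S : {ffun TA -> bool}) (Q : {ffun TB -> bool}) : {ffun TC -> bool} :=
  [ffun c => ext fab (Sjoin S Q) (fc c)].

Lemma Phi_pair u w S Q : (Phi fa (sp u S) * Phi fb (sp w Q))%g =
  Phi fc (sp (emb ja u * emb jb w) (pullsign S Q)).
Proof.
have [Ql Qr] := SjoinK S Q.
transitivity (Phi fab (sp (sumperm u w) (Sjoin S Q))).
  by rewrite (Phi_split fab_inj) Ql Qr.
rewrite (Phi_sp fab_inj) (Phi_sp inj_fc); congr sp.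
  have -> : (emb ja u * emb jb w)%g = emb (copair ja jb) (sumperm u w).
    by rewrite [RHS]embM // (emb_comp _ (@inl_inj _ _)) // (emb_comp _ (@inr_inj _ _)).
  by rewrite emb_comp //; apply: eq_emb => t; rewrite fab_fc.
apply/ffunP=> i; have /codomP[c ->] := fc_onto i.
by rewrite [RHS](ext_in inj_fc) [RHS]ffunE.
Qed.

Lemma lamc_pullsign (c : TC -> bool) S Q :
  lamc c (pullsign S Q) = lamc (fun t => c (ja t)) S (+) lamc (fun t => c (jb t)) Q.
Proof.
have jab_onto x : x \in codom (copair ja jb).
  have : fc x \in codom fab.
    have /orP[] := cover (fc x); rewrite ?SAE ?SBE => /codomP[t E].
      by rewrite E -[fa t]/(fab (inl t)) codom_f.
    by rewrite E -[fb t]/(fab (inr t)) codom_f.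
  by case/codomP=> t; rewrite -fab_fc => /inj_fc->; apply: codom_f.
have [Ql Qr] := SjoinK S Q.
transitivity (lamc (fun t => c (copair ja jb t)) (Sjoin S Q)); last by rewrite lamc_join Ql Qr.
rewrite /lamc (reindex (copair ja jb)) /=; last first.
  apply: onW_bij; apply: (inj_card_bij jab_inj); rewrite -(card_codom jab_inj).
  by apply/subset_leq_card/subsetP=> x _.
apply: eq_bigr => t _; congr (_ && _).
by rewrite ffunE fab_fc (ext_in fab_inj).
Qed.

Variables (FA : {perm TA} -> K) (FB : {perm TB} -> K) (FC : {perm TC} -> K).
Hypotheses (compA : compatible (@colour _ _) true FA) (compB : compatible (@colour _ _) true FB).
Variables (A B X : {ffun sperm n -> K}).
Hypothesis A_val : forall v S, inW true S -> A (Phi fa (sp v S)) = Theta (@colour _ _) FA v S.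
Hypothesis B_val : forall v S, inW true S -> B (Phi fb (sp v S)) = Theta (@colour _ _) FB v S.
Hypothesis X_val : forall v S, inW true S -> X (Phi fc (sp v S)) = Theta (@colour _ _) FC v S.
Variables (WA WB W : {group sperm n}).
Hypotheses (WAE : WA :=: WS SA true) (WBE : WB :=: WS SB true).
Hypotheses (sAW : WA \subset W) (sBW : WB \subset W).
Hypothesis classX : classfun W X.

Let cAB : (WB \subset 'C(WA))%g. Proof. by rewrite WAE WBE WS_cent. Qed.
Let tiAB : (WA :&: WB = 1)%g. Proof. by rewrite WAE WBE WS_TI. Qed.
Let comm u v : u \in WA -> v \in WB -> (u * v = v * u)%g.
Proof. by move=> Au Bv; have /centP/(_ u Au) := subsetP cAB v Bv. Qed.

Lemma ip_join : ip (WA <*> WB) (boxprod WA WB A B) X =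
  ip WA A (fun u => ip WB B (fun v => X (u * v)%g)).
Proof.
rewrite /ip /= card_join // big_join // natrM invfM -mulrA; congr (_ * _).
rewrite mulr_sumr; apply: eq_bigr => u Au; rewrite mulrCA; congr (_ * _).
rewrite mulr_sumr; apply: eq_bigr => v Bv.
rewrite comm // invMg boxprodE ?groupV // -comm //.
by rewrite mulrA.
Qed.

Lemma pairing_signed : ip (WA <*> WB) (boxprod WA WB A B) X =
  \sum_u \sum_(S | inW true S) \sum_w \sum_(Q | inW true Q)
     zfun (@colour _ _) true FA (sp u S) * (zfun (@colour _ _) true FB (sp w Q) *
       Theta (@colour _ _) FC (emb ja u * emb jb w)%g (pullsign S Q)).
Proof.
have WAE' : WA = WS SA true by apply: val_inj.
have WBE' : WB = WS SB true by apply: val_inj.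
have inA x : x \in Wg TA true -> Phi fa x \in WA by rewrite WAE' (Phi_WS inj_fa SAE).
have inB x : x \in Wg TB true -> Phi fb x \in WB by rewrite WBE' (Phi_WS inj_fb SBE).
have XJ u v y : u \in WA -> v \in WB -> y \in W -> X ((u * v) ^ y)%g = X (u * v)%g.
  by move=> Au Bv Wy; apply: classX => //; rewrite groupM ?(subsetP sAW u) ?(subsetP sBW v).
have ipA (f : sperm n -> K) : classfun WA f ->
    ip WA A f = \sum_(x in Wg TA true) zfun (@colour _ _) true FA x * f (Phi fa x).
  move=> cf; rewrite {1}WAE' (ip_Phi inj_fa SAE) -(ip_ch charK); last first.
    by move=> x y Wx Wy; rewrite (PhiJ inj_fa) cf ?inA.
  apply: eq_ip => // _ /WgP[v [S [eS ->]]].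
  by rewrite A_val // -(@ch_zfun _ _ _ charK true).
have ipB (f : sperm n -> K) : classfun WB f ->
    ip WB B f = \sum_(x in Wg TB true) zfun (@colour _ _) true FB x * f (Phi fb x).
  move=> cf; rewrite {1}WBE' (ip_Phi inj_fb SBE) -(ip_ch charK); last first.
    by move=> x y Wx Wy; rewrite (PhiJ inj_fb) cf ?inB.
  apply: eq_ip => // _ /WgP[v [S [eS ->]]].
  by rewrite B_val // -(@ch_zfun _ _ _ charK true).
have classB u : u \in WA -> classfun WB (fun v => X (u * v)%g).
  move=> Au v y Bv By; rewrite -(XJ u v y) ?(subsetP sBW y) // conjMg.
  by congr (X (_ * _)%g); rewrite conjgE (comm Au By) mulKg.
have classA : classfun WA (fun u => ip WB B (fun v => X (u * v)%g)).
  move=> u y Au Ay; apply: eq_ip => // v Bv.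
  rewrite -(XJ u v y) ?(subsetP sAW y) // conjMg.
  by congr (X (_ * _)%g); rewrite conjgE -(comm Ay Bv) mulKg.
rewrite ip_join ipA // big_Wg; apply: eq_bigr => u _; apply: eq_bigr => S eS.
rewrite ipB ?big_Wg; last by apply/classB/inA; rewrite sp_Wg.
rewrite mulr_sumr; apply: eq_bigr => w _; rewrite mulr_sumr; apply: eq_bigr => Q eQ.
rewrite Phi_pair X_val // /inW /= /par lamc_pullsign /=.
by move: eS eQ; rewrite /inW /= /par => /negPf-> /negPf->.
Qed.

(** Each of the two averages over sign changes is evaluated by [avg_even]; the
    surviving y are the aligned ones. *)
Lemma ip_triple_sum : ip (WA <*> WB) (boxprod WA WB A B) X = triple_sum ja jb FA FB FC.
Proof.
rewrite pairing_signed.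
pose avgA (y : {perm TC}) := \sum_(S : {ffun TA -> bool} | inW true S) (-1) ^+ lamc (@colour _ _) S * (-1) ^+ lamc (fun t => colour (y (ja t))) S / Neven K TA true.
pose avgB (y : {perm TC}) := \sum_(S : {ffun TB -> bool} | inW true S) (-1) ^+ lamc (@colour _ _) S * (-1) ^+ lamc (fun t => colour (y (jb t))) S / Neven K TB true.
transitivity (\sum_u \sum_w \sum_y FA u * FB w * FC (((emb ja u * emb jb w)^-1) ^ y)%g * (avgA y * avgB y)).
  apply: eq_bigr => u _; rewrite exchange_big; apply: eq_bigr => w _ /=.
  transitivity (\sum_(S | inW true S) \sum_(Q | inW true Q) \sum_y
    FA u * FB w * FC (((emb ja u * emb jb w)^-1) ^ y)%g *
    (((-1) ^+ lamc (@colour _ _) S * (-1) ^+ lamc (fun t => colour (y (ja t))) S / Neven K TA true) *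
    ((-1) ^+ lamc (@colour _ _) Q * (-1) ^+ lamc (fun t => colour (y (jb t))) Q / Neven K TB true))).
    apply: eq_bigr => S eS; apply: eq_bigr => Q eQ.
    rewrite !zfun_sp // /Theta !mulr_sumr; apply: eq_bigr => y _.
    rewrite lamc_pullsign signr_addb.
    move: (FA u) (FB w) (FC _) (Neven K TA true)^-1 (Neven K TB true)^-1 (_ ^+ lamc _ S) (_ ^+ lamc _ S) (_ ^+ lamc _ Q) (_ ^+ lamc _ Q).
    by move=> *; ring.
  under [LHS]eq_bigr do rewrite exchange_big.
  rewrite exchange_big; apply: eq_bigr => y _ /=.
  rewrite /avgA /avgB mulr_suml mulr_sumr; apply: eq_bigr => S _.
  by rewrite mulr_sumr mulr_sumr.
transitivity (\sum_(sa : bool) \sum_(sb : bool) \sum_y \sum_u \sum_w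
   (aligned ja jb sa sb y)%:R * (FA u * FB w * FC (((emb ja u * emb jb w)^-1) ^ y)%g)); last first.
  apply: eq_bigr => sa _; apply: eq_bigr => sb _; rewrite /aligned_sum [RHS]big_mkcond.
  apply: eq_bigr => y _; case: ifP => _.
    by apply: eq_bigr => u _; apply: eq_bigr => w _; rewrite mul1r.
  by rewrite big1 // => u _; rewrite big1 // => w _; rewrite mul0r.
under [RHS]eq_bigr do rewrite exchange_big.
rewrite [RHS]exchange_big.
transitivity (\sum_y \sum_u \sum_w FA u * FB w * FC (((emb ja u * emb jb w)^-1) ^ y)%g * (avgA y * avgB y)).
  under [LHS]eq_bigr do rewrite exchange_big.
  by rewrite exchange_big.
apply: eq_bigr => y _ /=.
have -> : avgA y * avgB y = \sum_(sa : bool) \sum_(sb : bool) (aligned ja jb sa sb y)%:R.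
  rewrite /avgA /avgB !avg_even // mulr_suml; apply: eq_bigr => sa _.
  by rewrite mulr_sumr; apply: eq_bigr => sb _; rewrite -natrM mulnb.
under [RHS]eq_bigr do rewrite exchange_big.
rewrite [RHS]exchange_big; apply: eq_bigr => u _ /=.
under [RHS]eq_bigr do rewrite exchange_big.
rewrite [RHS]exchange_big; apply: eq_bigr => w _ /=.
rewrite mulr_sumr; apply: eq_bigr => sa _; rewrite mulr_sumr; apply: eq_bigr => sb _.
exact: mulrC.
Qed.

End PairingFormula.

(** * The formula *)

Section TripleSums.

Variables (K : fieldType).
Hypothesis charK : [pchar K] =i pred0.

Definition LRprod (l m g : seq nat * seq nat) : K :=
  (LRcoef K l.1 m.1 g.1)%:R * (LRcoef K l.2 m.2 g.2)%:R.
Definition swap_pair (l : seq nat * seq nat) := (l.2, l.1).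

(** One term for each of the four orderings of the pairs l and m. *)
Lemma triple_FR (l1 l2 m1 m2 g1 g2 : seq nat)
   (ja : ('I_(sumn l1) + 'I_(sumn l2))%type -> ('I_(sumn g1) + 'I_(sumn g2))%type)
   (jb : ('I_(sumn m1) + 'I_(sumn m2))%type -> ('I_(sumn g1) + 'I_(sumn g2))%type) :
   injective ja -> injective jb -> (forall t t', ja t != jb t') ->
   (sumn l1 + sumn l2 + (sumn m1 + sumn m2) = sumn g1 + sumn g2)%N ->
  triple_sum ja jb (FR (yidem K l1) (yidem K l2)) (FR (yidem K m1) (yidem K m2))
    (FR (yidem K g1) (yidem K g2)) =
  let l := (l1, l2) in let m := (m1, m2) in let g := (g1, g2) in
  LRprod l m g + LRprod (swap_pair l) m g + LRprod l (swap_pair m) g + LRprod (swap_pair l) (swap_pair m) g.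
Proof.
move=> inj_a inj_b dis tot /=.
have swl_inj : injective (fun t => ja (sumswap t)) by move=> x y /inj_a/sumswap_inj.
have swr_inj : injective (fun t => jb (sumswap t)) by move=> x y /inj_b/sumswap_inj.
have tl : (sumn l2 + sumn l1 + (sumn m1 + sumn m2) = sumn g1 + sumn g2)%N by rewrite [(sumn l2 + _)%N]addnC.
have tr : (sumn l1 + sumn l2 + (sumn m2 + sumn m1) = sumn g1 + sumn g2)%N by rewrite [(sumn m2 + _)%N]addnC.
have tlr : (sumn l2 + sumn l1 + (sumn m2 + sumn m1) = sumn g1 + sumn g2)%N by rewrite [(sumn m2 + _)%N]addnC.
rewrite /triple_sum !big_bool /= !aligned_FR_swapl // !aligned_FR_swapr // /LRprod /=.
rewrite !aligned_FR //; try by move=> *; apply: dis.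
by move: (_ * _) (_ * _) (_ * _) (_ * _) => p q r s; ring.
Qed.

(** The four terms are equal. *)
Lemma triple_FD (l m g : seq nat)
   (ja : ('I_(sumn l) + 'I_(sumn l))%type -> ('I_(sumn g) + 'I_(sumn g))%type)
   (jb : ('I_(sumn m) + 'I_(sumn m))%type -> ('I_(sumn g) + 'I_(sumn g))%type) :
   injective ja -> injective jb -> (forall t t', ja t != jb t') ->
   (sumn l + sumn m = sumn g)%N ->
  triple_sum ja jb (FD (yidem K l)) (FD (yidem K m)) (FD (yidem K g)) =
  4%:R * (LRcoef K l m g)%:R.
Proof.
move=> inj_a inj_b dis tot.
have swl_inj : injective (fun t => ja (sumswap t)) by move=> x y /inj_a/sumswap_inj.
have swr_inj : injective (fun t => jb (sumswap t)) by move=> x y /inj_b/sumswap_inj.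
have H : (0 + sumn l <= sumn g)%N by rewrite add0n -tot leq_addr.
have L : (sumn l + sumn m <= sumn g)%N by rewrite tot.
rewrite /triple_sum !big_bool /= !aligned_FD_swapl // !aligned_FD_swapr //.
rewrite !aligned_FD //; try by move=> *; apply: dis.
by ring.
Qed.

(** When the sizes do not match, one of the two coefficients is 0. *)
Lemma acoef_ordered (l m g : seq nat * seq nat) :
  (acoef K l m g)%:R = \sum_(p <- orderings l) \sum_(q <- orderings m) LRprod p q g.
Proof.
rewrite /acoef natr_sum; apply: eq_bigr => p _; rewrite natr_sum.
rewrite big_mkcond /=; apply: eq_bigr => q _; rewrite /LRprod natrM; case: ifPn => //.
by rewrite /LRcoef ![_ == sumn _]eq_sym negb_and => /orP[]/negPf->; rewrite ?mul0r ?mulr0.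
Qed.

End TripleSums.

Lemma triple_scale (K : fieldType) (A1 A2 B1 B2 C1 C2 : finType) (ja : A1 + A2 -> C1 + C2) (jb : B1 + B2 -> C1 + C2)
    FA FB FC (p q r : K) :
  triple_sum ja jb (fun u => p * FA u) (fun u => q * FB u) (fun u => r * FC u) = p * q * r * triple_sum ja jb FA FB FC.
Proof.
rewrite /triple_sum !mulr_sumr; apply: eq_bigr => sa _; rewrite !mulr_sumr; apply: eq_bigr => sb _.
rewrite !mulr_sumr; apply: eq_bigr => y _; rewrite !mulr_sumr; apply: eq_bigr => u _.
by rewrite !mulr_sumr; apply: eq_bigr => w _; ring.
Qed.

(** The part of a labelled character supported on the permutations exchanging the
    colours.  The equality of the two diagrams in the degenerate case is an
    equality of indices, so that [FD] is well typed. *)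
Inductive swap_part (K : fieldType) : forall (l1 l2 : seq nat) (s : bool),
    ({perm ('I_(sumn l1) + 'I_(sumn l2))%type} -> K) -> Prop :=
| NoSwap l1 l2 s : l1 != l2 -> @swap_part K l1 l2 s (fun=> 0)
| Swap l s : @swap_part K l l s (fun u => (-1) ^+ sumn l * (-1) ^+ s * FD (yidem K l) u).

Section Labelled.

Variables (K : fieldType).
Hypothesis charK : [pchar K] =i pred0.

Definition epsK (l1 l2 : seq nat) (s : bool) : K := if l1 == l2 then (-1) ^+ s else 0.
Definition dweight (l1 l2 : seq nat) : K := if l1 == l2 then 2%:R^-1 else 1.
Definition label_fun (l1 l2 : seq nat) (D : {perm ('I_(sumn l1) + 'I_(sumn l2))%type} -> K) v : K :=
  dweight l1 l2 * FR (yidem K l1) (yidem K l2) v + dweight l1 l2 * D v.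

Lemma FR_flip (A1 A2 : finType) (e1 : {perm A1} -> K) (e2 : {perm A2} -> K) u :
  FR e1 e2 u != 0 -> forall t, colour (u t) = colour t (+) false.
Proof. by move=> /FR_colour cu t; rewrite addbF. Qed.

Lemma swap_part_flip l1 l2 s D : @swap_part K l1 l2 s D ->
  forall u, D u != 0 -> forall t, colour (u t) = colour t (+) true.
Proof.
move=> swD; case: l1 l2 s D / swD => [l1 l2 s _ u|l s u]; first by rewrite eqxx.
by rewrite mulf_eq0 => /norP[_ /FD_colour cu] t; rewrite addbT.
Qed.

Lemma compatible_label l1 l2 s D : @swap_part K l1 l2 s D ->
  compatible (@colour _ _) true (@label_fun l1 l2 D).
Proof.
move=> swD v; rewrite /label_fun.
have [nR|nR _] := eqVneq (FR (yidem K l1) (yidem K l2) v) 0.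
  have [->|nD _] := eqVneq (D v) 0; first by rewrite nR !mulr0 addr0 eqxx.
  by exists true => // t; exact: swap_part_flip swD _ nD t.
by exists false => // t; exact: FR_flip nR t.
Qed.

Lemma epsK_sign l1 l2 s : l1 = l2 -> epsK l1 l2 s = (-1) ^+ s.
Proof. by move=> ->; rewrite /epsK eqxx. Qed.

(** The sign (-1)^(|l| + |m| + |g|) is 1 because |g| = |l| + |m|. *)
Lemma triple_swap_part l1 l2 m1 m2 g1 g2 sA sB sX
   (ja : ('I_(sumn l1) + 'I_(sumn l2))%type -> ('I_(sumn g1) + 'I_(sumn g2))%type)
   (jb : ('I_(sumn m1) + 'I_(sumn m2))%type -> ('I_(sumn g1) + 'I_(sumn g2))%type) DA DB DC :
   injective ja -> injective jb -> (forall t t', ja t != jb t') ->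
   (sumn l1 + sumn l2 + (sumn m1 + sumn m2) = sumn g1 + sumn g2)%N ->
   @swap_part K l1 l2 sA DA -> @swap_part K m1 m2 sB DB -> @swap_part K g1 g2 sX DC ->
  triple_sum ja jb DA DB DC =
    4%:R * (epsK l1 l2 sA * epsK m1 m2 sB * epsK g1 g2 sX * (LRcoef K l1 m1 g1)%:R).
Proof.
move=> inj_a inj_b dis tot swA swB swC.
have zero (H : epsK l1 l2 sA * epsK m1 m2 sB * epsK g1 g2 sX = 0) :
    (forall u w y, DA u * DB w * DC y = 0) -> triple_sum ja jb DA DB DC =
    4%:R * (epsK l1 l2 sA * epsK m1 m2 sB * epsK g1 g2 sX * (LRcoef K l1 m1 g1)%:R).
  move=> z; rewrite H mul0r mulr0 /triple_sum big1 // => sa _; rewrite big1 // => sb _.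
  by rewrite /aligned_sum big1 // => y _; rewrite big1 // => u _; rewrite big1.
case: l1 l2 sA DA / swA ja inj_a dis tot zero => [l1 l2 sA nl|l sA] ja inj_a dis tot zero.
  apply: zero => [|u w y]; last by rewrite !mul0r.
  by rewrite {1}/epsK (negPf nl) !mul0r.
case: m1 m2 sB DB / swB jb inj_b dis tot zero => [m1 m2 sB nm|m sB] jb inj_b dis tot zero.
  apply: zero => [|u w y]; last by rewrite mulr0 mul0r.
  by rewrite {2}/epsK (negPf nm) mulr0 mul0r.
case: g1 g2 sX DC / swC ja jb inj_a inj_b dis tot zero => [g1 g2 sX ng|g sX] ja jb inj_a inj_b dis tot zero.
  apply: zero => [|u w y]; last by rewrite mulr0.
  by rewrite {3}/epsK (negPf ng) mulr0.
have lmg : (sumn l + sumn m = sumn g)%N.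
  by apply: double_inj; rewrite -!addnn -tot addnACA.
have E := triple_FD charK inj_a inj_b dis lmg.
rewrite triple_scale E !epsK_sign //.
have : (-1) ^+ sumn l * (-1) ^+ sumn m * (-1) ^+ sumn g = 1 :> K.
  by rewrite -lmg -!exprD -signr_odd !oddD addbb.
set x := (-1) ^+ sumn l; set y := (-1) ^+ sumn m; set z := (-1) ^+ sumn g => xyz.
transitivity (x * y * z * (4%:R * ((-1) ^+ sA * (-1) ^+ sB * (-1) ^+ sX * (LRcoef K l m g)%:R))); last by rewrite xyz mul1r.
by ring.
Qed.

(** Of the eight products of preserving and exchanging parts only two survive.
    The weights 1/2 of degenerate A and B compensate for the fact that
    [triple_FR] counts every ordering of a pair of equal diagrams twice. *)
Lemma triple_labelled l1 l2 m1 m2 g1 g2 sA sB sX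
   (ja : ('I_(sumn l1) + 'I_(sumn l2))%type -> ('I_(sumn g1) + 'I_(sumn g2))%type)
   (jb : ('I_(sumn m1) + 'I_(sumn m2))%type -> ('I_(sumn g1) + 'I_(sumn g2))%type) DA DB DC :
   injective ja -> injective jb -> (forall t t', ja t != jb t') ->
   (0 < sumn l1 + sumn l2)%N -> (0 < sumn m1 + sumn m2)%N ->
   (sumn l1 + sumn l2 + (sumn m1 + sumn m2) = sumn g1 + sumn g2)%N ->
   @swap_part K l1 l2 sA DA -> @swap_part K m1 m2 sB DB -> @swap_part K g1 g2 sX DC ->
  let c := (acoef K (l1, l2) (m1, m2) (g1, g2))%:R in
  triple_sum ja jb (label_fun DA) (label_fun DB) (label_fun DC) = if g1 != g2 then c else
    (c + epsK l1 l2 sA * epsK m1 m2 sB * epsK g1 g2 sX * (LRcoef K l1 m1 g1)%:R) / 2%:R.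
Proof.
move=> inj_a inj_b dis lgt0 mgt0 tot swA swB swC /=.
have cardA : (0 < #|{: ('I_(sumn l1) + 'I_(sumn l2))}|)%N by rewrite card_sum !card_ord.
have cardB : (0 < #|{: ('I_(sumn m1) + 'I_(sumn m2))}|)%N by rewrite card_sum !card_ord.
have n2 : (2%:R : K) != 0 by apply: natrK_neq0.
have mix (FA : {perm ('I_(sumn l1) + 'I_(sumn l2))%type} -> K) (FB : {perm ('I_(sumn m1) + 'I_(sumn m2))%type} -> K)
    (FC : {perm ('I_(sumn g1) + 'I_(sumn g2))%type} -> K) (ca cb cc : bool) :
    (forall u, FA u != 0 -> forall t, colour (u t) = colour t (+) ca) ->
    (forall u, FB u != 0 -> forall t, colour (u t) = colour t (+) cb) ->
    (forall u, FC u != 0 -> forall t, colour (u t) = colour t (+) cc) ->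
    (ca != cc) || (cb != cc) -> triple_sum ja jb FA FB FC = 0.
  move=> hA hB hC ne; rewrite /triple_sum big1 // => sa _; rewrite big1 // => sb _.
  exact: (aligned_mixed sa sb inj_a inj_b dis hA hB hC cardA cardB ne).
have flA := swap_part_flip swA; have flB := swap_part_flip swB; have flC := swap_part_flip swC.
have frA := @FR_flip _ _ (yidem K l1) (yidem K l2).
have frB := @FR_flip _ _ (yidem K m1) (yidem K m2).
have frC := @FR_flip _ _ (yidem K g1) (yidem K g2).
rewrite /label_fun triple_linA !triple_linB !triple_linC.
rewrite (mix _ _ _ _ _ _ frA frB flC) // (mix _ _ _ _ _ _ frA flB frC) // (mix _ _ _ _ _ _ frA flB flC) //.
rewrite (mix _ _ _ _ _ _ flA frB frC) // (mix _ _ _ _ _ _ flA frB flC) // (mix _ _ _ _ _ _ flA flB frC) //.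
rewrite (triple_FR charK inj_a inj_b dis tot) (triple_swap_part inj_a inj_b dis tot swA swB swC).
rewrite acoef_ordered /orderings /dweight /epsK /=.
move: (LRcoef K l1 m1 g1)%:R => c {mix flA flB flC frA frB frC DA DB DC swA swB swC ja jb inj_a inj_b dis tot lgt0 mgt0 cardA cardB}.
have [E|_] := eqVneq l1 l2; have [E'|_] := eqVneq m1 m2; have [E''|_] := eqVneq g1 g2; subst=> //=;
  rewrite ?big_cons ?big_nil /swap_pair /=; do ?move: (LRprod _ _ _ _) => ?; by field.
Qed.

End Labelled.

Lemma label_swap_part (K : fieldType) (charK : [pchar K] =i pred0) n k (W : {group sperm n})
    (H : bool -> {group sperm n}) l1 l2 (s : bool) (X : {ffun sperm n -> K}) (t0 : 'I_n)
    (le1 : (k + sumn l1 <= n)%N) (le2 : (k + sumn l1 + sumn l2 <= n)%N) :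
    (0 < sumn l1 + sumn l2)%N ->
    W :=: WS (window n k (sumn l1 + sumn l2)) true ->
    t0 \in window n k (sumn l1 + sumn l2) ->
    (l1 = l2 -> H s :=: LS (window n k (sumn l1 + sumn l2)) :^ (flip t0 ^+ s))%g ->
    has_label k (sumn l1 + sumn l2) W H (l1, l2) s X ->
  exists2 D, @swap_part K l1 l2 s D & forall v S, inW true S ->
    X (Phi (wsum le1 le2) (sp v S)) = Theta (@colour _ _) (label_fun D) v S.
Proof.
have [E|nl] := eqVneq l1 l2; last first.
  move=> _ WE _ _ labX; exists (fun=> 0); first exact: NoSwap.
  move=> v S eS; rewrite (label_nondeg charK le1 le2 WE nl labX v eS).
  apply: eq_bigr => y _; rewrite /label_fun /dweight (negPf nl).
  by rewrite mulr0 addr0 mul1r.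
subst l2 => l_gt0 WE t0W /(_ (erefl _)) HE labX.
exists (fun u => (-1) ^+ sumn l1 * (-1) ^+ s * FD (yidem K l1) u); first exact: Swap.
move=> v S eS; have lgt0 : (0 < sumn l1)%N by move: l_gt0; rewrite addnn double_gt0.
rewrite (label_deg charK lgt0 le1 le2 WE t0W HE labX v eS).
apply: eq_bigr => y _; congr (_ * _); rewrite /label_fun /dweight eqxx /Fpm.
by rewrite !mulrA.
Qed.

(** The identities are between natural numbers, once the negative terms are moved
    to the other side; so they do not depend on the field. *)
Lemma sign_transfer (K K' : fieldType) : [pchar K] =i pred0 -> [pchar K'] =i pred0 ->
  forall (d c r : nat) (e : bool), d%:R = (c%:R + (-1) ^+ e * r%:R) / 2%:R :> K ->
  d%:R = (c%:R + (-1) ^+ e * r%:R) / 2%:R :> K'.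
Proof.
move=> charK charK' d c r e E.
have n2 : (2%:R : K) != 0 by apply: natrK_neq0.
have n2' : (2%:R : K') != 0 by apply: natrK_neq0.
have {}E : (d%:R * 2%:R = c%:R + (-1) ^+ e * r%:R :> K) by rewrite E divfK.
apply: (mulIf n2'); rewrite divfK //; case: e E => E.
  have EN : (d * 2 + r = c)%N.
    by apply: (natrK_inj charK); rewrite natrD natrM E expr1 mulN1r subrK.
  by rewrite -EN natrD natrM expr1 mulN1r addrK.
have EN : (d * 2 = c + r)%N by apply: (natrK_inj charK); rewrite natrD natrM E mul1r.
by rewrite mul1r -natrD -EN natrM.
Qed.

Theorem proposition2p7 (K : fieldType) (charK : [pchar K] =i pred0)
  (n a b : nat) (n_ge4 : (4 <= n)%N) (a_gt0 : (0 < a)%N) (b_gt0 : (0 < b)%N)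
  (abn : (a + b = n)%N)
  (A B E X : {ffun sperm n -> K})
  (al be ga : seq nat * seq nat) (sA sB sX : bool)
  (al_bip : is_bipartition a al) (be_bip : is_bipartition b be)
  (ga_bip : is_bipartition n ga)
  (irrA : irrchar (Wleft n a) A) (irrB : irrchar (Wright n a b) B)
  (irrE : irrchar (WaWb n a) E)
  (defE : E = boxprod (Wleft n a) (Wright n a b) A B)
  (labA : has_label 0 a (Wleft n a) (Hleft n a) al sA A)
  (labB : has_label a b (Wright n a b) (Hright n a) be sB B)
  (irrX : irrchar (Wfull n) X)
  (labX : has_label 0 n (Wfull n) (Hfull n) ga sX X) :
  (mult (Wfull n) (indf (WaWb n a) (Wfull n) E) X)%:R =
    (if ga.1 != ga.2 then (acoef K al be ga)%:R
     else ((acoef K al be ga)%:R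
           + eps al sA * eps be sB * eps ga sX
             * (LRcoef K al.1 be.1 ga.1)%:R) / 2) :> rat.
Proof.
case: al al_bip labA => l1 l2 /and3P[_ _ /eqP/= aE] labA.
case: be be_bip labB => m1 m2 /and3P[_ _ /eqP/= bE] labB.
case: ga ga_bip labX => g1 g2 /and3P[_ _ /eqP/= nE] labX.
have a_n : (0 < a < n)%N by rewrite a_gt0 -abn -addn1 leq_add2l.
have la1 : (0 + sumn l1 <= n)%N by rewrite add0n -abn -aE -addnA leq_addr.
have la2 : (0 + sumn l1 + sumn l2 <= n)%N by rewrite add0n -abn -aE leq_addr.
have lb1 : (a + sumn m1 <= n)%N by rewrite -abn -bE leq_add2l leq_addr.
have lb2 : (a + sumn m1 + sumn m2 <= n)%N by rewrite -abn -bE addnA.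
have lc1 : (0 + sumn g1 <= n)%N by rewrite add0n -nE leq_addr.
have lc2 : (0 + sumn g1 + sumn g2 <= n)%N by rewrite add0n -nE.
have WAE : Wleft n a :=: WS (window n 0 (sumn l1 + sumn l2)) true by rewrite aE Wleft_WS.
have WBE : Wright n a b :=: WS (window n a (sumn m1 + sumn m2)) true by rewrite bE Wright_WS.
have WXE : Wfull n :=: WS (window n 0 (sumn g1 + sumn g2)) true by rewrite nE Wfull_WS //; lia.
have n0 : (0 < n)%N by lia.
have n1 : (n.-1 < n)%N by lia.
have two k l : l = k -> (0 < l + k)%N -> (1 < l + k)%N by lia.
have la_gt0 : (0 < sumn l1 + sumn l2)%N by rewrite aE.
have lb_gt0 : (0 < sumn m1 + sumn m2)%N by rewrite bE.
have lc_gt0 : (0 < sumn g1 + sumn g2)%N by rewrite nE.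
have [DA swA valA] : exists2 D, @swap_part K l1 l2 sA D & forall v S, inW true S ->
    A (Phi (wsum la1 la2) (sp v S)) = Theta (@colour _ _) (label_fun D) v S.
  rewrite -[X in has_label 0 X]aE in labA.
  have in_win : Ordinal n0 \in window n 0 (sumn l1 + sumn l2) by rewrite inE.
  apply: (label_swap_part charK la1 la2 la_gt0 WAE in_win _ labA) => ll; rewrite aE.
  apply: Hleft_LS => //; last by case/andP: a_n => _ /ltnW.
  by rewrite -aE two // ll.
have [DB swB valB] : exists2 D, @swap_part K m1 m2 sB D & forall v S, inW true S ->
    B (Phi (wsum lb1 lb2) (sp v S)) = Theta (@colour _ _) (label_fun D) v S.
  rewrite -[X in has_label a X]bE in labB.
  have in_win : Ordinal n1 \in window n a (sumn m1 + sumn m2) by rewrite inE /= bE; lia.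
  apply: (label_swap_part charK lb1 lb2 lb_gt0 WBE in_win _ labB) => ll; rewrite bE.
  apply: (@Hright_LS _ a b (fun s => if s then rcons (index_iota a.+1 n.-1) n else index_iota a.+1 n)) => //.
  by rewrite -bE two // ll.
have [DC swC valC] : exists2 D, @swap_part K g1 g2 sX D & forall v S, inW true S ->
    X (Phi (wsum lc1 lc2) (sp v S)) = Theta (@colour _ _) (label_fun D) v S.
  rewrite -[X in has_label 0 X]nE in labX.
  have in_win : Ordinal n1 \in window n 0 (sumn g1 + sumn g2) by rewrite inE /= nE; lia.
  apply: (label_swap_part charK lc1 lc2 lc_gt0 WXE in_win _ labX) => ll; rewrite nE.
  by apply: (@Hright_LS _ 0 n (fun s => if s then rcons (index_iota 1 n.-1) n else index_iota 1 n)) => //; lia.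
set fa := wsum la1 la2 in valA; set fb := wsum lb1 lb2 in valB; set fc := wsum lc1 lc2 in valC.
have inj_fa : injective fa := @wsum_inj _ _ _ _ la1 la2.
have inj_fb : injective fb := @wsum_inj _ _ _ _ lb1 lb2.
have inj_fc : injective fc := @wsum_inj _ _ _ _ lc1 lc2.
have [fcV fcK fcVK] : bijective fc.
  by apply: inj_card_bij; rewrite // card_sum !card_ord nE.
(* the cells of A and of B, placed among those of X through the common coordinates *)
pose ja t := fcV (fa t); pose jb t := fcV (fb t).
have SAE := wsum_codom la1 la2; have SBE := wsum_codom lb1 lb2.
have dis i : i \in window n 0 (sumn l1 + sumn l2) -> i \notin window n a (sumn m1 + sumn m2).
  by rewrite !inE aE bE; lia.
have cover i : (i \in window n 0 (sumn l1 + sumn l2)) || (i \in window n a (sumn m1 + sumn m2)).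
  by rewrite !inE aE bE; have := ltn_ord i; lia.
have sWaWb : (Wleft n a <*> Wright n a b)%G \subset Wfull n.
  rewrite join_subG WAE WBE WXE.
  by rewrite !WS_mono //; apply/subsetP=> i; rewrite !inE nE ?aE ?bE; lia.
have charX := irrchar_char irrX.
have classX := classfun_char charX.
have TA_gt0 : (0 < #|{: ('I_(sumn l1) + 'I_(sumn l2))}|)%N by rewrite card_sum !card_ord aE.
have TB_gt0 : (0 < #|{: ('I_(sumn m1) + 'I_(sumn m2))}|)%N by rewrite card_sum !card_ord bE.
have fc_onto i : i \in codom fc by rewrite -(fcVK i) codom_f.
have fcja t : fc (ja t) = fa t by rewrite fcVK.
have fcjb t : fc (jb t) = fb t by rewrite fcVK.
have cAB : (Wright n a b \subset 'C(Wleft n a))%g by rewrite WAE WBE WS_cent.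
have sAW : Wleft n a \subset Wfull n by apply: subset_trans sWaWb; apply: joing_subl.
have sBW : Wright n a b \subset Wfull n by apply: subset_trans sWaWb; apply: joing_subr.
(* Frobenius reciprocity, then the evaluation of the pairing on the subgroup *)
have multE : (mult (Wfull n) (indf (WaWb n a) (Wfull n) E) X)%:R =
    triple_sum ja jb (label_fun DA) (label_fun DB) (label_fun DC).
  have WE : WaWb n a = (Wleft n a <*> Wright n a b)%G by apply/val_inj/WaWb_join.
  rewrite (mult_ip charK) //; last first.
    by apply: (is_char_indf charK); [rewrite WE | apply: irrchar_char].
  rewrite WE defE (indf_ip charK) //; last first.
    by move=> x xAB; have := boxprod_out cAB A B xAB; rewrite ffunE.
  rewrite -(ip_triple_sum charK inj_fa inj_fb inj_fc fcja fcjb fc_onto TA_gt0 TB_gt0 SAE SBE dis cover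
    (compatible_label swA) (compatible_label swB) valA valB valC WAE WBE sAW sBW classX).
  by apply: eq_ip => // x _; rewrite [RHS]ffunE.
have inj_ja : injective ja by move=> x y /(can_inj fcVK)/inj_fa.
have inj_jb : injective jb by move=> x y /(can_inj fcVK)/inj_fb.
have dis_j t t' : ja t != jb t'.
  apply/eqP=> /(can_inj fcVK) E'; have := dis (fa t).
  by rewrite SAE codom_f E' SBE codom_f => /(_ isT).
have tot : (sumn l1 + sumn l2 + (sumn m1 + sumn m2) = sumn g1 + sumn g2)%N by rewrite aE bE nE.
move: multE; rewrite (triple_labelled charK inj_ja inj_jb dis_j la_gt0 lb_gt0 tot swA swB swC) /=.
rewrite /eps /epsK /=; have charQ : [pchar rat] =i pred0 := Num.Theory.pchar_num _.
have [_|_] := eqVneq g1 g2; last by move/(natrK_inj charK)->.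
have zero (F : fieldType) (c : nat) : (c%:R + 0) / 2%:R = (c%:R + (-1) ^+ false * 0%:R) / 2%:R :> F.
  by rewrite mulr0.
case: eqP => _; last by rewrite !mul0r !zero; apply: sign_transfer.
case: eqP => _; last by rewrite !mulr0 !mul0r !zero; apply: sign_transfer.
by rewrite -!signr_addb; apply: sign_transfer.
Qed.
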